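(* There is a universal constant $r_0$ with $0<r_0<1$ such that the following holds: for every analytic function $f:\mathbb{D}\to\mathbb{C}$ with $f(0)=0$ and every $M>0$, if $A(M)<\pi M^2$, where $A(M)=\int_{\Omega(M)}|f'(z)|^2\,dA(z)$ and $\Omega(M)=\{z\in\mathbb{D}:|f(z)|<M\}$, then $f(r_0\mathbb{D})\subset D(0,M)$.
   Context: $\mathbb{D}=\{z\in\mathbb{C}:|z|<1\}$ is the open unit disk, $r_0\mathbb{D}=\{z\in\mathbb{C}:|z|<r_0\}$, and $D(0,M)=\{w\in\mathbb{C}:|w|<M\}$. The symbol $dA(z)$ denotes two-dimensional Lebesgue measure; the quantity $A(M)\in[0,+\infty]$ is the Euclidean area of $f(\Omega(M))$ counting multiplicity. ''Universal'' means that $r_0$ does not depend on $f$ or $M$. *)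

(* Defs.v *)
From HB Require Import structures.
From mathcomp Require Import all_boot all_order all_algebra.
From mathcomp Require Import complex.
From mathcomp Require Import all_classical all_reals all_analysis.

Set Implicit Arguments.
Unset Strict Implicit.
Unset Printing Implicit Defensive.

Import Order.TTheory GRing.Theory Num.Theory.
Import numFieldNormedType.Exports.

Local Open Scope complex_scope.
Local Open Scope ring_scope.
Local Open Scope classical_set_scope.

Definition disk {R : realType} (r : R) : set R[i] := [set z | `|z| < r%:C].

(* The regular module R[i]^o makes [derivable] and [derive1] refer to the limit
   of h^-1 * (f (z + h) - f z) as h tends to 0 in the complex plane.  The map
   is total; for A open, only its values on A matter. *)
Definition analytic_on {R : realType} (A : set R[i]) (f : R[i] -> R[i]) :=
  forall z, A z -> derivable (f : R[i]^o -> R[i]^o) z 1.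

Definition complex_derive {R : realType} (f : R[i] -> R[i]) (z : R[i]) : R[i] :=
  (f : R[i]^o -> R[i]^o)^`() z.

Definition sublevel {R : realType} (f : R[i] -> R[i]) (M : R) : set R[i] :=
  [set z | disk 1 z /\ `|f z| < M%:C].

(* dA is the product Lebesgue measure on R * R, (x, y) standing for x + i y.
   The norm on R[i] is R[i]-valued with zero imaginary part, hence Re. *)
Definition image_area {R : realType} (f : R[i] -> R[i]) (M : R) : \bar R :=
  (\int[(@lebesgue_measure R \x @lebesgue_measure R)%E]_(p in
     [set p : R * R | sublevel f M (p.1 +i* p.2)])
     (complex.Re (`|complex_derive f (p.1 +i* p.2)| ^+ 2))%:E)%E.

(* Main.v *)
Require Import Defs.
From HB Require Import structures.
From mathcomp Require Import all_boot all_order all_algebra.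
From mathcomp Require Import complex.
From mathcomp Require Import all_classical all_reals all_analysis.
From mathcomp Require Import measurable_realfun.
From mathcomp Require Import ring lra.
Import Order.TTheory GRing.Theory Num.Theory.
Import numFieldNormedType.Exports.
Set Implicit Arguments.
Unset Strict Implicit.
Unset Printing Implicit Defensive.
Local Open Scope complex_scope.
Local Open Scope ring_scope.
Local Open Scope classical_set_scope.

(** Let [f] be as in the theorem.  If [f] took every value of the disc
    [|w| < M], the area of its image, counted with multiplicity, would be at
    least [pi * M ^+ 2].  Hence [f] omits some [w] with [|w| < M]
    ([omitted_value]), and [w <> 0] as [f 0 = 0].  The function [F = 1 - f / w]
    has no zero in the unit disc and [F 0 = 1], so [F = cexp g] with [g 0 = 0]
    ([log_exists]).  Put [lam = M / |w| > 1]; then [|f z| >= M] means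
    [|1 - F z| >= lam].

    Suppose that [|f z0| >= M] with [z0] close to 0.  Let
    [b = max (1, lam - 1)] and [t = ln b].  The level line [Re g = t] passes
    through a point [p] with [|p| <= |z0|]: through 0 if [b = 1], and otherwise
    because [|F z0| >= lam - 1 = b], so that [Re g] goes from 0 to at least [t]
    between 0 and [z0].  How large is [g'] on this line?  The answer is a
    dichotomy with universal constants ([gradient_dichotomy]).

    Either [g'] is bounded on the line in a neighbourhood of 0.  By Hopf's lemma
    [Re g - t] is then bounded on a full disc around 0 ([level_control]), and so
    is [g'], by Schwarz's integral formula ([re_deriv_bound]).  Therefore
    [|g z0| <= 1 / 4] if [z0] is close enough to 0 ([small_log]), and [F z0] is
    too close to 1 for [|1 - F z0| >= lam].

    Or [g'] is large, of size [N], at a point where the line leaves room for a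
    disc of radius [rho] on which [g] is nearly affine and [rho * N] is as large
    as desired.  The image of this disc under [g] contains a large disc around a
    point of real part [t], hence many points of the form
    [t - ln 2 + 2 pi i k].  Near the preimage of each of them [F] is close to
    [b / 2], so [|1 - F| < lam] and [|f| < M]; moreover
    [|f'| = |w| |F| |g'|] is of order [M * N] there, on a square of side of order
    [1 / N].  Each square contributes a universal multiple of [M ^+ 2] to the
    area, and enough of them exceed [pi * M ^+ 2] ([crossing_area]), a
    contradiction.

    The function theory rests on Goursat's theorem for rectangles.  Pulled back
    by the exponential, it says that the mean of an analytic function over a
    circle does not depend on the radius ([mean_value]).  Applied to difference
    quotients this is Cauchy's formula; combined with the conjugate kernel it
    gives Schwarz's formula, and from there Harnack's inequality and Hopf's
    lemma.  That the image of [f] has large area if [f] omits nothing is proved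
    by averaging over small discs, with Tonelli's theorem and Fatou's lemma
    ([area_coverage]). *)

(** * The modulus as a real number *)

Section Modulus.
Context {R : realType}.
Implicit Types (z w h : R[i]) (x y : R).

(** The modulus with values in [R], where the order is total and real
    arithmetic applies; the norm of [R[i]] takes values in [R[i]]. *)
Definition cabs z : R := Num.sqrt (complex.Re z ^+ 2 + complex.Im z ^+ 2).

Lemma normE z : `|z| = (cabs z)%:C.
Proof. by rewrite normc_def. Qed.

Lemma cabs_sq z : cabs z ^+ 2 = complex.Re z ^+ 2 + complex.Im z ^+ 2.
Proof. by rewrite sqr_sqrtr// addr_ge0// sqr_ge0. Qed.

Lemma cabs_ge0 z : 0 <= cabs z. Proof. exact: sqrtr_ge0. Qed.
Hint Extern 0 (is_true (_ <= cabs _)) => solve [apply: cabs_ge0] : core.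

Lemma cabsM z w : cabs (z * w) = cabs z * cabs w.
Proof. by apply: complexI; rewrite rmorphM/= -!normE normrM. Qed.

Lemma cabsN z : cabs (- z) = cabs z.
Proof. by apply: complexI; rewrite -!normE normrN. Qed.

Lemma cabsD z w : cabs (z + w) <= cabs z + cabs w.
Proof. by rewrite -lecR rmorphD/= -!normE ler_normD. Qed.

Lemma cabsB z w : cabs (z - w) <= cabs z + cabs w.
Proof. by rewrite -(cabsN w) cabsD. Qed.

Lemma cabsC z w : cabs (z - w) = cabs (w - z).
Proof. by rewrite -cabsN opprB. Qed.

Lemma cabs_tri u z w : cabs (z - w) <= cabs (z - u) + cabs (u - w).
Proof. by rewrite -(subrKA u) cabsD. Qed.

Lemma cabsBge z w : cabs z - cabs w <= cabs (z - w).
Proof. by rewrite lerBlDr -{1}(subrK w z) cabsD. Qed.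

Lemma cabsV z : cabs z^-1 = (cabs z)^-1.
Proof. by apply: complexI; rewrite fmorphV/= -!normE normfV. Qed.

Lemma cabs0 : cabs 0 = 0.
Proof. by apply: complexI; rewrite -normE normr0. Qed.

Lemma cabs1 : cabs 1 = 1.
Proof. by apply: complexI; rewrite -normE normr1. Qed.

Lemma cabsX z n : cabs (z ^+ n) = cabs z ^+ n.
Proof. by apply: complexI; rewrite rmorphXn/= -!normE normrX. Qed.

Lemma cabs_eq0 z : (cabs z == 0) = (z == 0).
Proof. by rewrite -(inj_eq (@complexI R)) -normE normr_eq0. Qed.

Lemma cabs_gt0 z : (0 < cabs z) = (z != 0).
Proof. by rewrite lt_def cabs_eq0 cabs_ge0 andbT. Qed.

Lemma cabs_real x : cabs x%:C = `|x|.
Proof. by rewrite /cabs/= expr0n addr0 sqrtr_sqr. Qed.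

Lemma cabs_i : cabs 'i = 1.
Proof. by rewrite /cabs/= expr0n add0r expr1n sqrtr1. Qed.

Lemma Re_le z : `|complex.Re z| <= cabs z.
Proof. by rewrite -sqrtr_sqr ler_wsqrtr// lerDl sqr_ge0. Qed.

Lemma Im_le z : `|complex.Im z| <= cabs z.
Proof. by rewrite -sqrtr_sqr ler_wsqrtr// lerDr sqr_ge0. Qed.

Lemma cabs_le z : cabs z <= `|complex.Re z| + `|complex.Im z|.
Proof.
rewrite -ler_sqr ?nnegrE ?addr_ge0// cabs_sq sqrrD !real_normK ?num_real//.
by rewrite -addrA lerD2l lerDr mulrn_wge0// mulr_ge0.
Qed.

Lemma cReD z w : complex.Re (z + w) = complex.Re z + complex.Re w.
Proof. by case: z w => [? ?] []. Qed.
Lemma cImD z w : complex.Im (z + w) = complex.Im z + complex.Im w.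
Proof. by case: z w => [? ?] []. Qed.
Lemma cReN z : complex.Re (- z) = - complex.Re z.
Proof. by case: z. Qed.
Lemma cImN z : complex.Im (- z) = - complex.Im z.
Proof. by case: z. Qed.
Lemma cReM z w : complex.Re (z * w) =
  complex.Re z * complex.Re w - complex.Im z * complex.Im w.
Proof. by case: z w => [? ?] []. Qed.
Lemma cImM z w : complex.Im (z * w) =
  complex.Re z * complex.Im w + complex.Im z * complex.Re w.
Proof. by case: z w => [? ?] []. Qed.

Lemma ceqP z w : complex.Re z = complex.Re w -> complex.Im z = complex.Im w ->
  z = w.
Proof. by case: z w => [? ?] [? ?] /= -> ->. Qed.
End Modulus.
#[global] Hint Extern 0 (is_true (_ <= cabs _)) => solve [apply: cabs_ge0] : core.

(** * Complex derivatives *)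

Section Calculus.
Context {R : realType}.
Implicit Types (f g : R[i] -> R[i]) (z w h d : R[i]) (e : R).

(** Errors and radii are real, so that estimates on derivatives never leave
    the ordered field [R]. *)
Definition cderiv f z d := forall e, 0 < e -> exists2 dl : R, 0 < dl &
  forall w, cabs (w - z) < dl ->
    cabs (f w - f z - d * (w - z)) <= e * cabs (w - z).

Definition ccont f z := forall e, 0 < e -> exists2 dl : R, 0 < dl &
  forall w, cabs (w - z) < dl -> cabs (f w - f z) <= e.

Lemma cderiv_cont f z d : cderiv f z d -> ccont f z.
Proof.
move=> df e e0; have [dl dl0 H] := df 1 ltr01.
exists (Num.min dl (e / (1 + cabs d))).
  by rewrite lt_min dl0 divr_gt0// ltr_pwDl.
move=> w; rewrite lt_min => /andP[/H {}H].
rewrite ltr_pdivlMr ?ltr_pwDl// => we.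
rewrite (_ : f w - f z = (f w - f z - d * (w - z)) + d * (w - z)); last by ring.
rewrite (le_trans (cabsD _ _))// cabsM.
rewrite (le_trans (lerD H (lexx _)))// -mulrDl mulrC; exact: ltW.
Qed.

Lemma eq_cderiv f g z d e : 0 < e -> (forall w, cabs (w - z) < e -> f w = g w) ->
  cderiv f z d -> cderiv g z d.
Proof.
move=> e0 fg df e1 e10; have [dl dl0 H] := df e1 e10.
exists (Num.min dl e); first by rewrite lt_min dl0.
move=> w; rewrite lt_min => /andP[wd we].
by rewrite -!fg ?subrr ?cabs0//; exact: H.
Qed.

Lemma cderiv_cst d z : cderiv (fun=> d) z 0.
Proof.
by move=> e e0; exists 1 => // w _; rewrite subrr mul0r subrr cabs0 mulr_ge0// ltW.
Qed.

Lemma cderiv_id z : cderiv id z 1.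
Proof.
by move=> e e0; exists 1 => // w _; rewrite mul1r subrr cabs0 mulr_ge0// ltW.
Qed.

Lemma cderivD f g z df dg : cderiv f z df -> cderiv g z dg ->
  cderiv (fun w => f w + g w) z (df + dg).
Proof.
move=> Df Dg e e0; have e20 : 0 < e / 2 by rewrite divr_gt0.
have [d1 d10 H1] := Df _ e20; have [d2 d20 H2] := Dg _ e20.
exists (Num.min d1 d2); first by rewrite lt_min d10.
move=> w; rewrite lt_min => /andP[/H1 {}H1 /H2 {}H2].
rewrite (_ : _ - _ = (f w - f z - df * (w - z)) + (g w - g z - dg * (w - z))); last by ring.
rewrite (le_trans (cabsD _ _))// (le_trans (lerD H1 H2))//.
by rewrite -mulrDl -splitr.
Qed.

Lemma ccontD f g z : ccont f z -> ccont g z -> ccont (fun w => f w + g w) z.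
Proof.
move=> Df Dg e e0; have e20 : 0 < e / 2 by rewrite divr_gt0.
have [d1 d10 H1] := Df _ e20; have [d2 d20 H2] := Dg _ e20.
exists (Num.min d1 d2); first by rewrite lt_min d10.
move=> w; rewrite lt_min => /andP[/H1 {}H1 /H2 {}H2].
rewrite opprD addrACA (le_trans (cabsD _ _))// (le_trans (lerD H1 H2))//.
by rewrite -splitr.
Qed.

Lemma ccont_cst d z : ccont (fun=> d) z.
Proof. exact: cderiv_cont (cderiv_cst _ _). Qed.

Lemma ccontM f g z : ccont f z -> ccont g z -> ccont (fun w => f w * g w) z.
Proof.
move=> Df Dg e e0; pose A := 1 + cabs (f z) + cabs (g z).
have A1 : 1 <= A by rewrite /A -addrA lerDl addr_ge0.
have A0 : 0 < A by rewrite (lt_le_trans ltr01).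
have e1 : 0 < Num.min 1 (e / (2 * A)) by rewrite lt_min ltr01/= divr_gt0 ?mulr_gt0.
have [d1 d10 H1] := Df _ e1; have [d2 d20 H2] := Dg _ e1.
exists (Num.min d1 d2); first by rewrite lt_min d10.
move=> w; rewrite lt_min => /andP[/H1 {}H1 /H2 {}H2].
move: H1 H2; rewrite !le_min => /andP[H1a H1b] /andP[_ H2b].
rewrite (_ : _ - _ = (f w - f z) * g z + f w * (g w - g z)); last by ring.
rewrite (le_trans (cabsD _ _))// !cabsM.
have Fw : cabs (f w) <= A.
  rewrite -(subrK (f z) (f w)) (le_trans (cabsD _ _))//.
  by rewrite (le_trans (lerD H1a (lexx _)))// /A lerDl.
have gA : cabs (g z) <= A by rewrite /A lerDr addr_ge0.
have -> : e = e / (2 * A) * A + A * (e / (2 * A)) by field; rewrite gt_eqF.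
by rewrite lerD// ler_pM.
Qed.

Lemma cderivM f g z df dg : cderiv f z df -> cderiv g z dg ->
  cderiv (fun w => f w * g w) z (df * g z + f z * dg).
Proof.
move=> Df Dg e e0; pose A := 1 + cabs (f z) + cabs (g z) + cabs dg.
have A1 : 1 <= A by rewrite /A -!addrA lerDl !addr_ge0.
have A0 : 0 < A by rewrite (lt_le_trans ltr01).
have e1 : 0 < e / (3 * A) by rewrite divr_gt0 ?mulr_gt0.
have [d1 d10 H1] := Df _ e1; have [d2 d20 H2] := Dg _ e1.
have e2 : 0 < Num.min 1 (e / (3 * A)) by rewrite lt_min ltr01.
have [d3 d30 H3] := cderiv_cont Df e2.
exists (Num.min d1 (Num.min d2 d3)); first by rewrite !lt_min d10 d20.
move=> w; rewrite !lt_min => /and3P[/H1 {}H1 /H2 {}H2 /H3].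
rewrite le_min => /andP[H3a H3b].
rewrite (_ : _ - _ = (f w - f z - df * (w - z)) * g z +
   (f w * (g w - g z - dg * (w - z)) + (f w - f z) * (dg * (w - z)))); last by ring.
have Fw : cabs (f w) <= A.
  rewrite -(subrK (f z) (f w)) (le_trans (cabsD _ _))//.
  by rewrite (le_trans (lerD H3a (lexx _)))// /A -!addrA lerD2l lerDl addr_ge0.
have gA : cabs (g z) <= A by rewrite /A; have := cabs_ge0 (f z); have := cabs_ge0 dg; lra.
have dA : cabs dg <= A by rewrite /A lerDr !addr_ge0.
set h := cabs (w - z) in H1 H2 *.
have h0 : 0 <= h by rewrite /h.
have -> : e * h = (e / (3 * A) * h * A) + (A * (e / (3 * A) * h) + e / (3 * A) * (A * h)).
  by field; rewrite gt_eqF.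
apply: (le_trans (cabsD _ _)); rewrite cabsM lerD//; first by rewrite ler_pM.
apply: (le_trans (cabsD _ _)); rewrite !cabsM lerD// ler_pM// ?mulr_ge0//.
by rewrite ler_wpM2r.
Qed.

Lemma ccontV f z : f z != 0 -> ccont f z -> ccont (fun w => (f w)^-1) z.
Proof.
move=> fz0 cf e e0; set a := cabs (f z).
have a0 : 0 < a by rewrite /a cabs_gt0.
have e1 : 0 < Num.min (a / 2) (e * a ^+ 2 / 2).
  by rewrite lt_min !divr_gt0// mulr_gt0// exprn_gt0.
have [dl dl0 H] := cf _ e1; exists dl => // w /H; rewrite le_min => /andP[Ha Hb].
have fw : a / 2 <= cabs (f w).
  have := cabsBge (f z) (f z - f w); rewrite subKr -/a cabsC => H1; lra.
have fw0 : f w != 0 by rewrite -cabs_gt0 (lt_le_trans _ fw)// divr_gt0.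
rewrite (_ : _ - _ = - ((f w - f z) / (f w * f z))); last by field; rewrite ?fw0 ?fz0.
rewrite cabsN cabsM cabsV cabsM ler_pdivrMr ?mulr_gt0 ?cabs_gt0//.
apply: (le_trans Hb); rewrite -/a.
rewrite (_ : e * a ^+ 2 / 2 = e * (a / 2 * a)); last by field.
by rewrite ler_wpM2l ?(ltW e0)// ler_wpM2r// ltW.
Qed.

Lemma cderivV f z d : f z != 0 -> cderiv f z d ->
  cderiv (fun w => (f w)^-1) z (- d / f z ^+ 2).
Proof.
move=> fz0 Df e e0; have cf := cderiv_cont Df.
have cV := ccontV fz0 cf.
have a0 : 0 < cabs (f z) by rewrite cabs_gt0.
pose A := 1 + cabs (f z)^-1 + cabs d + cabs (f z)^-1.
have A1 : 1 <= A by rewrite /A -!addrA lerDl !addr_ge0.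
have A0 : 0 < A by rewrite (lt_le_trans ltr01).
have e1 : 0 < e / (2 * A ^+ 2) by rewrite divr_gt0 ?mulr_gt0 ?exprn_gt0.
have [d1 d10 H1] := Df _ e1.
have e2 : 0 < Num.min 1 (e / (2 * A ^+ 2)) by rewrite lt_min ltr01.
have [d2 d20 H2] := cV _ e2.
have a2 : 0 < cabs (f z) / 2 by rewrite divr_gt0.
have [d3 d30 H3] := cf _ a2.
exists (Num.min d1 (Num.min d2 d3)); first by rewrite !lt_min d10 d20.
move=> w; rewrite !lt_min => /and3P[/H1 {}H1 /H2 {}H2 /H3 {}H3].
move: H2; rewrite le_min => /andP[H2a H2b].
have fw0 : f w != 0.
  rewrite -cabs_gt0; have := cabsBge (f z) (f z - f w).
  by rewrite subKr cabsC => H4; lra.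
rewrite (_ : _ - _ = - ((f w - f z - d * (w - z)) * ((f w)^-1 * (f z)^-1)
    + ((f w)^-1 - (f z)^-1) * (d * (f z)^-1) * (w - z))); last first.
  by field; rewrite ?fw0 ?fz0.
have Fw : cabs (f w)^-1 <= A.
  rewrite -(subrK (f z)^-1 (f w)^-1) (le_trans (cabsD _ _))//.
  by rewrite (le_trans (lerD H2a (lexx _)))// /A -!addrA lerD2l lerDl addr_ge0.
have gA : cabs (f z)^-1 <= A by rewrite /A lerDr !addr_ge0.
have dA : cabs d <= A by rewrite /A; have := cabs_ge0 (f z)^-1; lra.
set h := cabs (w - z) in H1 *.
have h0 : 0 <= h by rewrite /h.
rewrite cabsN; apply: (le_trans (cabsD _ _)).
have -> : e * h = (e / (2 * A ^+ 2) * h) * (A * A) + e / (2 * A ^+ 2) * (A * A) * h.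
  by field; rewrite gt_eqF.
rewrite !cabsM -/h lerD//; first by rewrite ler_pM// ?mulr_ge0// ler_pM.
by rewrite ler_wpM2r// ler_pM// ?mulr_ge0// ler_pM.
Qed.

Lemma cderiv_comp f g z df dg : cderiv f z df -> cderiv g (f z) dg ->
  cderiv (fun w => g (f w)) z (dg * df).
Proof.
move=> Df Dg e e0; pose A := 1 + cabs df + cabs dg.
have A1 : 1 <= A by rewrite /A -!addrA lerDl !addr_ge0.
have A0 : 0 < A by rewrite (lt_le_trans ltr01).
have e1 : 0 < e / (2 * A) by rewrite divr_gt0 ?mulr_gt0.
have [d1 d10 H1] := Dg _ e1.
have e2 : 0 < Num.min 1 (e / (2 * A)) by rewrite lt_min ltr01.
have [d2 d20 H2] := Df _ e2.
have d12 : 0 < d1 / 2 by rewrite divr_gt0.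
have [d3 d30 H3] := cderiv_cont Df d12.
exists (Num.min d2 d3); first by rewrite lt_min d20.
move=> w; rewrite lt_min => /andP[/H2 {}H2 /H3 {}H3].
have {}H1 := H1 (f w) _.
have {}/H1 H1 : cabs (f w - f z) < d1.
  by rewrite (le_lt_trans H3)// ltr_pdivrMr// ltr_pMr// ltr1n.
set h := cabs (w - z) in H2 *; have h0 : 0 <= h by rewrite /h.
have H2a : cabs (f w - f z - df * (w - z)) <= h.
  by rewrite (le_trans H2)// ler_piMl// ge_min lexx.
have H2b : cabs (f w - f z - df * (w - z)) <= e / (2 * A) * h.
  by rewrite (le_trans H2)// ler_wpM2r// ge_min lexx orbT.
have Fw : cabs (f w - f z) <= A * h.
  rewrite -(subrK (df * (w - z)) (f w - f z)) (le_trans (cabsD _ _))//.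
  rewrite (le_trans (lerD H2a (lexx _)))// cabsM -/h /A -addrA mulrDl mul1r lerD2l.
  by rewrite ler_wpM2r// lerDl.
rewrite (_ : _ - _ = (g (f w) - g (f z) - dg * (f w - f z)) +
   dg * (f w - f z - df * (w - z))); last by ring.
rewrite (le_trans (cabsD _ _))//.
have -> : e * h = e / (2 * A) * (A * h) + A * (e / (2 * A) * h) by field; rewrite gt_eqF.
rewrite lerD//.
  rewrite (le_trans H1)// ler_wpM2l// ltW//.
rewrite cabsM ler_pM// /A lerDr addr_ge0//.
Qed.

Lemma cderivZ c f z d : cderiv f z d -> cderiv (fun w => c * f w) z (c * d).
Proof.
move=> H; have := cderivM (cderiv_cst c z) H.
by rewrite mul0r add0r.
Qed.

Lemma cderivN f z d : cderiv f z d -> cderiv (fun w => - f w) z (- d).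
Proof.
move=> /(cderivZ (-1)) /eq_cderiv; rewrite mulN1r.
by apply; [exact: ltr01 | move=> w _ /=; rewrite mulN1r].
Qed.

Lemma cderivB f g z df dg : cderiv f z df -> cderiv g z dg ->
  cderiv (fun w => f w - g w) z (df - dg).
Proof. by move=> Df /cderivN Dg; exact: cderivD. Qed.

Lemma cderiv_uniq f z d1 d2 : cderiv f z d1 -> cderiv f z d2 -> d1 = d2.
Proof.
move=> H1 H2; apply/eqP; rewrite -subr_eq0 -cabs_eq0 eq_le cabs_ge0 andbT.
apply/ler_addgt0Pl => e e0; rewrite addr0.
have e20 : 0 < e / 2 by rewrite divr_gt0.
have [a a0 {}H1] := H1 _ e20; have [b b0 {}H2] := H2 _ e20.
pose t := Num.min a b / 2; have ab0 : 0 < Num.min a b by rewrite lt_min a0.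
have t0 : 0 < t by rewrite divr_gt0.
have tab : t < Num.min a b by rewrite ltr_pdivrMr// ltr_pMr// ltr1n.
move: tab; rewrite lt_min => /andP[ta tb].
have tE : cabs (z + t%:C - z) = t by rewrite addrAC subrr add0r cabs_real gtr0_norm.
have := H1 (z + t%:C); have := H2 (z + t%:C); rewrite tE => /(_ tb) {}H2 /(_ ta) {}H1.
rewrite -(ler_pM2r t0) -{1}tE -cabsM.
rewrite (_ : (d1 - d2) * _ = (f (z + t%:C) - f z - d2 * (z + t%:C - z)) - (f (z + t%:C) - f z - d1 * (z + t%:C - z))); last by ring.
by rewrite (le_trans (cabsB _ _))// (le_trans (lerD H2 H1))// -mulrDl -splitr.
Qed.

(** The bridge to the filter-based derivative: the radius of a ball of [R[i]]
    is a complex number that is positive, hence real. *)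
Lemma derivable_cderiv f z :
  derivable (f : R[i]^o -> R[i]^o) z 1 -> cderiv f z (complex_derive f z).
Proof.
rewrite /derivable /complex_derive derive1E /derive => /cvg_ex[/= l fl].
rewrite (cvg_lim _ fl)// => e e0.
have e0C : 0 < (e%:C : R[i]) by rewrite ltcR.
move/cvgrPdist_le : fl => /(_ _ e0C).
rewrite near_withinE => /nbhs_ballP[/= dl dl0 H].
have := dl0; rewrite ltcE/= => /andP[/eqP idl rdl].
exists (complex.Re dl) => // w wd.
have [->|wz] := eqVneq w z; first by rewrite !subrr mulr0 subrr cabs0 mulr0.
have wz' : w - z != 0 by rewrite subr_eq0.
have dlE : dl = (complex.Re dl)%:C by apply: ceqP => //=; rewrite idl.
have := H (w - z); rewrite /ball/= sub0r normrN normE dlE ltcR => /(_ wd wz').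
rewrite normE lecR /GRing.scale/= mulr1 subrK => H1.
rewrite (_ : f w - f z - l * (w - z) = - ((l - (w - z)^-1 * (f w - f z)) * (w - z))); last by field.
by rewrite cabsN cabsM ler_wpM2r.
Qed.

End Calculus.

(** * Integrals of continuous real functions on a segment *)

Section RealCalc.
Context {R : realType}.
Implicit Types (f g F : R -> R) (a b x t : R).

Lemma is_derive_epsP f x d : is_derive x 1 f d <->
  (forall e, 0 < e -> exists2 dl : R, 0 < dl & forall y, `|y - x| < dl ->
    `|f y - f x - d * (y - x)| <= e * `|y - x|).
Proof.
have E y e : y != x -> (`|d - (y - x)^-1 * (f y - f x)| <= e) =
    (`|f y - f x - d * (y - x)| <= e * `|y - x|).
  move=> yx; have yx' : y - x != 0 by rewrite subr_eq0.
  have -> : f y - f x - d * (y - x) = - ((d - (y - x)^-1 * (f y - f x)) * (y - x)) by field.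
  by rewrite normrN normrM ler_pM2r// normr_gt0.
split.
  move=> [/cvg_ex[/= l fl]]; rewrite /derive (cvg_lim _ fl)// => <- e e0.
  move/cvgrPdist_le : fl => /(_ _ e0).
  rewrite near_withinE => /nbhs_ballP[/= dl dl0 H].
  exists dl => // y yd; have [->|yx] := eqVneq y x.
    by rewrite !subrr mulr0 subrr normr0 mulr0.
  have {}H := H (y - x); rewrite /ball/= sub0r normrN in H.
  move: (H yd); rewrite subr_eq0 => /(_ yx).
  rewrite /GRing.scale/= mulr1 subrK -/(d) => H1.
  have yx' : y - x != 0 by rewrite subr_eq0.
  have -> : f y - f x - l * (y - x) = - ((l - (y - x)^-1 * (f y - f x)) * (y - x)) by field.
  by rewrite normrN normrM ler_pM2r// normr_gt0.
move=> H; have cv : h^-1 *: ((f \o shift x) (h *: 1) - f x) @[h --> 0^'] --> d.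
  apply/cvgrPdist_le => e e0; have [dl dl0 {}H] := H _ e0.
  rewrite near_withinE; apply/nbhs_ballP; exists dl => //= h.
  rewrite /ball/= sub0r normrN => hd h0.
  have hxx : h + x != x by rewrite -subr_eq0 addrK.
  by have := H (h + x); rewrite addrK => /(_ hd); have := E (h + x) e hxx; rewrite addrK => <-; rewrite /GRing.scale/= mulr1.
split; first by apply/cvg_ex; exists d.
exact: cvg_lim cv.
Qed.

(** Continuity at the points of the segment as a function on the whole line,
    not relative to the segment: the integrands below are all of this kind, and
    it is stable under the operations without boundary cases. *)
Definition rcont a b f := forall t, a <= t <= b -> {for t, continuous f}.

Lemma rcont_within a b f : rcont a b f -> {within `[a, b], continuous f}.
Proof.
move=> cf; apply: continuous_in_subspaceT => t.
by rewrite inE/= in_itv/=; exact: cf.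
Qed.

Lemma rcont_int a b f : rcont a b f ->
  (@lebesgue_measure R).-integrable `[a, b] (EFin \o f).
Proof.
move=> cf; apply: continuous_compact_integrable; first exact: segment_compact.
exact: rcont_within.
Qed.

Definition rint a b f : R := \int[@lebesgue_measure R]_(t in `[a, b]) f t.

Lemma eq_rint a b f g : (forall t, a <= t <= b -> f t = g t) -> rint a b f = rint a b g.
Proof.
by move=> fg; apply: eq_Rintegral => t; rewrite inE/= in_itv/=; exact: fg.
Qed.

Lemma rintD a b f g : rcont a b f -> rcont a b g ->
  rint a b (fun t => f t + g t) = rint a b f + rint a b g.
Proof. by move=> cf cg; rewrite /rint RintegralD//; exact: rcont_int. Qed.

Lemma rintB a b f g : rcont a b f -> rcont a b g ->
  rint a b (fun t => f t - g t) = rint a b f - rint a b g.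
Proof. by move=> cf cg; rewrite /rint RintegralB//; exact: rcont_int. Qed.

Lemma rintZ a b c f : rcont a b f ->
  rint a b (fun t => c * f t) = c * rint a b f.
Proof. by move=> cf; rewrite /rint RintegralZl//; exact: rcont_int. Qed.

Lemma rint_le a b f g : rcont a b f -> rcont a b g ->
  (forall t, a <= t <= b -> f t <= g t) -> rint a b f <= rint a b g.
Proof.
by move=> cf cg fg; apply: le_Rintegral => //; exact: rcont_int.
Qed.

Lemma rcont_cst a b c : rcont a b (fun=> c).
Proof. by move=> t _; exact: cvg_cst. Qed.

Lemma rint_cst a b c : a <= b -> rint a b (fun=> c) = c * (b - a).
Proof.
move=> ab; rewrite /rint Rintegral_cst//.
transitivity (c * fine (b - a)%:E); last by []; congr (_ * fine _).
refine (etrans (lebesgue_measure_itv (Interval (BLeft a) (BRight b))) _); rewrite /= lte_fin.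
case: ltP => [_|ba]; first by rewrite EFinB.
by have -> : a = b; [apply: le_anti; rewrite ab ba|rewrite subrr].
Qed.

Lemma rcontW a b c d f : a <= c -> d <= b -> rcont a b f -> rcont c d f.
Proof.
by move=> ac db cf t /andP[ct td]; apply: cf; rewrite (le_trans ac)//= (le_trans td).
Qed.

Lemma rint_split a c b f : a <= c -> c <= b -> rcont a b f ->
  rint a b f = rint a c f + rint c b f.
Proof.
move=> ac cb cf; rewrite /rint; apply/eqP; rewrite addrC -subr_eq; apply/eqP.
rewrite (@Rintegral_itvB _ f (BLeft a) (BRight b) c) ?bnd_simp//; last exact: rcont_int.
rewrite Rintegral_itv_obnd_cbnd//.
apply: (integrableS _ _ _ (rcont_int (rcontW ac (lexx b) cf))) => //.
exact: subset_itv_oc_cc.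
Qed.

Lemma rint_point a f : rint a a f = 0.
Proof. by rewrite /rint set_itv1 Rintegral_set1. Qed.

Lemma rint_norm a b f M : a <= b -> rcont a b f ->
  (forall t, a <= t <= b -> `|f t| <= M) -> `|rint a b f| <= M * (b - a).
Proof.
move=> ab cf H; rewrite ler_norml -mulNr -!rint_cst//; apply/andP; split.
  by apply: rint_le => //; [exact: rcont_cst|move=> t /H; rewrite ler_norml => /andP[]].
by apply: rint_le => //; [exact: rcont_cst|move=> t /H; rewrite ler_norml => /andP[]].
Qed.

Lemma rint_FTC a b f F : a <= b -> rcont a b f ->
  (forall t, a <= t <= b -> is_derive t 1 F (f t)) -> rint a b f = F b - F a.
Proof.
rewrite le_eqVlt => /predU1P[->|ab] cf dF; first by rewrite rint_point subrr.
have Fc t : a <= t <= b -> {for t, continuous F}.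
  move=> /dF [/derivable1_diffP/differentiable_continuous dFt _]; exact: dFt.
rewrite /rint /Rintegral (@continuous_FTC2 _ f F)//.
- exact: rcont_within.
- split.
  + by move=> t; rewrite in_itv/= => /andP[t1 t2]; have [] := dF t _ ; rewrite ?(ltW t1) ?(ltW t2).
  + apply: cvg_at_right_filter; apply: Fc; by rewrite lexx ltW.
  + apply: cvg_at_left_filter; apply: Fc; by rewrite lexx ltW.
- move=> t; rewrite in_itv/= => /andP[t1 t2]; rewrite derive1E.
  by have H := dF t; rewrite (ltW t1) (ltW t2) in H; have [_ ->] := H isT.
Qed.

Lemma continuous_epsP f x : {for x, continuous f} <->
  (forall e, 0 < e -> exists2 dl : R, 0 < dl & forall y, `|y - x| < dl ->
    `|f y - f x| <= e).
Proof.
split.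
  move=> /cvgrPdist_le H e /H /nbhs_ballP[/= dl dl0 {}H].
  by exists dl => // y yd; rewrite distrC; apply: H; rewrite /ball/= distrC.
move=> H; apply/cvgrPdist_le => e /H [dl dl0 {}H].
apply/nbhs_ballP; exists dl => //= y; rewrite /ball/= distrC => /H.
by rewrite distrC.
Qed.

End RealCalc.

(** * Integrals of complex functions of a real variable *)

Section ComplexIntegral.
Context {R : realType}.
Implicit Types (f g : R -> R[i]) (a b c d t : R).

Definition pcont a b f := rcont a b (fun t => complex.Re (f t)) /\
  rcont a b (fun t => complex.Im (f t)).

Definition cint a b f : R[i] :=
  rint a b (fun t => complex.Re (f t)) +i* rint a b (fun t => complex.Im (f t)).

Lemma pcontP a b f : pcont a b f <-> (forall t, a <= t <= b -> forall e, 0 < e ->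
   exists2 dl : R, 0 < dl & forall y, `|y - t| < dl -> cabs (f y - f t) <= e).
Proof.
split.
  move=> [cr ci] t tab e e0; have e20 : 0 < e / 2 by rewrite divr_gt0.
  have /continuous_epsP/(_ _ e20)[d1 d10 H1] := cr t tab.
  have /continuous_epsP/(_ _ e20)[d2 d20 H2] := ci t tab.
  exists (Num.min d1 d2); first by rewrite lt_min d10.
  move=> y; rewrite lt_min => /andP[/H1 {}H1 /H2 {}H2].
  by rewrite (le_trans (cabs_le _))// cReD cImD cReN cImN (splitr e) lerD.
move=> H; split=> t tab; apply/continuous_epsP => e e0.
  have [dl dl0 {}H] := H _ tab _ e0; exists dl => // y /H.
  by apply: le_trans; rewrite -cReN -cReD Re_le.
have [dl dl0 {}H] := H _ tab _ e0; exists dl => // y /H.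
by apply: le_trans; rewrite -cImN -cImD Im_le.
Qed.

Lemma eq_cint a b f g : (forall t, a <= t <= b -> f t = g t) -> cint a b f = cint a b g.
Proof. by move=> fg; congr Complex; apply: eq_rint => t /fg ->. Qed.

Lemma pcont_cst a b z : pcont a b (fun=> z).
Proof. by split; exact: rcont_cst. Qed.

Lemma rcontD a b (f g : R -> R) : rcont a b f -> rcont a b g -> rcont a b (fun t => f t + g t).
Proof. by move=> cf cg t tab; apply: cvgD; [exact: cf|exact: cg]. Qed.

Lemma rcontM a b (f g : R -> R) : rcont a b f -> rcont a b g -> rcont a b (fun t => f t * g t).
Proof. by move=> cf cg t tab; apply: cvgM; [exact: cf|exact: cg]. Qed.

Lemma rcontN a b (f : R -> R) : rcont a b f -> rcont a b (fun t => - f t).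
Proof. by move=> cf t tab; apply: cvgN; exact: cf. Qed.

Lemma eq_rcont a b (f g : R -> R) : f =1 g -> rcont a b f -> rcont a b g.
Proof. by move=> /funext ->. Qed.

Lemma pcontD a b f g : pcont a b f -> pcont a b g -> pcont a b (fun t => f t + g t).
Proof.
move=> [f1 f2] [g1 g2]; split.
  by apply: eq_rcont (rcontD f1 g1) => t; rewrite cReD.
by apply: eq_rcont (rcontD f2 g2) => t; rewrite cImD.
Qed.

Lemma pcontM a b f g : pcont a b f -> pcont a b g -> pcont a b (fun t => f t * g t).
Proof.
move=> [f1 f2] [g1 g2]; split.
  by apply: eq_rcont (rcontD (rcontM f1 g1) (rcontN (rcontM f2 g2))) => t; rewrite cReM.
by apply: eq_rcont (rcontD (rcontM f1 g2) (rcontM f2 g1)) => t /=; rewrite cImM.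
Qed.

Lemma pcontZ a b z f : pcont a b f -> pcont a b (fun t => z * f t).
Proof. by move=> cf; apply: pcontM => //; exact: pcont_cst. Qed.

Lemma pcontB a b f g : pcont a b f -> pcont a b g -> pcont a b (fun t => f t - g t).
Proof.
move=> [f1 f2] [g1 g2]; split.
  by apply: eq_rcont (rcontD f1 (rcontN g1)) => t; rewrite cReD cReN.
by apply: eq_rcont (rcontD f2 (rcontN g2)) => t; rewrite cImD cImN.
Qed.

Lemma cintD a b f g : pcont a b f -> pcont a b g ->
  cint a b (fun t => f t + g t) = cint a b f + cint a b g.
Proof.
move=> [f1 f2] [g1 g2]; rewrite /cint; apply: ceqP; rewrite ?cReD ?cImD/=.
  by rewrite -rintD//; apply: eq_rint => t _; rewrite cReD.
by rewrite -rintD//; apply: eq_rint => t _; rewrite cImD.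
Qed.

Lemma cintZ a b z f : pcont a b f -> cint a b (fun t => z * f t) = z * cint a b f.
Proof.
move=> [f1 f2]; apply: ceqP; rewrite ?cReM ?cImM/=.
  rewrite -!rintZ// -rintB//; first by apply: eq_rint => t _; rewrite cReM.
    by apply: rcontM => //; exact: rcont_cst.
  by apply: rcontM => //; exact: rcont_cst.
rewrite -!rintZ// -rintD//; first by apply: eq_rint => t _; rewrite cImM.
  by apply: rcontM => //; exact: rcont_cst.
by apply: rcontM => //; exact: rcont_cst.
Qed.

Lemma cintB a b f g : pcont a b f -> pcont a b g ->
  cint a b (fun t => f t - g t) = cint a b f - cint a b g.
Proof.
move=> cf cg; have -> : cint a b (fun t => f t - g t) = cint a b (fun t => f t + (-1) * g t).
  by apply: eq_cint => t _; rewrite mulN1r.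
by rewrite cintD ?cintZ ?mulN1r//; exact: pcontZ.
Qed.

Lemma cint_split a c b f : a <= c -> c <= b -> pcont a b f ->
  cint a b f = cint a c f + cint c b f.
Proof. by move=> ac cb [f1 f2]; rewrite /cint (rint_split ac cb)// (rint_split ac cb f2). Qed.

Lemma cint_cst a b z : a <= b -> cint a b (fun=> z) = (b - a)%:C * z.
Proof.
by move=> ab; rewrite /cint !rint_cst//; apply: ceqP; rewrite ?cReM ?cImM/= mul0r ?subr0 ?addr0 mulrC.
Qed.

(** The factor 2 comes from bounding real and imaginary parts separately; only
    the existence of universal constants matters in the end. *)
Lemma cint_norm a b f M : a <= b -> pcont a b f ->
  (forall t, a <= t <= b -> cabs (f t) <= M) -> cabs (cint a b f) <= 2 * M * (b - a).
Proof.
move=> ab [f1 f2] H; rewrite (le_trans (cabs_le _))//= -mulrA mulr_natl mulr2n lerD//.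
  by apply: rint_norm => // t /H; apply: le_trans; exact: Re_le.
by apply: rint_norm => // t /H; apply: le_trans; exact: Im_le.
Qed.

Lemma cint_FTC a b f F : a <= b -> pcont a b f ->
  (forall t, a <= t <= b -> forall e, 0 < e -> exists2 dl : R, 0 < dl &
     forall y, `|y - t| < dl -> cabs (F y - F t - f t * (y - t)%:C) <= e * `|y - t|) ->
  cint a b f = F b - F a.
Proof.
move=> ab [f1 f2] dF; apply: ceqP; rewrite ?cReD ?cImD ?cReN ?cImN/=.
  apply: (rint_FTC (F := fun t => complex.Re (F t))) => // t tab.
  apply/is_derive_epsP => e e0; have [dl dl0 H] := dF t tab e e0.
  exists dl => // y /H; apply: le_trans; apply: le_trans (Re_le _).
  by rewrite !cReD !cReN cReM/= mulr0 subr0.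
apply: (rint_FTC (F := fun t => complex.Im (F t))) => // t tab.
apply/is_derive_epsP => e e0; have [dl dl0 H] := dF t tab e e0.
exists dl => // y /H; apply: le_trans; apply: le_trans (Im_le _).
by rewrite !cImD !cImN cImM/= mulr0 add0r.
Qed.

Lemma pcont_comp a b (q : R[i] -> R[i]) f : pcont a b f ->
  (forall t, a <= t <= b -> ccont q (f t)) -> pcont a b (fun t => q (f t)).
Proof.
move=> /pcontP cf cq; apply/pcontP => t tab e e0.
have [d1 d10 H1] := cq t tab e e0.
have d12 : 0 < d1 / 2 by rewrite divr_gt0.
have [d2 d20 H2] := cf t tab _ d12; exists d2 => // y /H2 H3; apply: H1.
by rewrite (le_lt_trans H3)// ltr_pdivrMr// ltr_pMr// ltr1n.
Qed.

Lemma pcont_affine a b (p v : R[i]) : pcont a b (fun t => p + t%:C * v).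
Proof.
apply/pcontP => t _ e e0; pose A := 1 + cabs v.
have A0 : 0 < A by rewrite ltr_pwDl.
exists (e / A); first by rewrite divr_gt0.
move=> y; rewrite ltr_pdivlMr// => yt.
rewrite (_ : _ - _ = (y - t)%:C * v); last by rewrite rmorphB/=; ring.
rewrite cabsM cabs_real (le_trans _ (ltW yt))// ler_wpM2l// /A lerDr//.
Qed.

End ComplexIntegral.

(** * Goursat's theorem on rectangles *)

Section Goursat.
Context {R : realType}.
Implicit Types (phi psi : R[i] -> R[i]) (a b c d x y : R).

Lemma half_pow_small (A dl : R) : 0 < dl -> exists n, A / 2 ^+ n < dl.
Proof.
move=> dl0; exists (Num.truncn (`|A| / dl)).+1.
have p0 k : 0 < (2 : R) ^+ k by rewrite exprn_gt0.
rewrite ltr_pdivrMr// (le_lt_trans (ler_norm A))// mulrC -ltr_pdivrMr//.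
rewrite (lt_trans (truncnS_gt _))//.
by rewrite -natrX ltr_nat ltn_expl.
Qed.

(** Bisection, in the form shared by Goursat's theorem and by the existence of
    minima on compact sets of the plane: [B n x y] speaks of the cell with
    corner [(x, y)] and sides [w / 2 ^+ n], [h / 2 ^+ n], and passes to one of
    its four quarters. *)
Lemma nested_cells (w h : R) (B : nat -> R -> R -> Prop) x0 y0 : 0 <= w -> 0 <= h ->
  (forall n x y, B n x y -> exists x' y', [/\ B n.+1 x' y',
     x <= x' <= x + w / 2 ^+ n.+1 & y <= y' <= y + h / 2 ^+ n.+1]) ->
  B 0%N x0 y0 -> exists xs ys, forall n, exists x y, [/\ B n x y,
     x <= xs <= x + w / 2 ^+ n & y <= ys <= y + h / 2 ^+ n].
Proof.
move=> w0 h0 step B0.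
have /choice[F HF] : forall t : nat * R * R, exists p : R * R, B t.1.1 t.1.2 t.2 ->
   [/\ B t.1.1.+1 p.1 p.2, t.1.2 <= p.1 <= t.1.2 + w / 2 ^+ t.1.1.+1 &
       t.2 <= p.2 <= t.2 + h / 2 ^+ t.1.1.+1].
  move=> [[n x] y] /=; have [/step|nB] := pselect (B n x y).
    by move=> [x' [y' H]]; exists (x', y').
  by exists (x, y).
pose s := fix s n : R * R := if n is m.+1 then F (m, (s m).1, (s m).2) else (x0, y0).
have sB n : B n (s n).1 (s n).2.
  by elim: n => [//|n IH] /=; have [] := HF (n, (s n).1, (s n).2) IH.
have sS n := HF (n, (s n).1, (s n).2) (sB n); rewrite /= in sS.
have mono (u : nat -> R) (v : R) : 0 <= v -> (forall n, u n <= u n.+1 <= u n + v / 2 ^+ n.+1) ->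
    exists us, forall n, u n <= us <= u n + v / 2 ^+ n.
  move=> v0 Hu.
  have uinc m n : (m <= n)%N -> u m <= u n.
    move=> /subnK <-; elim: (n - m)%N => // k IH.
    by rewrite addSn (le_trans IH)//; have /andP[] := Hu (k + m)%N.
  have udec m n : (m <= n)%N -> u n + v / 2 ^+ n <= u m + v / 2 ^+ m.
    move=> /subnK <-; elim: (n - m)%N => // k IH.
    rewrite addSn; apply: le_trans IH; have /andP[_] := Hu (k + m)%N.
    set r := u _; set r' := u _ => H.
    have -> : v / 2 ^+ (k + m) = v / 2 ^+ (k + m).+1 + v / 2 ^+ (k + m).+1.
      by rewrite exprS; field; rewrite expf_neq0.
    by rewrite addrA lerD2r.
  have ub m n : u n <= u m + v / 2 ^+ m.
    have v2 k : 0 <= v / 2 ^+ k by rewrite divr_ge0// exprn_ge0.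
    have [mn|/ltnW nm] := leqP m n.
      by apply: le_trans (udec _ _ mn); rewrite lerDl.
    by rewrite (le_trans (uinc _ _ nm))// lerDl.
  exists (sup (range u)) => n; apply/andP; split.
    apply: ub_le_sup; last by exists n.
    by exists (u 0%N + v / 2 ^+ 0) => _ [m _ <-]; exact: ub.
  by apply: ge_sup; [exists (u 0%N), 0%N|move=> _ [m _ <-]; exact: ub].
have [xs Hx] := mono (fun n => (s n).1) w w0 (fun n => let: And3 _ H _ := sS n in H).
have [ys Hy] := mono (fun n => (s n).2) h h0 (fun n => let: And3 _ _ H := sS n in H).
by exists xs, ys => n; exists (s n).1, (s n).2; split; [exact: sB|exact: Hx|exact: Hy].
Qed.

(** The integral of [phi] along the boundary of the rectangle
    [[a, b] x [c, d]], counterclockwise. *)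
Definition rectint phi a b c d : R[i] :=
  cint a b (fun x => phi (x +i* c)) + 'i * cint c d (fun y => phi (b +i* y))
  - cint a b (fun x => phi (x +i* d)) - 'i * cint c d (fun y => phi (a +i* y)).

Definition edge_cont phi a b c d := (forall x y, a <= x <= b -> c <= y <= d ->
  ccont phi (x +i* y)).

Lemma hpathE c t : (0 +i* c) + t%:C * 1 = t +i* c.
Proof. by apply: ceqP => /=; ring. Qed.

Lemma vpathE a t : (a +i* 0) + t%:C * 'i = a +i* t.
Proof. by apply: ceqP => /=; ring. Qed.

Lemma pcont_h phi a b c : (forall x, a <= x <= b -> ccont phi (x +i* c)) ->
  pcont a b (fun x => phi (x +i* c)).
Proof.
move=> H; apply: pcont_comp => //.
have := pcont_affine a b (0 +i* c) 1.
by rewrite (_ : (fun t => _) = (fun x => x +i* c))//; apply/funext => t; rewrite hpathE.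
Qed.

Lemma pcont_v phi a b c : (forall y, a <= y <= b -> ccont phi (c +i* y)) ->
  pcont a b (fun y => phi (c +i* y)).
Proof.
move=> H; apply: pcont_comp => //.
have := pcont_affine a b (c +i* 0) 'i.
by rewrite (_ : (fun t => _) = (fun x => c +i* x))//; apply/funext => t; rewrite vpathE.
Qed.

(** The fundamental theorem of calculus along the segment [p + t v]. *)
Lemma cint_path a b phi F (p v : R[i]) : a <= b ->
  (forall t, a <= t <= b -> ccont phi (p + t%:C * v)) ->
  (forall t, a <= t <= b -> cderiv F (p + t%:C * v) (phi (p + t%:C * v))) ->
  cint a b (fun t => phi (p + t%:C * v)) * v = F (p + b%:C * v) - F (p + a%:C * v).
Proof.
move=> ab cphi dF; have cp : pcont a b (fun t => phi (p + t%:C * v)).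
  by apply: pcont_comp => //; exact: pcont_affine.
rewrite mulrC -cintZ//.
apply: (cint_FTC (F := fun t => F (p + t%:C * v))) => //; first exact: pcontZ.
move=> t tab e e0; pose A := 1 + cabs v.
have A0 : 0 < A by rewrite ltr_pwDl.
have [dl dl0 H] := dF t tab (e / A) (divr_gt0 e0 A0).
exists (dl / A); first by rewrite divr_gt0.
move=> y; rewrite ltr_pdivlMr// => yt.
have E : p + y%:C * v - (p + t%:C * v) = (y - t)%:C * v by rewrite rmorphB/=; ring.
have vA : cabs v <= A by rewrite /A lerDr.
have := H (p + y%:C * v); rewrite E cabsM cabs_real => {}H.
have {}H := H (le_lt_trans (ler_wpM2l (normr_ge0 _) vA) yt).
rewrite (_ : v * _ * _ = phi (p + t%:C * v) * ((y - t)%:C * v)); last by ring.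
apply: (le_trans H); rewrite mulrCA mulrC ler_wpM2r//.
by rewrite mulrAC ler_pdivrMr// ler_wpM2l// ltW.
Qed.

Lemma rectint_split_x phi a m b c d : a <= m -> m <= b -> c <= d ->
  edge_cont phi a b c d ->
  rectint phi a b c d = rectint phi a m c d + rectint phi m b c d.
Proof.
move=> am mb cd E; rewrite /rectint.
rewrite (@cint_split _ a m b (fun x => phi (x +i* c)))//; last first.
  by apply: pcont_h => x xab; apply: E => //; rewrite lexx.
rewrite (@cint_split _ a m b (fun x => phi (x +i* d)))//; last first.
  by apply: pcont_h => x xab; apply: E => //; rewrite lexx andbT.
ring.
Qed.

Lemma rectint_split_y phi a b c m d : c <= m -> m <= d -> a <= b ->
  edge_cont phi a b c d ->
  rectint phi a b c d = rectint phi a b c m + rectint phi a b m d.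
Proof.
move=> cm md ab E; rewrite /rectint.
rewrite (@cint_split _ c m d (fun y => phi (b +i* y)))//; last first.
  by apply: pcont_v => y yab; apply: E => //; rewrite lexx andbT.
rewrite (@cint_split _ c m d (fun y => phi (a +i* y)))//; last first.
  by apply: pcont_v => y yab; apply: E => //; rewrite lexx.
ring.
Qed.

Lemma rectint_primitive phi F a b c d : a <= b -> c <= d -> edge_cont phi a b c d ->
  (forall x y, a <= x <= b -> c <= y <= d -> cderiv F (x +i* y) (phi (x +i* y))) ->
  rectint phi a b c d = 0.
Proof.
move=> ab cd cphi dF.
have H c' : c <= c' <= d -> cint a b (fun x => phi (x +i* c')) = F (b +i* c') - F (a +i* c').
  move=> cc; have E := hpathE c'.
  rewrite -(E a) -(E b) -(@cint_path a b phi F (0 +i* c') 1)//.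
  - by rewrite mulr1; apply: eq_cint => t _; rewrite E.
  - by move=> t tab; rewrite E; exact: cphi.
  - by move=> t tab; rewrite E; exact: dF.
have V a' : a <= a' <= b -> 'i * cint c d (fun y => phi (a' +i* y)) = F (a' +i* d) - F (a' +i* c).
  move=> cc; have E := vpathE a'.
  rewrite -(E c) -(E d) -(@cint_path c d phi F (a' +i* 0) 'i)//.
  - by rewrite mulrC; congr (_ * _); apply: eq_cint => t _; rewrite E.
  - by move=> t tab; rewrite E; exact: cphi.
  - by move=> t tab; rewrite E; exact: dF.
rewrite /rectint !H ?V ?lexx ?ab ?cd//; ring.
Qed.

Lemma rectintB phi psi a b c d : a <= b -> c <= d ->
  edge_cont phi a b c d -> edge_cont psi a b c d ->
  rectint (fun z => phi z - psi z) a b c d = rectint phi a b c d - rectint psi a b c d.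
Proof.
move=> ab cd cp cq; rewrite /rectint !cintB.
  ring.
all: try (by apply: pcont_v => y yab; first [apply: cp|apply: cq] => //; rewrite ?lexx ?ab ?cd).
all: try (by apply: pcont_h => y yab; first [apply: cp|apply: cq] => //; rewrite ?lexx ?ab ?cd).
Qed.

Lemma rectint_bound phi a b c d M : a <= b -> c <= d -> edge_cont phi a b c d ->
  (forall x y, a <= x <= b -> c <= y <= d -> cabs (phi (x +i* y)) <= M) ->
  cabs (rectint phi a b c d) <= 4 * M * ((b - a) + (d - c)).
Proof.
move=> ab cd cp H; rewrite /rectint.
have Hh c' : c <= c' <= d -> cabs (cint a b (fun x => phi (x +i* c'))) <= 2 * M * (b - a).
  move=> cc; apply: cint_norm => //; last by move=> t tab; exact: H.
  by apply: pcont_h => x xab; exact: cp.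
have Hv a' : a <= a' <= b -> cabs ('i * cint c d (fun y => phi (a' +i* y))) <= 2 * M * (d - c).
  move=> cc; rewrite cabsM cabs_i mul1r; apply: cint_norm => //; last by move=> t tab; exact: H.
  by apply: pcont_v => x xab; exact: cp.
have h1 := Hh c; have h2 := Hh d; have v1 := Hv a; have v2 := Hv b.
rewrite !lexx ab cd in h1 h2 v1 v2.
apply: (le_trans (cabsB _ _)); apply: (le_trans (lerD (cabsB _ _) (lexx _))).
apply: (le_trans (lerD (lerD (cabsD _ _) (lexx _)) (lexx _))).
have := h1 isT; have := h2 isT; have := v1 isT; have := v2 isT; lra.
Qed.

Lemma one_of_four (r1 r2 r3 r4 : R[i]) (k : R) :
  4 * k <= cabs (r1 + r2 + (r3 + r4)) ->
  [\/ k <= cabs r1, k <= cabs r2, k <= cabs r3 | k <= cabs r4].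
Proof.
move=> H; have [|k1] := leP k (cabs r1); first by move=> ?; apply: Or41.
have [|k2] := leP k (cabs r2); first by move=> ?; apply: Or42.
have [|k3] := leP k (cabs r3); first by move=> ?; apply: Or43.
have [|k4] := leP k (cabs r4); first by move=> ?; apply: Or44.
have := cabsD (r1 + r2) (r3 + r4); have := cabsD r1 r2; have := cabsD r3 r4; lra.
Qed.

(** If the integral [k] over the boundary is not zero, one of the four quarters
    carries at least a quarter of it, and so on: the cells shrink to a point
    where [phi] is differentiable.  The affine part of [phi] there has a
    primitive and integrates to 0, and the remainder on the [n]-th cell is at
    most [e] times its squared size, which contradicts the lower bound
    [k / 4 ^+ n] as soon as [e] is small. *)
Theorem goursat phi a b c d : a <= b -> c <= d ->
  (forall x y, a <= x <= b -> c <= y <= d -> exists l, cderiv phi (x +i* y) l) ->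
  rectint phi a b c d = 0.
Proof.
move=> ab cd D.
have EC : edge_cont phi a b c d by move=> x y xab ycd; have [l /cderiv_cont] := D x y xab ycd.
have ECW a' b' c' d' : a <= a' -> b' <= b -> c <= c' -> d' <= d -> edge_cont phi a' b' c' d'.
  move=> h1 h2 h3 h4 x y /andP[x1 x2] /andP[y1 y2]; apply: EC.
    by rewrite (le_trans h1)//= (le_trans x2).
  by rewrite (le_trans h3)//= (le_trans y2).
pose w := b - a; pose h := d - c.
have w0 : 0 <= w by rewrite subr_ge0.
have h0 : 0 <= h by rewrite subr_ge0.
pose k := cabs (rectint phi a b c d).
have [/eqP|k0] := eqVneq k 0; first by rewrite cabs_eq0 => /eqP.
have {}k0 : 0 < k by rewrite lt_def k0 /k/=.
pose B n x y := [/\ a <= x, x + w / 2 ^+ n <= b, c <= y, y + h / 2 ^+ n <= d &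
   k / 4 ^+ n <= cabs (rectint phi x (x + w / 2 ^+ n) y (y + h / 2 ^+ n))].
have hf (v : R) n : v / 2 ^+ n = v / 2 ^+ n.+1 + v / 2 ^+ n.+1.
  by rewrite exprS; field; rewrite expf_neq0.
have pos (v : R) n : 0 <= v -> 0 <= v / 2 ^+ n by move=> v0; rewrite divr_ge0// exprn_ge0.
have step n x y : B n x y -> exists x' y', [/\ B n.+1 x' y',
     x <= x' <= x + w / 2 ^+ n.+1 & y <= y' <= y + h / 2 ^+ n.+1].
  rewrite /B (hf w) (hf h); set u := w / _; set v := h / _.
  have u0 : 0 <= u by exact: pos. have v0 : 0 <= v by exact: pos.
  rewrite !addrA; move=> [ax xb cy yd].
  rewrite (@rectint_split_x phi x (x + u))//; try lra; last by apply: ECW; lra.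
  rewrite (@rectint_split_y phi x (x + u) y (y + v))//; try lra; last by apply: ECW; lra.
  rewrite (@rectint_split_y phi (x + u) (x + u + u) y (y + v))//; try lra; last by apply: ECW; lra.
  have -> : k / 4 ^+ n = 4 * (k / 4 ^+ n.+1) by rewrite exprS; field; rewrite expf_neq0.
  set k4 := k / _; set r1 := rectint _ _ _ _ _; set r2 := rectint _ _ _ _ _.
  set r3 := rectint _ _ _ _ _; set r4 := rectint _ _ _ _ _ => Hk.
  by case: (one_of_four Hk) => Hr; [exists x, y|exists x, (y + v)|exists (x + u), y|
    exists (x + u), (y + v)]; split; [split|idtac|idtac|split|idtac|idtac|split|idtac|
    idtac|split|idtac|idtac] => //; clear -u0 v0 ax xb cy yd; lra.
have B0 : B 0%N a c.
  by rewrite /B !expr0 !divr1 /w /h !(addrC _ (_ - _)) !subrK; split.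
have [xs [ys Hs]] := nested_cells w0 h0 step B0.
have sab : a <= xs <= b.
  by have [x [y [[]]]] := Hs 0%N; rewrite expr0 divr1 => ? ? ? ? ? ? ?; lra.
have scd : c <= ys <= d.
  by have [x [y [[]]]] := Hs 0%N; rewrite expr0 !divr1 => ? ? ? ? ? ? ?; lra.
have [l Dl] := D xs ys sab scd.
pose Q := (w + h) ^+ 2 + 1.
have Q0 : 0 < Q by rewrite ltr_wpDl// sqr_ge0.
(* [e] is chosen so that [4 * e * (w + h) ^+ 2 < k]. *)
pose e := k / (8 * Q).
have e0 : 0 < e by rewrite divr_gt0// mulr_gt0.
have [dl dl0 H] := Dl e e0.
have [n Hn] := half_pow_small (w + h) dl0.
have [x [y [[ax xb cy yd Hk] xx yy]]] := Hs n.
set u := w / 2 ^+ n in xb Hk xx. set v := h / 2 ^+ n in yd Hk yy.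
have u0 : 0 <= u by exact: pos. have v0 : 0 <= v by exact: pos.
have uv : (w + h) / 2 ^+ n = u + v by rewrite mulrDl.
pose ps := xs +i* ys.
pose aff z := phi ps + l * (z - ps).
have affd z : cderiv aff z l.
  have := cderivD (cderiv_cst (phi ps) z) (cderivZ l (cderivB (cderiv_id z) (cderiv_cst ps z))).
  by rewrite add0r subr0 mulr1.
have affc a' b' c' d' : edge_cont aff a' b' c' d' by move=> x' y' _ _; exact: cderiv_cont (affd _).
have affI : rectint aff x (x + u) y (y + v) = 0.
  apply: (@rectint_primitive _ (fun z => phi ps * z + l * ((z - ps) * (z - ps) / 2))) => //; try lra.
  move=> x' y' _ _; set z := x' +i* y'.
  have zp : cderiv (fun w => w - ps) z 1.
    by have := cderivB (cderiv_id z) (cderiv_cst ps z); rewrite subr0.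
  have -> : aff z = phi ps * 1 + l * ((1 * (z - ps) + (z - ps) * 1) * 2^-1 + (z - ps) * (z - ps) * 0).
    by rewrite /aff; field.
  exact: (cderivD (cderivZ (phi ps) (cderiv_id z)) (cderivZ l (cderivM (cderivM zp zp) (cderiv_cst 2^-1 z)))).
have E1 : edge_cont phi x (x + u) y (y + v) by exact: ECW.
have xu : x <= x + u by rewrite lerDl.
have yv : y <= y + v by rewrite lerDl.
have HR := rectintB xu yv E1 (affc _ _ _ _).
rewrite affI subr0 in HR; rewrite -HR in Hk.
have Hb : cabs (rectint (fun z => phi z - aff z) x (x + u) y (y + v)) <= 4 * (e * (u + v)) * (u + v).
  have -> : 4 * (e * (u + v)) * (u + v) = 4 * (e * (u + v)) * ((x + u - x) + (y + v - y)) by ring.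
  apply: rectint_bound => //.
    move=> x' y' x1 y1; have := ccontD (E1 x' y' x1 y1) (cderiv_cont (cderivN (affd (x' +i* y')))).
    by [].
  move=> x' y' x1 y1; have cz : cabs (x' +i* y' - ps) <= u + v.
    rewrite (le_trans (cabs_le _))//= lerD//; rewrite ler_norml; lra.
  rewrite /aff opprD addrA (le_trans (H _ _))//.
    by rewrite (le_lt_trans cz)// -uv.
  by rewrite ler_wpM2l// ltW.
have : k / 4 ^+ n <= 4 * e * ((w + h) ^+ 2 / 4 ^+ n).
  apply: (le_trans Hk); apply: (le_trans Hb).
  have -> : (w + h) ^+ 2 / 4 ^+ n = (u + v) ^+ 2.
    rewrite -uv expr_div_n -exprM mulnC exprM; congr (_ / _ ^+ _); by rewrite -natrX.
  by rewrite expr2; lra.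
rewrite mulrA ler_pM2r ?invr_gt0 ?exprn_gt0// /e => Hf.
have : k < k; last by rewrite ltxx.
apply: (le_lt_trans Hf).
have -> : 4 * (k / (8 * Q)) * (w + h) ^+ 2 = k * ((w + h) ^+ 2 / (2 * Q)).
  by field; rewrite gt_eqF.
rewrite -[ltRHS]mulr1 ltr_pM2l// ltr_pdivrMr ?mulr_gt0// mul1r /Q.
have := sqr_ge0 (w + h); lra.
Qed.
End Goursat.

(** * The complex exponential *)

Section Exponential.
Context {R : realType}.
Implicit Types (z w : R[i]) (s t x y : R).

Definition circ t : R[i] := cos t +i* sin t.
Definition cexp z : R[i] := (expR (complex.Re z))%:C * circ (complex.Im z).

Lemma cabs_circ t : cabs (circ t) = 1.
Proof. by rewrite /cabs /= cos2Dsin2 sqrtr1. Qed.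

Lemma circD s t : circ (s + t) = circ s * circ t.
Proof. by apply: ceqP; rewrite /= ?cosD ?sinD//; ring. Qed.

Lemma circ0 : circ 0 = 1.
Proof. by rewrite /circ cos0 sin0. Qed.

Lemma circ2pi : circ (2 * pi) = 1.
Proof. by rewrite /circ mulr_natl cos2pi sin2pi. Qed.

Lemma cabs_cexp z : cabs (cexp z) = expR (complex.Re z).
Proof. by rewrite cabsM cabs_circ cabs_real mulr1 ger0_norm// expR_ge0. Qed.

Lemma cexpD z w : cexp (z + w) = cexp z * cexp w.
Proof. by rewrite /cexp cReD cImD expRD circD rmorphM/=; ring. Qed.

Lemma cexp0 : cexp 0 = 1.
Proof. by rewrite /cexp /= expR0 circ0 mulr1. Qed.

(** The only analytic input on the exponential: the derivatives at 0 of [expR],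
    [cos] and [sin].  Multiplicativity carries the result to every point. *)
Lemma cderiv_cexp0 : cderiv cexp 0 1.
Proof.
move=> e e0; have e1 : 0 < e / 8 by rewrite divr_gt0.
have e2 : 0 < Num.min 1 (e / 8) by rewrite lt_min ltr01.
have [d1 d10 H1] := (is_derive_epsP _ _ _).1 (is_derive_expR 0) _ e1.
have [d2 d20 H2] := (is_derive_epsP _ _ _).1 (is_derive_cos 0) _ e1.
have [d3 d30 H3] := (is_derive_epsP _ _ _).1 (is_derive_sin 0) _ e1.
have cexpR : {for 0, continuous (@expR R)} by exact: continuous_expR.
have [d4 d40 H4] := (continuous_epsP _ _).1 cexpR _ e2.
exists (Num.min (Num.min d1 d2) (Num.min d3 d4)); first by rewrite !lt_min d10 d20 d30.
case=> x y; rewrite subr0 !lt_min => /andP[/andP[h1 h2] /andP[h3 h4]].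
have xh := Re_le (x +i* y); have yh := Im_le (x +i* y); rewrite /= in xh yh.
set h := cabs _ in h1 h2 h3 h4 xh yh *.
have := H1 x; rewrite expR0 subr0 mul1r => /(_ (le_lt_trans xh h1)) {}H1.
have := H2 y; rewrite cos0 sin0 subr0 oppr0 mul0r subr0 => /(_ (le_lt_trans yh h2)) {}H2.
have := H3 y; rewrite sin0 cos0 !subr0 mul1r => /(_ (le_lt_trans yh h3)) {}H3.
have := H4 x; rewrite expR0 subr0 => /(_ (le_lt_trans xh h4)) {}H4.
have h0 : 0 <= h by exact: cabs_ge0.
rewrite cexp0.
have -> : cexp (x +i* y) - 1 - 1 * (x +i* y) =
  (expR x)%:C * ((cos y - 1) +i* (sin y - y)) + (expR x - 1 - x)%:C + (y * (expR x - 1))%:C * 'i.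
  by apply: ceqP => /=; ring.
move: H4; rewrite le_min => /andP[H4 H5].
have ex2 : expR x <= 2 by have := ler_norm (expR x - 1); lra.
apply: (le_trans (cabsD _ _)); apply: (le_trans (lerD (cabsD _ _) (lexx _))).
rewrite !cabsM !cabs_real cabs_i mulr1 (ger0_norm (expR_ge0 x)) normrM.
have A1 : cabs ((cos y - 1) +i* (sin y - y)) <= e / 8 * h + e / 8 * h.
  rewrite (le_trans (cabs_le _))//= lerD//.
    by rewrite (le_trans H2)// ler_wpM2l// ltW.
  by rewrite (le_trans H3)// ler_wpM2l// ltW.
have A2 : expR x * cabs ((cos y - 1) +i* (sin y - y)) <= 2 * (e / 8 * h + e / 8 * h).
  by rewrite ler_pM// expR_ge0.
have A3 : `|expR x - 1 - x| <= e / 8 * h by rewrite (le_trans H1)// ler_wpM2l// ltW.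
have A4 : `|y| * `|expR x - 1| <= h * (e / 8) by rewrite ler_pM.
have : 0 <= e * h by rewrite mulr_ge0// ltW.
lra.
Qed.

Lemma cderiv_cexp z : cderiv cexp z (cexp z).
Proof.
have := cderivZ (cexp z) (cderiv_comp (cderivB (cderiv_id z) (cderiv_cst z z)) (_ : cderiv cexp (z - z) 1)).
rewrite subrr => /(_ cderiv_cexp0); rewrite subr0 !mulr1.
apply: (eq_cderiv (ltr01)) => w _ /=.
by rewrite -cexpD addrC subrK.
Qed.

Lemma pcont_circ a b : pcont a b circ.
Proof.
by split => t _; [exact: continuous_cos|exact: continuous_sin].
Qed.
End Exponential.

(** * The mean value property on circles *)

Section MeanValue.
Context {R : realType}.
Implicit Types (q : R[i] -> R[i]) (c z w a : R[i]) (r s t e : R).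

Definition cpath c r t : R[i] := c + r%:C * circ t.

Lemma cabs_cpath c r t : 0 <= r -> cabs (cpath c r t - c) = r.
Proof.
by move=> r0; rewrite /cpath addrAC subrr add0r cabsM cabs_circ mulr1 cabs_real ger0_norm.
Qed.

Lemma pcont_cpath x y c r : pcont x y (cpath c r).
Proof.
apply: pcontD; first exact: pcont_cst.
by apply: pcontZ; exact: pcont_circ.
Qed.

Definition cmean c r q : R[i] := ((2 * pi)^-1)%:C * cint 0 (2 * pi) (fun t => q (cpath c r t)).

Lemma twopi_gt0 : 0 < 2 * pi :> R.
Proof. by rewrite mulr_gt0// pi_gt0. Qed.

Lemma pcont_circle q c r : 0 <= r -> (forall z, cabs (z - c) = r -> ccont q z) ->
  pcont 0 (2 * pi) (fun t => q (cpath c r t)).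
Proof.
move=> r0 H; apply: pcont_comp; first exact: pcont_cpath.
by move=> t _; apply: H; rewrite cabs_cpath.
Qed.

(** Uniform continuity along a circle, by compactness of [[0, 2 pi]].  The
    second point may leave the circle, which makes the mean of [q] over a circle
    continuous in the radius. *)
Lemma circ_unif q c r : 0 <= r -> (forall z, cabs (z - c) = r -> ccont q z) ->
  forall e, 0 < e -> exists2 dl : R, 0 < dl & forall t, 0 <= t <= 2 * pi ->
  forall w, cabs (w - cpath c r t) < dl -> cabs (q w - q (cpath c r t)) <= e.
Proof.
move=> r0 cq e e0; have := @segment_compact R 0 (2 * pi); rewrite compact_near_coveringP.
move=> /(_ R (0^'+) (fun dl t => forall w, cabs (w - cpath c r t) < dl -> cabs (q w - q (cpath c r t)) <= e) _) H.
have {}H : \forall dl \near 0^'+, `[0, 2 * pi] `<=`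
    (fun t => forall w, cabs (w - cpath c r t) < dl -> cabs (q w - q (cpath c r t)) <= e).
  apply: H => t _; have e20 : 0 < e / 2 by rewrite divr_gt0.
  have [d1 d10 H1] := cq (cpath c r t) (cabs_cpath _ _ r0) _ e20.
  have d12 : 0 < d1 / 2 by rewrite divr_gt0.
  have tt : t <= t <= t by rewrite lexx.
  have [d2 d20 H2] := (pcontP t t (cpath c r)).1 (pcont_cpath t t c r) t tt _ d12.
  exists ([set y | `|y - t| < d2], [set dl | dl < d1 / 2]) => /=.
    split => /=.
      apply/nbhs_ballP; exists d2 => // y; by rewrite /ball/= distrC.
    exact: nbhs_right_lt.
  move=> [y dl] /= [yt dld] w wy.
  have {}H2 := H2 _ yt.
  have E1 : cabs (q w - q (cpath c r t)) <= e / 2.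
    apply: H1; rewrite (le_lt_trans (cabs_tri (cpath c r y) _ _))//; lra.
  have E2 : cabs (q (cpath c r y) - q (cpath c r t)) <= e / 2.
    apply: H1; lra.
  rewrite (le_trans (cabs_tri (q (cpath c r t)) _ _))// (splitr e) lerD//.
  by rewrite cabsC.
move: H => /(filterI (nbhs_right_gt (0 : R))) /filter_ex[dl [dl0 H]].
by exists dl => // t tab; apply: H; rewrite /= in_itv.
Qed.

(** Passing over an isolated radius at which nothing is known: continuity at the
    ends turns constancy on the open interval into equality of the end values. *)
Lemma const_endpoints (K : R -> R[i]) x y : x < y ->
  (forall e, 0 < e -> exists2 dl : R, 0 < dl & forall r, x < r < x + dl -> r < y ->
     cabs (K r - K x) <= e) ->
  (forall e, 0 < e -> exists2 dl : R, 0 < dl & forall r, y - dl < r < y -> x < r ->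
     cabs (K r - K y) <= e) ->
  (forall r1 r2, x < r1 -> r1 <= r2 -> r2 < y -> K r1 = K r2) -> K x = K y.
Proof.
move=> xy Hx Hy HK; apply/eqP; rewrite -subr_eq0 -cabs_eq0 eq_le cabs_ge0 andbT.
apply/ler_addgt0Pl => e e0; rewrite addr0.
have e20 : 0 < e / 2 by rewrite divr_gt0.
have [d1 d10 H1] := Hx _ e20; have [d2 d20 H2] := Hy _ e20.
pose d := Num.min (Num.min d1 d2) (y - x) / 2.
have m0 : 0 < Num.min (Num.min d1 d2) (y - x) by rewrite !lt_min d10 d20 subr_gt0.
have d0 : 0 < d by rewrite divr_gt0.
have : Num.min (Num.min d1 d2) (y - x) <= Num.min (Num.min d1 d2) (y - x) by [].
rewrite [in X in X -> _]le_min [in X in X -> _]le_min => /andP[/andP[m1 m2] m3].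
have dE : Num.min (Num.min d1 d2) (y - x) = 2 * d by rewrite /d; field.
rewrite dE in m1 m2 m3; clearbody d; clear m0 dE.
have {}H1 : cabs (K (x + d) - K x) <= e / 2 by apply: H1; lra.
have {}H2 : cabs (K (y - d) - K y) <= e / 2 by apply: H2; lra.
have E : K (x + d) = K (y - d) by apply: HK; lra.
rewrite E in H1; rewrite (le_trans (cabs_tri (K (y - d)) _ _))// (splitr e) lerD//.
by rewrite cabsC.
Qed.

(** The integral [K s] of [q] over the circle of radius [s] does not depend on
    [s].  Indeed [z |-> c + cexp z] maps the rectangle
    [[ln r1, ln r2] x [0, 2 pi]] onto an annulus; the horizontal sides cancel
    because [cexp] has period [2 pi i], the vertical sides are [K r1] and
    [K r2], and Goursat's theorem applies.  One exceptional point [a], where [q]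
    is only continuous, is what the difference quotient in the proof of Cauchy's
    formula needs: [K] is constant on either side of the radius of [a], and it
    is continuous. *)
Theorem mean_value q c r a : 0 < r ->
  (forall z, cabs (z - c) <= r -> ccont q z) ->
  (forall z, cabs (z - c) <= r -> z != c -> z != a -> exists l, cderiv q z l) ->
  cmean c r q = q c.
Proof.
move=> r0 cq dq; pose K s := cint 0 (2 * pi) (fun t => q (cpath c s t)).
have pi0 := twopi_gt0.
have K0 : K 0 = (2 * pi)%:C * q c.
  rewrite /K (@eq_cint _ _ _ _ (fun=> q c)); last by move=> t _; rewrite /cpath mul0r addr0.
  by rewrite cint_cst ?subr0// ltW.
suff Kr : K 0 = K r.
  rewrite /cmean -/(K r) -Kr K0 mulrA -rmorphM/= mulVf ?mul1r//.
  by rewrite gt_eqF.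
have pcK s : 0 <= s -> s <= r -> pcont 0 (2 * pi) (fun t => q (cpath c s t)).
  by move=> s0 sr; apply: pcont_circle => // z zs; apply: cq; rewrite zs.
have Kcont s : 0 <= s -> s <= r -> forall e, 0 < e -> exists2 dl : R, 0 < dl &
    forall s', 0 <= s' -> s' <= r -> `|s' - s| < dl -> cabs (K s' - K s) <= e.
  move=> s0 sr e e0; have e1 : 0 < e / (4 * pi) by rewrite divr_gt0// mulr_gt0// pi_gt0.
  have [|dl dl0 H] := @circ_unif q c s s0 _ _ e1; first by move=> z zs; apply: cq; rewrite zs.
  exists dl => // s' s'0 s'r ss'.
  rewrite /K -cintB; [|exact: pcK|exact: pcK].
  have pin : (pi : R) != 0 by rewrite gt_eqF ?pi_gt0.
  have E1 (p : R) : p != 0 -> e = 2 * (e / (4 * p)) * (2 * p - 0) by move=> p0; field.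
  rewrite [leRHS](E1 pi)//.
  apply: cint_norm; [exact: ltW|by apply: pcontB; exact: pcK|].
  move=> t tab; apply: H => //.
  by rewrite /cpath opprD addrACA subrr add0r -mulrBl -rmorphB/= cabsM cabs_circ mulr1 cabs_real.
have Kconst r1 r2 : 0 < r1 -> r1 <= r2 -> r2 <= r ->
    (forall s, r1 <= s -> s <= r2 -> s != cabs (a - c)) -> K r1 = K r2.
  move=> r10 r12 r2r Ha; have r20 : 0 < r2 by exact: lt_le_trans r12.
  pose phi z := q (c + cexp z).
  have l12 : ln r1 <= ln r2 by rewrite ler_ln.
  have phiE s t : phi (s +i* t) = q (cpath c (expR s) t) by [].
  have sE s : ln r1 <= s <= ln r2 -> r1 <= expR s <= r2.
    move=> /andP[s1 s2]; rewrite -[r1]lnK// -[r2]lnK//.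
    by rewrite !ler_expR s1 s2.
  have Dphi x y : ln r1 <= x <= ln r2 -> 0 <= y <= 2 * pi -> exists l, cderiv phi (x +i* y) l.
    move=> /sE /andP[x1 x2] _; set z := x +i* y.
    have ze : cabs (c + cexp z - c) = expR x by rewrite addrAC subrr add0r cabs_cexp.
    have [l Hl] : exists l, cderiv q (c + cexp z) l.
      apply: dq; first by rewrite ze (le_trans x2).
        by rewrite -subr_eq0 -cabs_eq0 ze gt_eqF// expR_gt0.
      apply/eqP => H; have := Ha _ x1 x2; rewrite -H ze eqxx//.
    exists (l * (0 + cexp z)); apply: (@cderiv_comp _ (fun z => c + cexp z) q) => //.
    by apply: cderivD; [exact: cderiv_cst|exact: cderiv_cexp].
  have := goursat l12 (ltW pi0) Dphi.
  rewrite /rectint (@eq_cint _ _ _ (fun x => phi (x +i* (2 * pi))) (fun x => phi (x +i* 0))); last first.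
    by move=> t _; rewrite !phiE /cpath circ2pi circ0.
  rewrite addrAC addrC addrA addrAC addrA.
  have -> : cint 0 (2 * pi) (fun y => phi (ln r1 +i* y)) = K r1.
    by apply: eq_cint => t _; rewrite phiE lnK.
  have -> : cint 0 (2 * pi) (fun y => phi (ln r2 +i* y)) = K r2.
    by apply: eq_cint => t _; rewrite phiE lnK.
  move=> /eqP H.
  have : 'i * (K r2 - K r1) = 0 by rewrite -(eqP H); ring.
  move=> /eqP; rewrite mulf_eq0 => /orP[/eqP/(congr1 (@complex.Im R))/= /eqP|].
    by rewrite oner_eq0.
  by rewrite subr_eq0 => /eqP.
have Kopen x y : 0 <= x -> x < y -> y <= r -> ~~ (x < cabs (a - c) < y) -> K x = K y.
  move=> x0 xy yr Ha; apply: const_endpoints => //.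
  - move=> e e0; have [dl dl0 H] := Kcont x x0 (le_trans (ltW xy) yr) e e0.
    exists dl => // s /andP[xs sdl] sy; apply: H; try lra.
    rewrite ltr_norml; lra.
  - move=> e e0; have [dl dl0 H] := Kcont y (le_trans x0 (ltW xy)) yr e e0.
    exists dl => // s /andP[xs sdl] sy; apply: H; try lra.
    rewrite ltr_norml; lra.
  - move=> r1 r2 xr1 r12 r2y; apply: Kconst; try lra.
    move=> s s1 s2; apply: contraNneq Ha => <-; lra.
have [H|] := boolP (0 < cabs (a - c) < r); last by move=> H; exact: Kopen.
move: (H) => /andP[Ha1 Ha2].
rewrite (Kopen 0 (cabs (a - c)))// ?ltxx ?andbF//; last exact: ltW.
by rewrite (Kopen (cabs (a - c)) r)// ?ltxx//.
Qed.
End MeanValue.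

(** * Cauchy's and Schwarz's integral formulas *)

Section CauchyFormula.
Context {R : realType}.
Implicit Types (f g q : R[i] -> R[i]) (c z w a b : R[i]) (r s t e M : R).

Definition circ_cont c r q := pcont 0 (2 * pi) (fun t => q (cpath c r t)).

Lemma circ_contP c r q : 0 <= r -> (forall z, cabs (z - c) = r -> ccont q z) -> circ_cont c r q.
Proof. by move=> r0 H; exact: pcont_circle. Qed.

Lemma eq_cmean c r q q' : 0 <= r -> (forall z, cabs (z - c) = r -> q z = q' z) ->
  cmean c r q = cmean c r q'.
Proof.
move=> r0 H; congr (_ * _); apply: eq_cint => t _; apply: H.
by rewrite cabs_cpath.
Qed.

Lemma eq_circ_cont c r q q' : 0 <= r -> (forall z, cabs (z - c) = r -> q z = q' z) ->
  circ_cont c r q -> circ_cont c r q'.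
Proof.
move=> r0 H; rewrite /circ_cont (_ : (fun t => q (cpath c r t)) = (fun t => q' (cpath c r t)))//.
by apply/funext => t; apply: H; rewrite cabs_cpath.
Qed.

Lemma cmeanD c r q q' : circ_cont c r q -> circ_cont c r q' ->
  cmean c r (fun z => q z + q' z) = cmean c r q + cmean c r q'.
Proof. by move=> H H'; rewrite /cmean cintD// mulrDr. Qed.

Lemma cmeanB c r q q' : circ_cont c r q -> circ_cont c r q' ->
  cmean c r (fun z => q z - q' z) = cmean c r q - cmean c r q'.
Proof. by move=> H H'; rewrite /cmean cintB// mulrBr. Qed.

Lemma cmeanZ c r k q : circ_cont c r q ->
  cmean c r (fun z => k * q z) = k * cmean c r q.
Proof. by move=> H; rewrite /cmean cintZ// mulrCA. Qed.

Definition on_circle c r z := exists2 t, 0 <= t <= 2 * pi & z = cpath c r t.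

Lemma cabs_on_circle c r z : 0 <= r -> on_circle c r z -> cabs (z - c) = r.
Proof. by move=> r0 [t _ ->]; rewrite cabs_cpath. Qed.

Lemma cmean_norm c r q M : 0 <= r -> circ_cont c r q ->
  (forall z, on_circle c r z -> cabs (q z) <= M) -> cabs (cmean c r q) <= 2 * M.
Proof.
move=> r0 cq H; have pi0 := @twopi_gt0 R; rewrite /cmean cabsM cabs_real ger0_norm; last first.
  by rewrite invr_ge0 ltW.
rewrite mulrC ler_pdivrMr// -[2 * pi in leRHS]subr0; apply: cint_norm; [exact: ltW|by []|].
by move=> t tab; apply: H; exists t.
Qed.

Lemma circ_bounded c r q : circ_cont c r q ->
  exists M, forall z, on_circle c r z -> cabs (q z) <= M.
Proof.
move=> [/rcont_within c1 /rcont_within c2]; have pi0 := ltW (@twopi_gt0 R).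
pose f1 t := complex.Re (q (cpath c r t)); pose f2 t := complex.Im (q (cpath c r t)).
have [x1 _ H1] := @EVT_max R f1 _ _ pi0 c1; have [y1 _ G1] := @EVT_min R f1 _ _ pi0 c1.
have [x2 _ H2] := @EVT_max R f2 _ _ pi0 c2; have [y2 _ G2] := @EVT_min R f2 _ _ pi0 c2.
exists (`|f1 x1| + `|f1 y1| + (`|f2 x2| + `|f2 y2|)) => _ [t tab ->].
have tin : t \in Interval (BLeft 0) (BRight (2 * pi)) by rewrite in_itv.
apply: (le_trans (cabs_le _)); rewrite -/(f1 t) -/(f2 t) lerD//.
  have := H1 t tin; have := G1 t tin; have := ler_norm (f1 x1); have := ler_norm (- f1 y1).
  rewrite normrN => *; rewrite ler_norml; have := normr_ge0 (f1 x1); have := normr_ge0 (f1 y1); lra.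
have := H2 t tin; have := G2 t tin; have := ler_norm (f2 x2); have := ler_norm (- f2 y2).
rewrite normrN => *; rewrite ler_norml; have := normr_ge0 (f2 x2); have := normr_ge0 (f2 y2); lra.
Qed.

Lemma circ_contD c r q q' : circ_cont c r q -> circ_cont c r q' ->
  circ_cont c r (fun z => q z + q' z).
Proof. exact: pcontD. Qed.

Lemma circ_contB c r q q' : circ_cont c r q -> circ_cont c r q' ->
  circ_cont c r (fun z => q z - q' z).
Proof. exact: pcontB. Qed.

Lemma circ_contM c r q q' : circ_cont c r q -> circ_cont c r q' ->
  circ_cont c r (fun z => q z * q' z).
Proof. exact: pcontM. Qed.

Lemma circ_contZ c r k q : circ_cont c r q -> circ_cont c r (fun z => k * q z).
Proof. exact: pcontZ. Qed.

Lemma conjcRe z : complex.Re z^* = complex.Re z. Proof. by case: z. Qed.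
Lemma conjcIm z : complex.Im z^* = - complex.Im z. Proof. by case: z. Qed.

Lemma cabsJ z : cabs z^* = cabs z.
Proof. by rewrite /cabs conjcRe conjcIm sqrrN. Qed.

Lemma rintN x y (h : R -> R) : rcont x y h -> rint x y (fun t => - h t) = - rint x y h.
Proof.
move=> ch; rewrite -mulN1r -rintZ//; apply: eq_rint => t _; by rewrite mulN1r.
Qed.

Lemma circ_contJ c r q : circ_cont c r q -> circ_cont c r (fun z => (q z)^*).
Proof.
move=> [c1 c2]; split.
  by apply: eq_rcont c1 => t; rewrite conjcRe.
by apply: eq_rcont (rcontN c2) => t; rewrite conjcIm.
Qed.

Lemma conjc_scale (k : R) z : (k%:C * z)^* = k%:C * z^*.
Proof. by case: z => x y; apply: ceqP => /=; ring. Qed.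

Lemma cmeanJ c r q : circ_cont c r q -> cmean c r (fun z => (q z)^*) = (cmean c r q)^*.
Proof.
move=> [c1 c2]; rewrite /cmean conjc_scale; congr (_ * _).
apply: ceqP; rewrite ?conjcRe ?conjcIm/=.
  by apply: eq_rint => t _; rewrite conjcRe.
by rewrite -rintN//; apply: eq_rint => t _; rewrite conjcIm.
Qed.

Lemma mulcJ z : z * z^* = (cabs z ^+ 2)%:C.
Proof. by rewrite cabs_sq; case: z => x y; apply: ceqP => /=; ring. Qed.

(** The derivative is part of the data because the estimates below are about
    it. *)
Definition hol f f' c r := forall z, cabs (z - c) <= r -> cderiv f z (f' z).

Lemma hol_cont f f' c r : hol f f' c r -> forall z, cabs (z - c) <= r -> ccont f z.
Proof. by move=> H z zr; exact: cderiv_cont (H z zr). Qed.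

Lemma holW f f' c r c' r' : cabs (c' - c) + r' <= r -> hol f f' c r -> hol f f' c' r'.
Proof.
move=> cr H z zr; apply: H; rewrite (le_trans (cabs_tri c' _ _))// (le_trans _ cr)//.
by rewrite addrC lerD.
Qed.

Lemma cderivX1 c z : cderiv (fun w => w - c) z 1.
Proof. by have := cderivB (cderiv_id z) (cderiv_cst c z); rewrite subr0. Qed.

Lemma ccontX1 c z : ccont (fun w => w - c) z.
Proof. exact: cderiv_cont (cderivX1 c z). Qed.

Lemma mean_hol f f' c r : 0 < r -> hol f f' c r -> cmean c r f = f c.
Proof.
move=> r0 H; apply: (@mean_value _ f c r c) => //; first exact: hol_cont H.
by move=> z zr _ _; exists (f' z); exact: H.
Qed.

Lemma notin_circle c a r z : cabs (a - c) < r -> cabs (z - c) = r -> z - a != 0.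
Proof.
move=> ar zr; rewrite subr_eq0; apply: contraTneq ar => <-.
by rewrite zr ltxx.
Qed.

(** On the circle, the conjugate of the Cauchy kernel with pole [a] is a
    kernel whose pole is the reflection of [a] in the circle, so that it is
    analytic on the disc. *)
Lemma conj_kernel c a r z : 0 < r -> cabs (a - c) < r -> cabs (z - c) = r ->
  ((z - c) / (z - a))^* = (r ^+ 2)%:C / ((r ^+ 2)%:C - (a - c)^* * (z - c)).
Proof.
move=> r0 ar zr; rewrite rmorphM/= fmorphV/=.
have zc0 : z - c != 0 by rewrite -cabs_gt0 zr.
have za0 := notin_circle ar zr.
have E : (z - c)^* = (r ^+ 2)%:C / (z - c).
  by rewrite -zr -mulcJ; field.
have -> : (r ^+ 2)%:C - (a - c)^* * (z - c) = (z - a)^* * (z - c).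
  rewrite -zr -mulcJ.
  have -> : (z - a)^* = (z - c)^* - (a - c)^* by rewrite -rmorphB/=; congr (_^*); ring.
  ring.
have za0' : (z - a)^* != 0 by rewrite conjc_eq0.
rewrite E; move: (_^*) za0' => w w0; by field; rewrite zc0 w0.
Qed.

Lemma kernel_den_neq0 c a r z : 0 < r -> cabs (a - c) < r -> cabs (z - c) <= r ->
  (r ^+ 2)%:C - (a - c)^* * (z - c) != 0.
Proof.
move=> r0 ar zr; rewrite -cabs_gt0.
have := cabsBge ((r ^+ 2)%:C) ((a - c)^* * (z - c)).
rewrite cabsM cabsJ cabs_real ger0_norm ?sqr_ge0// => H; apply: lt_le_trans H.
rewrite subr_gt0 expr2; apply: le_lt_trans (_ : _ <= cabs (a - c) * r) _.
  by rewrite ler_wpM2l.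
by rewrite ltr_pM2r.
Qed.

Lemma hol_reflected c a r : 0 < r -> cabs (a - c) < r ->
  exists k', hol (fun z => (r ^+ 2)%:C / ((r ^+ 2)%:C - (a - c)^* * (z - c))) k' c r.
Proof.
move=> r0 ar; eexists => z zr.
apply: cderivZ; apply: (@cderivV _ (fun z => (r ^+ 2)%:C - (a - c)^* * (z - c))).
  exact: kernel_den_neq0.
apply: cderivB; first exact: cderiv_cst.
by apply: cderivZ; exact: cderivX1.
Qed.

Lemma circ_cont_kernel c a r : 0 < r -> cabs (a - c) < r ->
  circ_cont c r (fun z => (z - c) / (z - a)).
Proof.
move=> r0 ar; apply: circ_contP; first exact: ltW.
move=> z zr; apply: ccontM; first exact: ccontX1.
by apply: ccontV; [exact: notin_circle zr|exact: ccontX1].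
Qed.

(** The reflected kernel is analytic on the disc and equals 1 at the centre, so
    the mean value property applies to the product. *)
Lemma mean_reflected f f' c a r : 0 < r -> cabs (a - c) < r -> hol f f' c r ->
  cmean c r (fun z => f z * ((z - c) / (z - a))^*) = f c.
Proof.
move=> r0 ar Hf; have [k' Hk] := hol_reflected r0 ar.
rewrite (@eq_cmean _ _ _ (fun z => f z * ((r ^+ 2)%:C / ((r ^+ 2)%:C - (a - c)^* * (z - c))))) ?ltW//; last first.
  by move=> z zr; rewrite (conj_kernel r0 ar zr).
rewrite (@mean_hol _ (fun z => f' z * ((r ^+ 2)%:C / ((r ^+ 2)%:C - (a - c)^* * (z - c))) + f z * k' z))//.
  rewrite subrr mulr0 subr0 divff ?mulr1//.
  by rewrite -cabs_eq0 cabs_real normr_eq0 expf_neq0// gt_eqF.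
by move=> z zr; apply: cderivM; [exact: Hf|exact: Hk].
Qed.

Lemma mean_kernel c a r : 0 < r -> cabs (a - c) < r ->
  cmean c r (fun z => (z - c) / (z - a)) = 1.
Proof.
move=> r0 ar; apply: (can_inj (@conjCK R[i])); rewrite -cmeanJ; last exact: circ_cont_kernel.
rewrite rmorph1 -(@mean_reflected (fun=> 1) (fun=> 0) c a r)//; last by move=> z _; exact: cderiv_cst.
by apply: eq_cmean => [|z _]; [exact: ltW|rewrite mul1r].
Qed.

(** The difference quotient [D] of [f] at [a] is continuous on the disc and
    analytic off [a]; the mean value property of [D z * (z - c)], which vanishes
    at the centre, gives the formula, since the kernel has mean 1. *)
Theorem cauchy_formula f f' c a r : 0 < r -> cabs (a - c) < r -> hol f f' c r ->
  cmean c r (fun z => f z * ((z - c) / (z - a))) = f a.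
Proof.
move=> r0 ar Hf.
pose D z := if z == a then f' a else (f z - f a) / (z - a).
have cf := hol_cont Hf.
have DE z : z != a -> D z = (f z - f a) / (z - a) by rewrite /D => /negbTE ->.
have Dd z : cabs (z - c) <= r -> z != a -> exists l, cderiv D z l.
  move=> zr za; have za0 : z - a != 0 by rewrite subr_eq0.
  eexists; have e0 : 0 < cabs (z - a) by rewrite cabs_gt0.
  apply: (@eq_cderiv _ (fun w => (f w - f a) * (w - a)^-1) D z _ _ e0) => [w wz|].
    by rewrite DE//; apply: contraTneq wz => ->; rewrite cabsC ltxx.
  apply: cderivM; first by apply: cderivB; [exact: Hf|exact: cderiv_cst].
  apply: (@cderivV _ (fun w => w - a)) => //; exact: cderivX1.
have Dc z : cabs (z - c) <= r -> ccont D z.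
  move=> zr; have [->|za] := eqVneq z a; last by have [l /cderiv_cont] := Dd z zr za.
  move=> e e0; have [dl dl0 H] := Hf a (ltW ar) e e0; exists dl => // w /H.
  have Da : D a = f' a by rewrite /D eqxx.
  rewrite Da => H1; have [->|wa] := eqVneq w a; first by rewrite Da subrr cabs0 (ltW e0).
  rewrite DE//; have wa0 : w - a != 0 by rewrite subr_eq0.
  rewrite -(ler_pM2r (_ : 0 < cabs (w - a))) ?cabs_gt0// -cabsM.
  by rewrite (_ : _ * (w - a) = f w - f a - f' a * (w - a))//; field.
have HQ : cmean c r (fun z => D z * (z - c)) = 0.
  rewrite (@mean_value _ (fun z => D z * (z - c)) c r a)//.
  - by rewrite subrr mulr0.
  - by move=> z zr; apply: ccontM; [exact: Dc|exact: ccontX1].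
  - move=> z zr _ za; have [l Hl] := Dd z zr za.
    by eexists; apply: cderivM; [exact: Hl|exact: cderivX1].
have r0' := ltW r0.
have ck := circ_cont_kernel r0 ar.
have cfc : circ_cont c r f by apply: circ_contP => // z zr; apply: cf; rewrite zr.
have : cmean c r (fun z => f z * ((z - c) / (z - a)) - f a * ((z - c) / (z - a))) = 0.
  rewrite -HQ; apply: eq_cmean => // z zr; have za0 := notin_circle ar zr.
  have za : z != a by rewrite -subr_eq0.
  by rewrite DE//; field.
rewrite cmeanB; [|exact: circ_contM|exact: circ_contZ].
by rewrite cmeanZ// mean_kernel// mulr1 => /eqP; rewrite subr_eq0 => /eqP.
Qed.

(** An analytic function is recovered inside a circle from its real part on the
    circle: add to Cauchy's formula the conjugate of the formula with the
    reflected kernel.  This is how bounds on [Re g] become bounds on [g']. *)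
Theorem schwarz_formula g g' c a r : 0 < r -> cabs (a - c) < r -> hol g g' c r ->
  cmean c r (fun z => (2 * complex.Re (g z))%:C * ((z - c) / (z - a))) = g a + (g c)^*.
Proof.
move=> r0 ar Hg; have r0' := ltW r0; have ck := circ_cont_kernel r0 ar.
have cg : circ_cont c r g by apply: circ_contP => // z zr; apply: (hol_cont Hg); rewrite zr.
rewrite -(cauchy_formula r0 ar Hg) -(mean_reflected r0 ar Hg) -cmeanJ; last first.
  by apply: circ_contM => //; exact: circ_contJ.
rewrite -cmeanD; [|exact: circ_contM|apply: circ_contJ; apply: circ_contM => //; exact: circ_contJ].
apply: eq_cmean => // z zr; rewrite (_ : (g z * ((z - c) / (z - a))^*)^* = (g z)^* * ((z - c) / (z - a))); last by case: (g z) (_ / _) => [? ?] [? ?]; apply: ceqP => /=; ring.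
rewrite -mulrDl; congr (_ * _).
by case: (g z) => x y; apply: ceqP => /=; ring.
Qed.
End CauchyFormula.

(** * Estimates from the integral formulas, Harnack and Hopf *)

Section KernelEstimates.
Context {R : realType}.
Implicit Types (f g q phi : R[i] -> R[i]) (c z w a b : R[i]) (r s t e M : R).

(** Differentiating an integral with respect to a parameter reduces to a
    quadratic bound on the remainder. *)
Lemma cderiv_quadratic f a d C e : 0 < e -> 0 <= C ->
  (forall b, cabs (b - a) < e -> cabs (f b - f a - d * (b - a)) <= C * cabs (b - a) ^+ 2) ->
  cderiv f a d.
Proof.
move=> e0 C0 H e1 e10; have C1 : 0 < 1 + C by rewrite ltr_pwDl.
exists (Num.min e (e1 / (1 + C))); first by rewrite lt_min e0 divr_gt0.
move=> w; rewrite lt_min ltr_pdivlMr// => /andP[/H {}H we].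
apply: (le_trans H); rewrite expr2 mulrA ler_wpM2r//.
by apply: le_trans (ltW we); rewrite mulrC ler_wpM2l// lerDr.
Qed.

Lemma cabs_nat n : cabs (n%:R : R[i]) = n%:R.
Proof. by rewrite -(rmorph_nat (real_complex R)) cabs_real normr_nat. Qed.

Lemma cube_bound z w (D : R) : cabs z <= D -> cabs w <= D ->
  cabs (z ^+ 2 * w) <= D ^+ 3.
Proof.
move=> zD wD; have D0 : 0 <= D by exact: le_trans zD.
by rewrite [leRHS]exprSr cabsM cabsX ler_pM ?exprn_ge0// lerXn2r ?nnegrE.
Qed.

Section FixedCircle.
Variables (phi : R[i] -> R[i]) (c : R[i]) (r M dl : R).
Hypotheses (r0 : 0 < r) (dl0 : 0 < dl) (cphi : circ_cont c r phi)
  (phiM : forall z, on_circle c r z -> cabs (phi z) <= M).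

(** Cauchy integrals: when [phi] is analytic on the disc, [kmean 1], [kmean 2]
    and [2 * kmean 3] are [phi], its derivative and its second derivative inside
    the circle.  The margin [dl] bounds from below the distance of the
    parameters to the circle. *)
Definition kmean n a := cmean c r (fun z => phi z * (z - c) * (z - a)^-1 ^+ n).

Lemma dist_circle a z : cabs (a - c) <= r - dl -> cabs (z - c) = r ->
  cabs (z - a)^-1 <= dl^-1.
Proof.
move=> ar zr; have H : dl <= cabs (z - a).
  have := cabs_tri a z c; rewrite zr => H; lra.
by rewrite cabsV lef_pV2// posrE// (lt_le_trans dl0).
Qed.

Lemma neq_circle a z : cabs (a - c) <= r - dl -> cabs (z - c) = r -> z - a != 0.
Proof.
move=> ar zr; apply: (notin_circle _ zr); apply: le_lt_trans ar _.
by rewrite ltrBlDr ltrDl.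
Qed.

Lemma circ_cont_inv a : cabs (a - c) <= r - dl -> circ_cont c r (fun z => (z - a)^-1).
Proof.
move=> ar; apply: circ_contP; first exact: ltW.
move=> z zr; apply: ccontV; [exact: neq_circle zr|exact: ccontX1].
Qed.

Lemma circ_contX q n : circ_cont c r q -> circ_cont c r (fun z => q z ^+ n).
Proof.
move=> cq; elim: n => [|n IH]; first exact: pcont_cst.
apply: (eq_circ_cont (q := fun z => q z * q z ^+ n)); [exact: ltW| |exact: circ_contM].
by move=> z _; rewrite exprS.
Qed.

Lemma circ_cont_phi : circ_cont c r (fun z => phi z * (z - c)).
Proof.
apply: circ_contM => //; apply: circ_contP; [exact: ltW|move=> z _; exact: ccontX1].
Qed.

Lemma circ_cont_k n a : cabs (a - c) <= r - dl ->
  circ_cont c r (fun z => phi z * (z - c) * (z - a)^-1 ^+ n).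
Proof.
move=> ar; apply: circ_contM; first exact: circ_cont_phi.
by apply: circ_contX; exact: circ_cont_inv.
Qed.

Lemma kmean_bound (k : R[i] -> R[i]) (B : R) : circ_cont c r k ->
  (forall z, cabs (z - c) = r -> cabs (k z) <= B) ->
  cabs (cmean c r (fun z => phi z * (z - c) * k z)) <= 2 * (M * r * B).
Proof.
move=> ck H; apply: cmean_norm; first exact: ltW.
  by apply: circ_contM => //; exact: circ_cont_phi.
move=> z zc; have zr := cabs_on_circle (ltW r0) zc; rewrite !cabsM zr ler_pM ?mulr_ge0 ?(ltW r0)//.
  by rewrite ler_wpM2r ?(ltW r0)// phiM.
exact: H.
Qed.

Lemma kmean_norm n a : cabs (a - c) <= r - dl ->
  cabs (kmean n a) <= 2 * (M * r * dl^-1 ^+ n).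
Proof.
move=> ar; apply: kmean_bound.
  by apply: circ_contX; exact: circ_cont_inv.
by move=> z zr; rewrite cabsX lerXn2r ?nnegrE ?invr_ge0 ?(ltW dl0)// dist_circle.
Qed.

Lemma kmean_taylor1 a b : cabs (a - c) <= r - dl -> cabs (b - c) <= r - dl ->
  cabs (kmean 1 b - kmean 1 a - kmean 2 a * (b - a)) <=
    2 * (M * r * dl^-1 ^+ 3) * cabs (b - a) ^+ 2.
Proof.
move=> ar br.
have -> : kmean 1 b - kmean 1 a - kmean 2 a * (b - a) = (b - a) ^+ 2 *
    cmean c r (fun z => phi z * (z - c) * ((z - a)^-1 ^+ 2 * (z - b)^-1)).
  rewrite [kmean 2 a * _]mulrC /kmean -!cmeanZ; [|exact: circ_cont_k|]; last first.
    apply: circ_contM; [exact: circ_cont_phi|apply: circ_contM; [|exact: circ_cont_inv]].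
    by apply: circ_contX; exact: circ_cont_inv.
  rewrite -(cmeanB (circ_cont_k _ br) (circ_cont_k _ ar)).
  rewrite -(cmeanB (circ_contB (circ_cont_k _ br) (circ_cont_k _ ar)) (circ_contZ _ (circ_cont_k _ ar))).
  apply: eq_cmean => [|z zr]; first exact: ltW.
  have za := neq_circle ar zr; have zb := neq_circle br zr.
  by field; rewrite za zb.
rewrite cabsM cabsX mulrC ler_wpM2r ?exprn_ge0//; apply: kmean_bound.
  by apply: circ_contM; [apply: circ_contX|]; exact: circ_cont_inv.
by move=> z zr; apply: cube_bound; exact: dist_circle.
Qed.

Lemma kmean_lip2 a b : cabs (a - c) <= r - dl -> cabs (b - c) <= r - dl ->
  cabs (kmean 2 b - kmean 2 a) <= 2 * (M * r * (2 * dl^-1 ^+ 3)) * cabs (b - a).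
Proof.
move=> ar br.
have -> : kmean 2 b - kmean 2 a = (b - a) *
    cmean c r (fun z => phi z * (z - c) * ((z - a)^-1 ^+ 2 * (z - b)^-1 + (z - b)^-1 ^+ 2 * (z - a)^-1)).
  rewrite /kmean -cmeanB; [|exact: circ_cont_k..].
  rewrite -cmeanZ; last first.
    apply: circ_contM; [exact: circ_cont_phi|].
    by apply: circ_contD; (apply: circ_contM; [apply: circ_contX|]); exact: circ_cont_inv.
  apply: eq_cmean => [|z zr]; first exact: ltW.
  have za := neq_circle ar zr; have zb := neq_circle br zr.
  by field; rewrite za zb.
rewrite cabsM mulrC ler_wpM2r//; apply: kmean_bound.
  by apply: circ_contD; (apply: circ_contM; [apply: circ_contX|]); exact: circ_cont_inv.
move=> z zr; rewrite mulr_natl mulr2n (le_trans (cabsD _ _))// lerD//.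
  by apply: cube_bound; exact: dist_circle.
by apply: cube_bound; exact: dist_circle.
Qed.

Lemma kmean_taylor2 a b : cabs (a - c) <= r - dl -> cabs (b - c) <= r - dl ->
  cabs (kmean 2 b - kmean 2 a - (2 * kmean 3 a) * (b - a)) <=
    2 * (M * r * (3 * dl^-1 ^+ 4)) * cabs (b - a) ^+ 2.
Proof.
move=> ar br; have ca n := circ_contX n (circ_cont_inv ar).
have cb n := circ_contX n (circ_cont_inv br).
have cK : circ_cont c r (fun z => (z - a)^-1 ^+ 2 * (z - b)^-1 ^+ 2 + 2 * ((z - a)^-1 ^+ 3 * (z - b)^-1 ^+ 1)).
  by apply: circ_contD; [|apply: circ_contZ]; apply: circ_contM.
have -> : kmean 2 b - kmean 2 a - (2 * kmean 3 a) * (b - a) = (b - a) ^+ 2 *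
    cmean c r (fun z => phi z * (z - c) * ((z - a)^-1 ^+ 2 * (z - b)^-1 ^+ 2 + 2 * ((z - a)^-1 ^+ 3 * (z - b)^-1 ^+ 1))).
  rewrite [_ * (b - a)]mulrC mulrA /kmean -!cmeanZ; [|exact: circ_cont_k|]; last first.
    by apply: circ_contM => //; exact: circ_cont_phi.
  rewrite -(cmeanB (circ_cont_k _ br) (circ_cont_k _ ar)).
  rewrite -(cmeanB (circ_contB (circ_cont_k _ br) (circ_cont_k _ ar)) (circ_contZ _ (circ_cont_k _ ar))).
  apply: eq_cmean => [|z zr]; first exact: ltW.
  have za := neq_circle ar zr; have zb := neq_circle br zr.
  by field; rewrite za zb.
rewrite cabsM cabsX mulrC ler_wpM2r ?exprn_ge0//; apply: kmean_bound => //.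
move=> z zr.
have D0 : 0 <= dl^-1 by rewrite invr_ge0 ltW.
have pa n : cabs ((z - a)^-1 ^+ n) <= dl^-1 ^+ n by rewrite cabsX lerXn2r ?nnegrE// dist_circle.
have pb n : cabs ((z - b)^-1 ^+ n) <= dl^-1 ^+ n by rewrite cabsX lerXn2r ?nnegrE// dist_circle.
have -> : 3 * dl^-1 ^+ 4 = dl^-1 ^+ 2 * dl^-1 ^+ 2 + 2 * (dl^-1 ^+ 3 * dl^-1 ^+ 1) by ring.
apply: (le_trans (cabsD _ _)); apply: lerD; rewrite cabsM; apply: ler_pM => //.
  by rewrite cabs_nat.
by rewrite cabsM; apply: ler_pM.
Qed.
End FixedCircle.

Lemma hol_circ_cont f f' c r : 0 <= r -> hol f f' c r -> circ_cont c r f.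
Proof.
by move=> r0 Hf; apply: circ_contP => // z zr; apply: (hol_cont Hf); rewrite zr.
Qed.

Lemma kmean1E phi c r a : 0 <= r ->
  kmean phi c r 1 a = cmean c r (fun z => phi z * ((z - c) / (z - a))).
Proof. by move=> r0; apply: eq_cmean => // z _; rewrite expr1 mulrA. Qed.

Lemma in_disk_margin c r a b : cabs (a - c) < r -> cabs (b - a) < (r - cabs (a - c)) / 2 ->
  cabs (b - c) <= r - (r - cabs (a - c)) / 2.
Proof. by move=> ar ba; have := cabs_tri a b c => H; lra. Qed.

Lemma kmean_deriv1 phi c r a : 0 < r -> circ_cont c r phi -> cabs (a - c) < r ->
  cderiv (kmean phi c r 1) a (kmean phi c r 2 a).
Proof.
move=> r0 cphi ar; have [M HM] := circ_bounded cphi.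
pose dl := (r - cabs (a - c)) / 2.
have dl0 : 0 < dl by rewrite divr_gt0// subr_gt0.
apply: (cderiv_quadratic dl0 (C := `|2 * (M * r * dl^-1 ^+ 3)|)) => // b ba.
apply: le_trans (kmean_taylor1 r0 dl0 cphi HM _ _) _.
- by rewrite /dl; lra.
- exact: in_disk_margin.
- by rewrite ler_wpM2r ?exprn_ge0// ler_norm.
Qed.

Lemma kmean_deriv2 phi c r a : 0 < r -> circ_cont c r phi -> cabs (a - c) < r ->
  cderiv (kmean phi c r 2) a (2 * kmean phi c r 3 a).
Proof.
move=> r0 cphi ar; have [M HM] := circ_bounded cphi.
pose dl := (r - cabs (a - c)) / 2.
have dl0 : 0 < dl by rewrite divr_gt0// subr_gt0.
apply: (cderiv_quadratic dl0 (C := `|2 * (M * r * (3 * dl^-1 ^+ 4))|)) => // b ba.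
apply: le_trans (kmean_taylor2 r0 dl0 cphi HM _ _) _.
- by rewrite /dl; lra.
- exact: in_disk_margin.
- by rewrite ler_wpM2r ?exprn_ge0// ler_norm.
Qed.

Lemma deriv_kmean f f' c r a : 0 < r -> hol f f' c r -> cabs (a - c) < r ->
  f' a = kmean f c r 2 a.
Proof.
move=> r0 Hf ar; apply: (cderiv_uniq (Hf a (ltW ar))).
have cf := hol_circ_cont (ltW r0) Hf.
have e0 : 0 < r - cabs (a - c) by rewrite subr_gt0.
apply: (eq_cderiv e0 _ (kmean_deriv1 r0 cf ar)) => b ba.
rewrite kmean1E ?(ltW r0)// (cauchy_formula r0 _ Hf)//.
by have := cabs_tri a b c => H; lra.
Qed.

(** The derivative is the Cauchy integral [kmean 2], which can be differentiated
    in its parameter. *)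
Theorem hol_deriv f f' c r : 0 < r -> hol f f' c r ->
  exists f'', forall a, cabs (a - c) < r -> cderiv f' a (f'' a).
Proof.
move=> r0 Hf; exists (fun a => 2 * kmean f c r 3 a) => a ar.
have cf := hol_circ_cont (ltW r0) Hf.
have e0 : 0 < r - cabs (a - c) by rewrite subr_gt0.
apply: (eq_cderiv e0 _ (kmean_deriv2 r0 cf ar)) => b ba.
rewrite (deriv_kmean r0 Hf)//.
by have := cabs_tri a b c => H; lra.
Qed.

Lemma re_circ_cont g g' c r t : 0 < r -> hol g g' c r ->
  circ_cont c r (fun z => (2 * (complex.Re (g z) - t))%:C).
Proof.
move=> r0 Hg; have [c1 _] := hol_circ_cont (ltW r0) Hg; split; last exact: rcont_cst.
exact: (rcontM (@rcont_cst R 0 (2 * pi) 2) (rcontD c1 (rcontN (@rcont_cst R 0 (2 * pi) t)))).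
Qed.

(** Schwarz's formula differentiated in [a]; subtracting the constant [t] from
    [g] does not change [g']. *)
Lemma deriv_re_kmean g g' c r t a : 0 < r -> hol g g' c r -> cabs (a - c) < r ->
  g' a = kmean (fun z => (2 * (complex.Re (g z) - t))%:C) c r 2 a.
Proof.
move=> r0 Hg ar; have r0' := ltW r0.
pose h z := g z - t%:C.
have Hh : hol h g' c r.
  move=> z zr; have := cderivB (Hg z zr) (cderiv_cst t%:C z); by rewrite subr0.
pose phi z := (2 * (complex.Re (g z) - t))%:C : R[i].
have cphi : circ_cont c r phi by exact: (re_circ_cont t r0 Hg).
apply: (cderiv_uniq (Hg a (ltW ar))).
have e0 : 0 < r - cabs (a - c) by rewrite subr_gt0.
have := cderivB (kmean_deriv1 r0 cphi ar) (cderiv_cst ((h c)^* - t%:C) a).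
rewrite subr0; apply: (eq_cderiv e0) => b ba.
have br : cabs (b - c) < r by have := cabs_tri a b c => H; lra.
rewrite kmean1E//.
transitivity (cmean c r (fun z => (2 * complex.Re (h z))%:C * ((z - c) / (z - b))) - ((h c)^* - t%:C)).
  by congr (_ - _); apply: eq_cmean => // z _; rewrite cReD cReN.
rewrite (schwarz_formula r0 br Hh) /h; ring.
Qed.

Section ReBound.
Variables (g g' : R[i] -> R[i]) (c : R[i]) (r t M : R).
Hypotheses (r0 : 0 < r) (Hg : hol g g' c r)
  (gM : forall z, cabs (z - c) = r -> `|complex.Re (g z) - t| <= M).

Let phiM z : on_circle c r z -> cabs ((2 * (complex.Re (g z) - t))%:C) <= 2 * M.
Proof.
move=> /(cabs_on_circle (ltW r0)) zr.
by rewrite cabs_real normrM ger0_norm// ler_wpM2l// gM.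
Qed.

Let r20 : 0 < r / 2. Proof. by rewrite divr_gt0. Qed.

(** The constant is [2 * (2 * M * r * (2 / r) ^+ 2)]: the density is bounded by
    [2 * M], and points with [cabs (a - c) <= r / 2] keep the distance [r / 2]
    from the circle. *)
Lemma re_deriv_bound a : cabs (a - c) <= r / 2 -> cabs (g' a) <= 16 * M / r.
Proof.
move=> ar; have ar' : cabs (a - c) < r by have := r0; lra.
rewrite (deriv_re_kmean t r0 Hg ar').
apply: le_trans (kmean_norm r0 r20 (re_circ_cont t r0 Hg) phiM _ _) _; first lra.
by rewrite le_eqVlt; apply/orP; left; apply/eqP; field; rewrite gt_eqF.
Qed.

Lemma re_deriv_lip a b : cabs (a - c) <= r / 2 -> cabs (b - c) <= r / 2 ->
  cabs (g' b - g' a) <= 64 * M / r ^+ 2 * cabs (b - a).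
Proof.
move=> ar br; have ar' : cabs (a - c) < r by have := r0; lra.
have br' : cabs (b - c) < r by have := r0; lra.
rewrite (deriv_re_kmean t r0 Hg ar') (deriv_re_kmean t r0 Hg br').
apply: le_trans (kmean_lip2 r0 r20 (re_circ_cont t r0 Hg) phiM _ _) _; [have := r0; lra|have := r0; lra|].
rewrite ler_wpM2r// le_eqVlt; apply/orP; left; apply/eqP; field; rewrite gt_eqF//.
Qed.
End ReBound.

Lemma re_kernel z a : z - a != 0 -> forall c,
  2 * complex.Re ((z - c) / (z - a)) - 1 =
  (cabs (z - c) ^+ 2 - cabs (a - c) ^+ 2) / cabs (z - a) ^+ 2.
Proof.
move=> za c; set w := (z - c) / (z - a).
have E1 : cabs w ^+ 2 = cabs (z - c) ^+ 2 / cabs (z - a) ^+ 2.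
  by rewrite /w cabsM cabsV exprMn exprVn.
have E2 : cabs (w - 1) ^+ 2 = cabs (a - c) ^+ 2 / cabs (z - a) ^+ 2.
  rewrite -expr_div_n -cabsV -cabsM; congr (cabs _ ^+ _).
  by rewrite /w; field.
rewrite mulrBl -E1 -E2 !cabs_sq cReD cImD cReN cImN/=; ring.
Qed.

(** Twice the real part of the Cauchy kernel minus 1 is the Poisson kernel
    ([re_kernel]); on the circle it is at least
    [(r - |a - c|) / (r + |a - c|)], and Schwarz's formula integrates [Re g]
    against it. *)
Lemma harnack g g' c r a : 0 < r -> hol g g' c r ->
  (forall z, cabs (z - c) = r -> 0 <= complex.Re (g z)) -> cabs (a - c) < r ->
  complex.Re (g c) * ((r - cabs (a - c)) / (r + cabs (a - c))) <= complex.Re (g a).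
Proof.
move=> r0 Hg g0 ar; have r0' := ltW r0; have pi0 := @twopi_gt0 R.
set d := cabs (a - c) in ar *; have d0 : 0 <= d by rewrite /d.
have rd : 0 < r + d by rewrite ltr_pwDl.
set k := (r - d) / (r + d).
have [cg _] := hol_circ_cont r0' Hg.
have [ck _] := circ_cont_kernel r0 ar.
have := congr1 (@complex.Re R) (mean_hol r0 Hg).
have := congr1 (@complex.Re R) (schwarz_formula r0 ar Hg).
rewrite /cmean !cReM/= !mul0r !subr0 cReD conjcRe => HS HM.
have : (2 * pi)^-1 * rint 0 (2 * pi) (fun s => (1 + k) * complex.Re (g (cpath c r s))) <=
    complex.Re (g a) + complex.Re (g c).
  rewrite -HS; apply: ler_wpM2l; first by rewrite invr_ge0 ltW.
  have -> : rint 0 (2 * pi) (fun s => complex.Re ((2 * complex.Re (g (cpath c r s)))%:C * ((cpath c r s - c) / (cpath c r s - a)))) =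
     rint 0 (2 * pi) (fun s => 2 * complex.Re (g (cpath c r s)) * complex.Re ((cpath c r s - c) / (cpath c r s - a))).
    by apply: eq_rint => s _; rewrite cReM/= mul0r subr0.
  apply: rint_le.
  - by apply: rcontM => //; exact: rcont_cst.
  - by apply: rcontM => //; apply: rcontM => //; exact: rcont_cst.
  - move=> s _; set z := cpath c r s.
    have zr : cabs (z - c) = r by rewrite cabs_cpath.
    have za := notin_circle ar zr.
    have Hk : 1 + k <= 2 * complex.Re ((z - c) / (z - a)).
      rewrite addrC -lerBrDr re_kernel// zr -/d /k.
      have q0 : 0 < cabs (z - a) by rewrite cabs_gt0.
      have qd : cabs (z - a) <= r + d.
        by have := cabs_tri c z a; rewrite zr (cabsC c a).
      rewrite ler_pdivlMr ?exprn_gt0// mulrAC ler_pdivrMr//.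
      have : cabs (z - a) ^+ 2 <= (r + d) ^+ 2 by rewrite lerXn2r ?nnegrE// ltW.
      have rd' : 0 <= r - d by rewrite subr_ge0 ltW.
      by move=> /(ler_wpM2l rd') H; apply: (le_trans H); rewrite le_eqVlt; apply/orP; left; apply/eqP; ring.
    by rewrite mulrAC; apply: ler_wpM2r => //; exact: g0.
rewrite rintZ// mulrCA HM; lra.
Qed.

(** Hopf's boundary lemma: where [Re g] attains its minimum [t] over the disc,
    on the circle, the gradient there is at least of the order of
    [(Re (g c) - t) / r].  Harnack's inequality bounds [Re g - t] from below by
    a linear function of the distance to the circle, along the radius of [z0]. *)
Lemma hopf g g' c r t z0 : 0 < r -> hol g g' c r -> cabs (z0 - c) = r ->
  (forall z, cabs (z - c) <= r -> t <= complex.Re (g z)) -> complex.Re (g z0) = t ->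
  complex.Re (g c) - t <= 2 * r * cabs (g' z0).
Proof.
move=> r0 Hg z0r gt gz0.
pose h z := g z - t%:C.
have Hh : hol h g' c r.
  move=> z zr; have := cderivB (Hg z zr) (cderiv_cst t%:C z); by rewrite subr0.
have hE z : complex.Re (h z) = complex.Re (g z) - t by rewrite cReD cReN.
apply/ler_addgt0Pl => e e0.
have e1 : 0 < e / (2 * r) by rewrite divr_gt0// mulr_gt0.
have zr' : cabs (z0 - c) <= r by rewrite z0r.
have [dl dl0 H] := Hh z0 zr' _ e1.
pose m := Num.min 1 (dl / r); have m0 : 0 < m by rewrite lt_min ltr01 divr_gt0.
pose s := m / 2.
have : m <= Num.min 1 (dl / r) by [].
rewrite le_min ler_pdivlMr// => /andP[m1 mr].
have sm : m = 2 * s by rewrite /s; field.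
rewrite sm in m0 m1 mr; clearbody s m; clear sm.
have s0 : 0 < s by lra.
pose a := c + (1 - s)%:C * (z0 - c).
have aE : cabs (a - c) = (1 - s) * r.
  rewrite /a addrAC subrr add0r cabsM z0r cabs_real ger0_norm//; lra.
have azE : cabs (a - z0) = s * r.
  have -> : a - z0 = - (s%:C * (z0 - c)) by rewrite /a rmorphB/=; ring.
  by rewrite cabsN cabsM z0r cabs_real gtr0_norm.
have sr0 : 0 < s * r by rewrite mulr_gt0.
have ar : cabs (a - c) < r by rewrite aE mulrBl mul1r; lra.
have := @harnack h g' c r a r0 Hh _ ar.
have h0 z : cabs (z - c) = r -> 0 <= complex.Re (h z).
  by move=> zr; rewrite hE subr_ge0 gt// zr.
move=> /(_ h0); rewrite hE aE.
have -> : (r - (1 - s) * r) / (r + (1 - s) * r) = s / (2 - s).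
  by field; rewrite !gt_eqF//; nra.
move=> Hk.
have Ha : cabs (h a - h z0 - g' z0 * (a - z0)) <= e / (2 * r) * (s * r).
  rewrite -azE; apply: H; rewrite azE; lra.
have hz0 : complex.Re (h z0) = 0 by rewrite hE gz0 subrr.
have Hre : complex.Re (h a) <= (e / (2 * r) + cabs (g' z0)) * (s * r).
  apply: le_trans (ler_norm _) _; rewrite -[complex.Re (h a)]subr0 -hz0 -cReN -cReD.
  apply: le_trans (Re_le _) _.
  rewrite -(subrK (g' z0 * (a - z0)) (h a - h z0)) (le_trans (cabsD _ _))//.
  by rewrite cabsM azE mulrDl lerD2r.
have gc : t <= complex.Re (g c) by apply: gt; rewrite subrr cabs0 ltW.
have Hq : (complex.Re (g c) - t) * (s / 2) <= (e / (2 * r) + cabs (g' z0)) * (s * r).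
  apply: le_trans Hre; apply: le_trans Hk; rewrite ler_wpM2l ?subr_ge0//.
  rewrite ler_wpM2l ?(ltW s0)// lef_pV2 ?posrE; lra.
have -> : e + 2 * r * cabs (g' z0) = (e / (2 * r) + cabs (g' z0)) * (s * r) / (s / 2).
  by field; rewrite !gt_eqF.
by rewrite ler_pdivlMr// divr_gt0.
Qed.

End KernelEstimates.

(** * Logarithms, level lines and quantitative open mapping *)

Section AnalyticTools.
Context {R : realType}.
Implicit Types (f g F k : R[i] -> R[i]) (c z w a b p : R[i]) (r s t e N : R).

(** A lower semicontinuous function attains its minimum on a nonempty compact
    set.  By bisection: [P n x y] says that the values of [phi] on the cell at
    [(x, y)] go as low as anywhere on [A], and one of the quarters inherits
    it. *)
Lemma compact_min (A : R[i] -> Prop) (phi : R[i] -> R) (B : R) : (exists z, A z) ->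
  (forall z, A z -> cabs z <= B) ->
  (forall z, (forall e, 0 < e -> exists2 w, A w & cabs (w - z) < e) -> A z) ->
  (forall z, A z -> forall e, 0 < e -> exists2 dl : R, 0 < dl &
     forall w, A w -> cabs (w - z) < dl -> phi z <= phi w + e) ->
  exists2 z, A z & forall w, A w -> phi z <= phi w.
Proof.
move=> [z0 Az0] bA clA cA.
have B0 : 0 <= B by apply: le_trans (bA _ Az0).
pose incell n x y v := x <= complex.Re v <= x + (2 * B) / 2 ^+ n /\
  y <= complex.Im v <= y + (2 * B) / 2 ^+ n.
pose P n x y := forall w, A w -> exists v, [/\ A v, incell n x y v & phi v <= phi w].
have B20 : 0 <= 2 * B by rewrite mulr_ge0.
have hf (v : R) n : v / 2 ^+ n = v / 2 ^+ n.+1 + v / 2 ^+ n.+1.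
  by rewrite exprS; field; rewrite expf_neq0.
have step n x y : P n x y -> exists x' y', [/\ P n.+1 x' y',
     x <= x' <= x + 2 * B / 2 ^+ n.+1 & y <= y' <= y + 2 * B / 2 ^+ n.+1].
  move=> Pn; set d := 2 * B / 2 ^+ n.+1.
  have d0 : 0 <= d by rewrite divr_ge0// exprn_ge0.
  apply: contrapT => nP.
  have bad x' y' : x' = x \/ x' = x + d -> y' = y \/ y' = y + d ->
      exists2 w, A w & forall v, A v -> incell n.+1 x' y' v -> phi w < phi v.
    move=> Hx Hy; apply: contrapT => H; apply: nP; exists x', y'; split.
    - move=> w Aw; apply: contrapT => H2; apply: H; exists w => // v Av iv.
      by rewrite ltNge; apply/negP => vw; apply: H2; exists v.
    - by case: Hx => ->; lra.
    - by case: Hy => ->; lra.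
  have [w1 A1 H1] := bad x y (or_introl erefl) (or_introl erefl).
  have [w2 A2 H2] := bad x (y + d) (or_introl erefl) (or_intror erefl).
  have [w3 A3 H3] := bad (x + d) y (or_intror erefl) (or_introl erefl).
  have [w4 A4 H4] := bad (x + d) (y + d) (or_intror erefl) (or_intror erefl).
  have [w [Aw W1 W2 W3 W4]] : exists w, [/\ A w, phi w <= phi w1, phi w <= phi w2, phi w <= phi w3 & phi w <= phi w4].
    have mn u v : A u -> A v -> exists w, [/\ A w, phi w <= phi u & phi w <= phi v].
      move=> Au Av; have [uv|/ltW vu] := leP (phi u) (phi v); first by exists u; split.
      by exists v; split.
    have [u [Au u1 u2]] := mn _ _ A1 A2; have [v [Av v1 v2]] := mn _ _ A3 A4.
    have [w [Aw wu wv]] := mn _ _ Au Av; exists w; split => //.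
    + exact: le_trans u1. + exact: le_trans u2. + exact: le_trans v1. + exact: le_trans v2.
  have [v [Av [vx vy] vw]] := Pn w Aw.
  rewrite (hf (2 * B) n) -/d in vx vy.
  have ic (x' y' : R) : x' <= complex.Re v <= x' + d -> y' <= complex.Im v <= y' + d -> incell n.+1 x' y' v by [].
  clear bad nP Pn; have [vx1|vx1] := leP (complex.Re v) (x + d); have [vy1|vy1] := leP (complex.Im v) (y + d).
  - have := H1 v Av (ic _ _ _ _) => G; have {}G : phi w1 < phi v by apply: G; lra.
    by have := lt_le_trans G (le_trans vw W1); rewrite ltxx.
  - have := H2 v Av (ic _ _ _ _) => G; have {}G : phi w2 < phi v by apply: G; lra.
    by have := lt_le_trans G (le_trans vw W2); rewrite ltxx.
  - have := H3 v Av (ic _ _ _ _) => G; have {}G : phi w3 < phi v by apply: G; lra.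
    by have := lt_le_trans G (le_trans vw W3); rewrite ltxx.
  - have := H4 v Av (ic _ _ _ _) => G; have {}G : phi w4 < phi v by apply: G; lra.
    by have := lt_le_trans G (le_trans vw W4); rewrite ltxx.
have P0 : P 0%N (- B) (- B).
  move=> w Aw; exists w; split => //; rewrite /incell expr0 divr1.
  have := bA _ Aw => wB; have := le_trans (Re_le w) wB; have := le_trans (Im_le w) wB.
  rewrite !ler_norml => ? ?; split; lra.
have [xs [ys H]] := nested_cells B20 B20 step P0.
pose z := xs +i* ys.
have near n w x y : incell n x y w -> x <= xs <= x + 2 * B / 2 ^+ n ->
    y <= ys <= y + 2 * B / 2 ^+ n -> cabs (w - z) <= (4 * B) / 2 ^+ n.
  move=> [wx wy] zx zy; rewrite (le_trans (cabs_le _))// cReD cImD cReN cImN/=.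
  have -> : 4 * B / 2 ^+ n = 2 * B / 2 ^+ n + 2 * B / 2 ^+ n by field; rewrite expf_neq0.
  by rewrite lerD// ler_norml; clear -wx wy zx zy; lra.
have Az : A z.
  apply: clA => e e0; have [n Hn] := half_pow_small (4 * B) e0.
  have [x [y [Pn zx zy]]] := H n; have [v [Av iv _]] := Pn z0 Az0.
  by exists v => //; apply: le_lt_trans Hn; exact: near iv zx zy.
exists z => // w Aw; apply/ler_addgt0Pr => e e0.
have [dl dl0 Hc] := cA z Az e e0.
have [n Hn] := half_pow_small (4 * B) dl0.
have [x [y [Pn zx zy]]] := H n; have [v [Av iv vw]] := Pn w Aw.
apply: (le_trans (Hc v Av _)); last by rewrite lerD2r.
by apply: le_lt_trans Hn; exact: near iv zx zy.
Qed.

Lemma hol_const f c r : hol f (fun=> 0) c r -> forall z, cabs (z - c) <= r -> f z = f c.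
Proof.
move=> Hf z zr; apply/eqP; rewrite -subr_eq0; apply/eqP.
have := @cint_path R 0 1 (fun=> 0) f c (z - c) ler01.
rewrite mul0r addr0 mul1r subrKC cint_cst// mulr0 mul0r => <-//.
  by move=> t _; exact: ccont_cst.
move=> t /andP[t0 t1]; apply: Hf; rewrite addrAC subrr add0r cabsM cabs_real ger0_norm//.
by apply: le_trans zr; rewrite ler_piMl.
Qed.

Lemma segment_ball c z r t : cabs (z - c) <= r -> 0 <= t <= 1 -> cabs (c + t%:C * (z - c) - c) <= r.
Proof.
move=> zr /andP[t0 t1]; rewrite addrAC subrr add0r cabsM cabs_real ger0_norm//.
by apply: le_trans zr; rewrite ler_piMl.
Qed.

(** Cauchy's formula makes the remainder explicit, hence uniform on a smaller
    disc. *)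
Lemma hol_taylor k k' c r r1 : 0 < r1 -> r1 < r -> hol k k' c r -> exists2 C, 0 <= C &
  forall a b, cabs (a - c) <= r1 -> cabs (b - c) <= r1 ->
    cabs (k b - k a - k' a * (b - a)) <= C * cabs (b - a) ^+ 2 /\ cabs (k' a) <= C.
Proof.
move=> r10 r1r Hk; have r0 := lt_trans r10 r1r.
have ck := hol_circ_cont (ltW r0) Hk.
have [M HM] := circ_bounded ck.
have dl0 : 0 < r - r1 by rewrite subr_gt0.
set dl := r - r1 in dl0.
exists (`|2 * (M * r * dl^-1 ^+ 3)| + `|2 * (M * r * dl^-1 ^+ 2)|); first by rewrite addr_ge0.
move=> a b ar br.
have ard : cabs (a - c) <= r - dl by rewrite /dl subKr.
have brd : cabs (b - c) <= r - dl by rewrite /dl subKr.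
have E1 z : cabs (z - c) <= r1 -> k z = kmean k c r 1 z.
  by move=> zr; rewrite kmean1E ?(ltW r0)// (cauchy_formula r0 _ Hk)// (le_lt_trans zr).
rewrite !E1// (deriv_kmean r0 Hk); last exact: le_lt_trans ar r1r.
split.
  apply: le_trans (kmean_taylor1 r0 dl0 ck HM ard brd) _.
  by rewrite ler_wpM2r ?exprn_ge0// (le_trans (ler_norm _))// lerDl.
apply: le_trans (kmean_norm r0 dl0 ck HM 2 ard) _.
by rewrite (le_trans (ler_norm _))// lerDr.
Qed.

(** The primitive of [k] vanishing at 0, as an integral along the ray from 0. *)
Definition ray_primitive k z : R[i] := cint 0 1 (fun t => z * k (t%:C * z)).

(** Differentiate under the integral sign: the derivative of [z * k (t * z)] in
    [z] is [D t], which is also the derivative of [t * k (t * z)] in [t], so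
    that its integral over [[0, 1]] is [k z]. *)
Lemma ray_primitive_deriv k k' r z : cabs z < r -> hol k k' 0 r -> cderiv (ray_primitive k) z (k z).
Proof.
move=> zr Hk.
have r0 : 0 < r by exact: le_lt_trans (cabs_ge0 z) zr.
pose r1 := (cabs z + r) / 2.
have zr1 : cabs z < r1 by rewrite /r1; lra.
have r1r : r1 < r by rewrite /r1; lra.
have r10 : 0 < r1 by exact: le_lt_trans (cabs_ge0 z) zr1.
have [C C0 HC] := hol_taylor r10 r1r Hk.
have [k'' Hk''] := hol_deriv r0 Hk.
have e0 : 0 < r1 - cabs z by rewrite subr_gt0.
have inb w t : cabs w <= r1 -> 0 <= t <= 1 -> cabs (t%:C * w - 0) <= r1.
  by move=> wr /andP[t0 t1]; rewrite subr0 cabsM cabs_real ger0_norm// (le_trans _ wr)// ler_piMl.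
have pth w (q : R[i] -> R[i]) : (forall v, cabs (v - 0) <= r1 -> ccont q v) -> cabs w <= r1 ->
    pcont 0 1 (fun t => q (t%:C * w)).
  move=> cq wr; apply: pcont_comp; last by move=> t tab; apply: cq; exact: inb.
  have := pcont_affine 0 1 0 w; rewrite (_ : (fun t => _) = (fun t => t%:C * w))//.
  by apply/funext => t; rewrite add0r.
have ck v : cabs (v - 0) <= r1 -> ccont k v.
  by move=> vr; apply: (hol_cont Hk); rewrite (le_trans vr)// ltW.
have ck' v : cabs (v - 0) <= r1 -> ccont k' v.
  by move=> vr; apply: cderiv_cont (Hk'' v _); rewrite (le_lt_trans vr).
have zr1' := ltW zr1.
have pid : pcont 0 1 (fun t : R => t%:C * z).
  by have := @pth z id; apply=> // v _; exact: cderiv_cont (cderiv_id v).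
pose D t := k (t%:C * z) + t%:C * z * k' (t%:C * z).
have cD : pcont 0 1 D.
  by apply: pcontD; [exact: pth|apply: pcontM => //; exact: pth].
have ID : cint 0 1 D = k z.
  have -> : k z = 1%:C * k (1%:C * z) - 0%:C * k (0%:C * z) by rewrite !mul1r mul0r subr0.
  apply: (@cint_FTC R 0 1 D (fun t => t%:C * k (t%:C * z))) => //.
  move=> t tab e e00; pose tz := t%:C * z.
  have tzr : cabs (tz - 0) <= r1 by exact: inb.
  have [z0|z0] := eqVneq z 0.
    exists 1 => // y _; rewrite /D z0 !mulr0 mul0r addr0.
    rewrite (_ : _ - _ = 0) ?cabs0 ?mulr_ge0 ?(ltW e00)//.
    by rewrite rmorphB/=; ring.
  have := cderivM (cderiv_id tz) (Hk tz (le_trans tzr (ltW r1r))).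
  have zc : 0 < cabs z by rewrite cabs_gt0.
  have zn1 : 0 < 1 + (cabs z)^-1 by rewrite ltr_wpDr// invr_ge0.
  move=> /(_ e e00)[dl dl0 H]; exists (dl / cabs z); first by rewrite divr_gt0.
  move=> y; rewrite ltr_pdivlMr// => yt.
  have E : y%:C * z - tz = (y - t)%:C * z by rewrite /tz rmorphB/=; ring.
  have {}H : cabs (y%:C * z * k (y%:C * z) - tz * k tz -
      (1 * k tz + tz * k' tz) * ((y - t)%:C * z)) <= e * (`|y - t| * cabs z).
    by have := H (y%:C * z); rewrite E cabsM cabs_real; exact.
  have E2 : y%:C * z * k (y%:C * z) - tz * k tz - (1 * k tz + tz * k' tz) * ((y - t)%:C * z) =
      (y%:C * k (y%:C * z) - t%:C * k tz - D t * (y - t)%:C) * z.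
    by rewrite /D -/tz; move: (k _) (k' _) (k _) => A1 A2 A3; rewrite /tz; ring.
  by move: H; rewrite E2 cabsM mulrA ler_pM2r.
apply: (cderiv_quadratic e0 (C := 2 * (C * 1 + cabs z * C + (C * r1 + C * 1)))).
  by rewrite !(mulr_ge0, addr_ge0)// ltW.
move=> w wz; pose h := w - z.
have wr : cabs w <= r1.
  by rewrite -(subrK z w) (le_trans (cabsD _ _))//; rewrite -/h in wz *; lra.
have cw : pcont 0 1 (fun t => w * k (t%:C * w)) by apply: pcontZ; exact: pth.
have cz : pcont 0 1 (fun t => z * k (t%:C * z)) by apply: pcontZ; exact: pth.
rewrite /ray_primitive -ID mulrC -cintZ// -cintB// -cintB//; last 2 first.
  exact: pcontB.
  exact: pcontZ.
have -> : 2 * (C * 1 + cabs z * C + (C * r1 + C * 1)) * cabs (w - z) ^+ 2 =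
   2 * ((C * 1 + cabs z * C + (C * r1 + C * 1)) * cabs (w - z) ^+ 2) * (1 - 0) by ring.
apply: cint_norm => //; first by apply: pcontB; [exact: pcontB|exact: pcontZ].
move=> t tab; rewrite -/h.
have tz := inb z t zr1' tab; have tw := inb w t wr tab.
have [HT HB] := HC (t%:C * z) (t%:C * w) tz tw.
have hr : cabs h <= r1 by move: wz; rewrite -/h; have := cabs_ge0 z; lra.
have Eh : t%:C * w - t%:C * z = t%:C * h by rewrite /h; ring.
rewrite Eh cabsM cabs_real in HT; move/andP: tab => [t0 t1].
rewrite (ger0_norm t0) in HT.
have HE : cabs (k (t%:C * w) - k (t%:C * z) - k' (t%:C * z) * (t%:C * h)) <= C * cabs h ^+ 2.
  by rewrite (le_trans HT)// ler_wpM2l// lerXn2r ?nnegrE ?mulr_ge0// ler_piMl.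
set E := _ - _ - _ in HE.
have -> : w * k (t%:C * w) - z * k (t%:C * z) - h * D t =
   h * (k' (t%:C * z) * (t%:C * h)) + z * E + h * E.
  by rewrite /E /D /h; ring.
apply: (le_trans (cabsD _ _)); apply: (le_trans (lerD (cabsD _ _) (lexx _))).
have B1 : cabs (h * (k' (t%:C * z) * (t%:C * h))) <= C * cabs h ^+ 2.
  rewrite !cabsM cabs_real (ger0_norm t0) expr2.
  have -> : C * (cabs h * cabs h) = cabs h * (C * (1 * cabs h)) by ring.
  by rewrite ler_wpM2l// ler_pM ?mulr_ge0// ler_wpM2r.
have B2 : cabs (z * E) <= cabs z * (C * cabs h ^+ 2) by rewrite cabsM ler_wpM2l.
have B3 : cabs (h * E) <= r1 * (C * cabs h ^+ 2) by rewrite cabsM ler_pM.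
apply: (le_trans (lerD (lerD B1 B2) B3)).
have : 0 <= C * cabs h ^+ 2 by rewrite mulr_ge0// exprn_ge0.
clear; move: (cabs h) (cabs z) => hh zz; nra.
Qed.

(** The primitive [g] of [F' / F] makes [F * cexp (- g)] constant. *)
Lemma log_exists F F' F'' r : (forall z, cabs z < r -> cderiv F z (F' z)) ->
  (forall z, cabs z < r -> cderiv F' z (F'' z)) ->
  (forall z, cabs z < r -> F z != 0) -> F 0 = 1 -> 0 < r ->
  exists g, [/\ forall z, cabs z < r -> cderiv g z (F' z / F z), g 0 = 0 &
    forall z, cabs z < r -> F z = cexp (g z)].
Proof.
move=> HF HF' F0 F01 r0; pose k z := F' z / F z.
have [k' Hk] : exists k', forall z, cabs z < r -> cderiv k z (k' z).
  exists (fun z => F'' z * (F z)^-1 + F' z * (- F' z / F z ^+ 2)) => z zr.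
  apply: cderivM; first exact: HF'.
  by apply: cderivV; [exact: F0|exact: HF].
have Hg z : cabs z < r -> cderiv (ray_primitive k) z (k z).
  move=> zr; apply: (@ray_primitive_deriv k k' ((cabs z + r) / 2)); first lra.
  by move=> w; rewrite subr0 => wr; apply: Hk; lra.
have g0 : ray_primitive k 0 = 0.
  rewrite /ray_primitive (@eq_cint _ _ _ _ (fun=> 0)); first by rewrite cint_cst// mulr0.
  by move=> t _; rewrite mul0r.
exists (ray_primitive k); split => // z zr.
pose Q w := F w * cexp (- ray_primitive k w).
have HQ : hol Q (fun=> 0) 0 (cabs z).
  move=> w; rewrite subr0 => wz; have wr := le_lt_trans wz zr.
  have := cderivM (HF w wr) (cderiv_comp (cderivN (Hg w wr)) (cderiv_cexp (- ray_primitive k w))).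
  rewrite (_ : _ + _ = 0)// /k; field; exact: F0.
have := hol_const HQ (z := z); rewrite subr0 => /(_ (lexx _)).
rewrite /Q g0 oppr0 cexp0 F01 mulr1 => H.
by rewrite -[F z]mulr1 -cexp0 -(addNr (ray_primitive k z)) cexpD mulrA H mul1r.
Qed.

(** Assume [Re (g z) > t] and let [z0] be the point of the level line nearest to
    [z].  On the disc around
    [z] that has [z0] on its boundary, [Re g >= t] by the intermediate value
    theorem, so Hopf's lemma bounds [Re (g z) - t] by [2 rho * cabs (g' z0)],
    where the radius [rho] is at most [2 * s] because the line passes through
    [p]. *)
Lemma level_control_pos g g' c s N t p z : 0 < s -> hol g g' c (4 * s) ->
  cabs (p - c) <= s -> complex.Re (g p) = t ->
  (forall w, cabs (w - c) <= 4 * s -> complex.Re (g w) = t -> cabs (g' w) <= N) ->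
  cabs (z - c) <= s -> complex.Re (g z) - t <= 4 * N * s.
Proof.
move=> s0 Hg pc gp HN zc.
have s40 : s <= 4 * s by lra.
have N0 : 0 <= N by apply: le_trans (HN p (le_trans pc s40) gp).
have [zt|zt] := leP (complex.Re (g z)) t.
  have : 0 <= 4 * N * s by rewrite !mulr_ge0// ltW.
  lra.
pose A w := cabs (w - c) <= 4 * s /\ complex.Re (g w) = t.
have Ap : A p by split => //; exact: le_trans s40.
have cg := hol_cont Hg.
have [z0 [z0c gz0] z0min] : exists2 z0, A z0 & forall w, A w -> cabs (z0 - z) <= cabs (w - z).
  apply: (@compact_min A (fun w => cabs (w - z)) (4 * s + cabs c)); first by exists p.
  - move=> w [wc _]; rewrite -(subrK c w) (le_trans (cabsD _ _))// lerD//.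
  - move=> w Hw.
    have wc : cabs (w - c) <= 4 * s.
      apply/ler_addgt0Pr => e e0; have [v [vc _] vw] := Hw e e0.
      by rewrite (le_trans (cabs_tri v _ _))// addrC lerD// cabsC ltW.
    split => //; apply/eqP; rewrite -subr_eq0 -normr_eq0 eq_le normr_ge0 andbT.
    apply/ler_addgt0Pr => e e0; rewrite add0r.
    have [dl dl0 Hc] := cg w wc e e0; have [v [vc <-] vw] := Hw dl dl0.
    by rewrite -cReN -cReD (le_trans (Re_le _))// cabsC Hc.
  - move=> w _ e e0; exists e => // v _ vw.
    by rewrite (le_trans (cabs_tri v _ _))// addrC lerD2l cabsC ltW.
pose rho := cabs (z0 - z).
have rho2 : rho <= 2 * s.
  rewrite (le_trans (z0min p Ap))// (le_trans (cabs_tri c _ _))// (cabsC c z); lra.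
have rho0 : 0 < rho.
  rewrite /rho cabs_gt0 subr_eq0; apply: contraTneq zt => <-.
  by rewrite gz0 ltxx.
have Hgz : hol g g' z rho by apply: holW Hg; lra.
have pos v : cabs (v - z) <= rho -> t <= complex.Re (g v).
  move=> vz; rewrite leNgt; apply/negP => gv.
  pose h (x : R) := complex.Re (g (z + x%:C * (v - z))).
  have ch : rcont 0 1 h.
    have [] // := @pcont_comp R 0 1 g (fun x => z + x%:C * (v - z)).
      exact: pcont_affine.
    by move=> x x01; apply: (hol_cont Hgz); exact: segment_ball.
  have h0 : h 0 = complex.Re (g z) by rewrite /h mul0r addr0.
  have h1 : h 1 = complex.Re (g v) by rewrite /h mul1r subrKC.
  have [|x] := IVT (ler01) (rcont_within ch) (v := t).
    by rewrite h0 h1; apply/andP; split; rewrite ?ge_min ?le_max ?(ltW gv) ?(ltW zt)// orbT.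
  rewrite in_itv/= => /andP[x0 x1] hx.
  have x1' : x < 1.
    rewrite lt_neqAle x1 andbT; apply: contraTneq gv => xE.
    by rewrite -leNgt -h1 -xE hx.
  have xz : cabs (z + x%:C * (v - z) - z) < rho.
    rewrite addrAC subrr add0r cabsM cabs_real ger0_norm//.
    have [->|vz0] := eqVneq (cabs (v - z)) 0; first by rewrite mulr0.
    by rewrite (lt_le_trans _ vz)// gtr_pMl// lt_def vz0/=.
  have Ax : A (z + x%:C * (v - z)).
    split => //; rewrite (le_trans (cabs_tri z _ _))//; lra.
  by have := le_lt_trans (z0min _ Ax) xz; rewrite ltxx.
have := hopf rho0 Hgz (erefl rho) pos gz0.
move=> H; apply: (le_trans H).
have : cabs (g' z0) <= N by exact: HN.
move=> H2; apply: (@le_trans _ _ (2 * (2 * s) * N)); last lra.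
by rewrite ler_pM ?mulr_ge0 ?(ltW rho0)// ler_wpM2l.
Qed.

(** A bound on the gradient along a level line controls the function around the
    line, not only on it. *)
Lemma level_control g g' c s N t p z : 0 < s -> hol g g' c (4 * s) ->
  cabs (p - c) <= s -> complex.Re (g p) = t ->
  (forall w, cabs (w - c) <= 4 * s -> complex.Re (g w) = t -> cabs (g' w) <= N) ->
  cabs (z - c) <= s -> `|complex.Re (g z) - t| <= 4 * N * s.
Proof.
move=> s0 Hg pc gp HN zc; rewrite ler_norml; apply/andP; split; last exact: level_control_pos gp HN zc.
have := @level_control_pos (fun w => - g w) (fun w => - g' w) c s N (- t) p z s0.
move=> H; have {}H : complex.Re (- g z) - - t <= 4 * N * s.
  apply: H => //.
  - by move=> w wc; apply: cderivN; exact: Hg.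
  - by rewrite cReN gp.
  - by move=> w wc; rewrite cReN cabsN => /oppr_inj; exact: HN.
by rewrite cReN in H; lra.
Qed.

(** The mean value inequality for [g w - g' z1 * w]. *)
Lemma near_affine g g' z1 rho N z : hol g g' z1 rho ->
  (forall w, cabs (w - z1) <= rho -> ccont g' w) ->
  (forall w, cabs (w - z1) <= rho -> cabs (g' w - g' z1) <= N) -> cabs (z - z1) <= rho ->
  cabs (g z - g z1 - g' z1 * (z - z1)) <= 2 * N * cabs (z - z1).
Proof.
move=> Hg cg' HN zr.
pose G w := g w - g' z1 * w.
have HG w : cabs (w - z1) <= rho -> cderiv G w (g' w - g' z1).
  move=> wr; have := cderivB (Hg w wr) (cderivZ (g' z1) (cderiv_id w)); by rewrite mulr1.
have cG w : cabs (w - z1) <= rho -> ccont (fun w => g' w - g' z1) w.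
  move=> wr; apply: ccontD; [exact: cg'|exact: ccont_cst].
have := @cint_path R 0 1 (fun w => g' w - g' z1) G z1 (z - z1) ler01.
move=> /(_ _ _)H.
have {}H := H (fun t tab => cG _ (segment_ball zr tab)) (fun t tab => HG _ (segment_ball zr tab)).
rewrite mul0r addr0 mul1r subrKC in H.
rewrite (_ : _ - _ - _ = G z - G z1); last by rewrite /G; ring.
rewrite -H cabsM ler_wpM2r//.
apply: (le_trans (cint_norm ler01 (M := N) _ _)); last by rewrite subr0 mulr1.
  apply: (@pcont_comp R 0 1 (fun w => g' w - g' z1)); first exact: pcont_affine.
  by move=> t tab; apply: cG; exact: segment_ball.
by move=> t tab; apply: HN; exact: segment_ball.
Qed.

(** A quantitative open mapping theorem.  The minimum of [cabs (g z - ze)] over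
    the disc is attained inside, because on the boundary [g] is too far from
    [g z1], by [near_affine].  At an interior point where [g z <> ze] a short
    step in the Newton direction [- (g z - ze) / g' z] would decrease the
    distance. *)
Lemma disc_covered g g' z1 rho N ze : 0 < rho -> hol g g' z1 rho ->
  (forall w, cabs (w - z1) <= rho -> ccont g' w) ->
  N = cabs (g' z1) -> 0 < N ->
  (forall w, cabs (w - z1) <= rho -> cabs (g' w - g' z1) <= N / 8) ->
  cabs (ze - g z1) < rho * N / 4 -> exists2 z, cabs (z - z1) <= rho & g z = ze.
Proof.
move=> rho0 Hg cg' NE N0 HN zeN.
pose A w := cabs (w - z1) <= rho.
have cg := hol_cont Hg.
have [z0 z0c z0min] : exists2 z0, A z0 & forall w, A w -> cabs (g z0 - ze) <= cabs (g w - ze).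
  apply: (@compact_min A (fun w => cabs (g w - ze)) (rho + cabs z1)).
  - by exists z1; rewrite /A subrr cabs0 ltW.
  - move=> w wc; rewrite -(subrK z1 w) (le_trans (cabsD _ _))// lerD//.
  - move=> w Hw; apply/ler_addgt0Pr => e e0; have [v vc vw] := Hw e e0.
    by rewrite (le_trans (cabs_tri v _ _))// addrC lerD// cabsC ltW.
  - move=> w wc e e0; have [dl dl0 H] := cg w wc e e0; exists dl => // v _ vw.
    by rewrite (le_trans (cabs_tri (g v) _ _))// addrC lerD2l cabsC H.
have A1 : A z1 by rewrite /A subrr cabs0 ltW.
have z0int : cabs (z0 - z1) < rho.
  have z0c' : cabs (z0 - z1) <= rho by []. rewrite lt_neqAle z0c' andbT; apply/negP => /eqP z0E.
  have := near_affine Hg cg' HN z0c; rewrite z0E => H.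
  have := z0min z1 A1; rewrite [in leRHS]cabsC => Hm.
  have H1 := cabsBge (g' z1 * (z0 - z1)) (g' z1 * (z0 - z1) - (g z0 - g z1)).
  rewrite subKr cabsM -NE z0E [cabs (_ - (_ - _))]cabsC in H1.
  have H2 := cabs_tri ze (g z0) (g z1).
  have : 0 < rho * N by rewrite mulr_gt0.
  clear -H H1 H2 Hm zeN; set x := rho * N in zeN *.
  rewrite (mulrC N rho) -/x in H1.
  have Hx : 2 * (N / 8) * rho = x / 4 by rewrite /x; field.
  rewrite Hx in H; lra.
exists z0 => //; apply/eqP; rewrite -subr_eq0; apply/eqP.
set v := g z0 - ze; apply/eqP; apply: contraT => v0.
have vc : 0 < cabs v by rewrite cabs_gt0.
have d0 : 0 < cabs (g' z0).
  have := HN z0 z0c; have := cabsBge (g' z1) (g' z1 - g' z0).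
  rewrite subKr -NE cabsC => H1 H2; lra.
set d := g' z0 in d0; have dn0 : d != 0 by rewrite -cabs_gt0.
have e0 : 0 < cabs d / 2 by rewrite divr_gt0.
have [dl dl0 H] := Hg z0 z0c _ e0.
have [q qE] : exists q, q = cabs v / cabs d by eexists.
have q0 : 0 < q by rewrite qE divr_gt0.
pose m := Num.min 1 (Num.min (dl / q) ((rho - cabs (z0 - z1)) / q)) / 2.
have M0 : 0 < Num.min 1 (Num.min (dl / q) ((rho - cabs (z0 - z1)) / q)).
  by rewrite !lt_min ltr01/= !divr_gt0// subr_gt0.
have m0 : 0 < m by rewrite divr_gt0.
have : m < 2 * m by rewrite mulr_natl mulr2n ltrDl.
have -> : 2 * m = Num.min 1 (Num.min (dl / q) ((rho - cabs (z0 - z1)) / q)) by rewrite /m; field.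
rewrite !lt_min !ltr_pdivlMr// => /and3P[m1 m2 m3].
pose w := z0 - m%:C * (v / d).
have wz : w - z0 = - (m%:C * (v / d)) by rewrite /w; ring.
have wzc : cabs (w - z0) = m * q.
  by rewrite qE wz cabsN !cabsM cabsV cabs_real gtr0_norm.
have Aw : A w.
  rewrite /A (le_trans (cabs_tri z0 _ _))// wzc; lra.
have := H w; rewrite wzc => /(_ m2) {}H.
have := z0min w Aw; rewrite -/v leNgt => /negP[].
have -> : g w - ze = (g w - g z0 - d * (w - z0)) + (1 - m%:C) * v.
  by rewrite wz /v; field.
apply: le_lt_trans (cabsD _ _) _.
have -> : cabs ((1 - m%:C) * v) = (1 - m) * cabs v.
  by rewrite cabsM -(rmorph1 (real_complex R)) -rmorphB/= cabs_real ger0_norm// subr_ge0 ltW.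
have E : cabs d / 2 * (m * q) = m * cabs v / 2 by rewrite qE; field; rewrite gt_eqF.
rewrite E in H; apply: le_lt_trans (lerD H (lexx _)) _.
have : 0 < m * cabs v by rewrite mulr_gt0.
rewrite mulrBl mul1r; lra.
Qed.
End AnalyticTools.

(** * Gradient on a level line of the logarithm *)

Section Dichotomy.
Context {R : realType}.
Implicit Types (f g F : R[i] -> R[i]) (c z w a b p : R[i]) (r s t e N : R).

Lemma circ_2pin n : circ (n%:R * (2 * pi)) = 1 :> R[i].
Proof.
elim: n => [|n IH]; first by rewrite mul0r circ0.
by rewrite -addn1 natrD mulrDl mul1r circD IH circ2pi mulr1.
Qed.

Lemma circ_2piz (j : int) : circ (j%:~R * (2 * pi)) = 1 :> R[i].
Proof.
case: j => n; first exact: circ_2pin.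
have := @circD R (n.+1%:R * (2 * pi)) ((Negz n)%:~R * (2 * pi)).
rewrite circ_2pin mul1r NegzE mulrNz mulNr subrr circ0 => <-.
by [].
Qed.

(** For fixed [u], the solutions of [cexp z = (expR u)%:C]. *)
Definition lattice (u : R) (j : int) : R[i] := u +i* (j%:~R * (2 * pi)).

Lemma cexp_lattice u j : cexp (lattice u j) = (expR u)%:C.
Proof. by rewrite /cexp /= circ_2piz mulr1. Qed.

(** The weight, which vanishes on the circle, makes the maximum useful in a
    whole neighbourhood: at the points of the level line within
    [(rad - cabs z1) / 2] of [z1] it bounds the gradient by twice its value at
    [z1]. *)
Lemma max_weighted (g g' : R[i] -> R[i]) t (rad : R) p :
  (forall z, cabs z <= rad -> ccont g z) -> (forall z, cabs z <= rad -> ccont g' z) ->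
  cabs p <= rad -> complex.Re (g p) = t ->
  exists z1, [/\ cabs z1 <= rad, complex.Re (g z1) = t &
    forall z, cabs z <= rad -> complex.Re (g z) = t ->
      (rad - cabs z) * cabs (g' z) <= (rad - cabs z1) * cabs (g' z1)].
Proof.
move=> cg cg' pr gp.
pose A w := cabs w <= rad /\ complex.Re (g w) = t.
have [z1 [z1r gz1] Hz1] : exists2 z1, A z1 & forall w, A w ->
    - ((rad - cabs z1) * cabs (g' z1)) <= - ((rad - cabs w) * cabs (g' w)).
  apply: (@compact_min _ A (fun w => - ((rad - cabs w) * cabs (g' w))) rad); first by exists p.
  - by move=> w [].
  - move=> w Hw.
    have wc : cabs w <= rad.
      apply/ler_addgt0Pr => e e0; have [v [vc _] vw] := Hw e e0.
      rewrite -(subrK v w) (le_trans (cabsD _ _))// addrC lerD// cabsC ltW//.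
    split => //; apply/eqP; rewrite -subr_eq0 -normr_eq0 eq_le normr_ge0 andbT.
    apply/ler_addgt0Pr => e e0; rewrite add0r.
    have [dl dl0 Hc] := cg w wc e e0; have [v [vc <-] vw] := Hw dl dl0.
    by rewrite -cReN -cReD (le_trans (Re_le _))// cabsC Hc.
  - move=> z [zr _] e e0; pose B := 1 + rad + cabs (g' z).
    have rad0 : 0 <= rad by apply: le_trans pr.
    have B0 : 0 < B by rewrite ltr_pwDl// ltr_pwDl.
    have e1 : 0 < Num.min 1 (e / (2 * B)) by rewrite lt_min ltr01/= divr_gt0// mulr_gt0.
    have [dl dl0 Hc] := cg' z zr _ e1.
    exists (Num.min dl (e / (2 * B))); first by rewrite lt_min dl0 divr_gt0// mulr_gt0.
    move=> w [wr _]; rewrite lt_min => /andP[/Hc {}Hc wz].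
    move: Hc; rewrite le_min => /andP[Hc1 Hc2].
    rewrite lerNl opprD opprK lerBlDr.
    have gw : cabs (g' w) <= cabs (g' z) + e / (2 * B).
      by rewrite -(subrK (g' z) (g' w)) (le_trans (cabsD _ _))// addrC lerD2l.
    have gw1 : cabs (g' w) <= B.
      rewrite -(subrK (g' z) (g' w)) (le_trans (cabsD _ _))// /B; lra.
    have zw : cabs z - cabs w <= e / (2 * B).
      by rewrite (le_trans (cabsBge _ _))// cabsC ltW.
    have E : e = B * (e / (2 * B)) + (e / (2 * B)) * B by field; rewrite gt_eqF.
    set x := e / (2 * B) in E gw zw.
    have x0 : 0 <= x by rewrite /x divr_ge0// ?(ltW e0)// mulr_ge0// ltW.
    have h1 : (cabs z - cabs w) * cabs (g' w) <= x * B.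
      apply: (@le_trans _ _ (x * cabs (g' w))); first by rewrite ler_wpM2r.
      by rewrite ler_wpM2l.
    have h2 : (rad - cabs z) * (cabs (g' w) - cabs (g' z)) <= B * x.
      apply: (@le_trans _ _ ((rad - cabs z) * x)).
        by rewrite ler_wpM2l ?subr_ge0// lerBlDl.
      rewrite ler_wpM2r// /B; have := cabs_ge0 z; have := cabs_ge0 (g' z); lra.
    rewrite E; nra.
exists z1; split => // z zr gz; have := Hz1 z (conj zr gz); by rewrite lerN2.
Qed.

(** Let [z1] maximise the weighted gradient on the level line, [d] its weight and
    [N] its gradient.  If [d * N] is at most a constant, the first alternative
    holds.  Otherwise the gradient on the level line is at most [2 * N] near
    [z1], so [Re g - t] is bounded there by a multiple of [N * d]
    ([level_control]), and [g'] is Lipschitz with constant of order [N / d]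
    ([re_deriv_lip]).  Hence [g] is nearly affine on a disc of radius [rho] of
    order [d], whose image contains a disc of radius of order [rho * N] around
    [g z1] ([disc_covered]); when [d * N] is large this disc contains [n]
    consecutive points of the vertical lattice of abscissa [t - ln 2]. *)
Lemma gradient_dichotomy (n : nat) : exists2 K0 : R, 0 < K0 &
  forall (g g' g'' : R[i] -> R[i]) t p,
    (forall z, cabs z < 1 -> cderiv g z (g' z)) ->
    (forall z, cabs z < 1 -> cderiv g' z (g'' z)) ->
    cabs p <= 1 / 2 -> complex.Re (g p) = t ->
    (forall z, cabs z <= 1 / 2 -> complex.Re (g z) = t -> (1 / 2 - cabs z) * cabs (g' z) <= K0) \/
    exists N (j : int) (zs : nat -> R[i]), 0 < N /\ forall k, (k < n)%N ->
      forall z, cabs (z - zs k) <= (8 * N)^-1 ->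
        [/\ cabs z < 1, N / 2 <= cabs (g' z) & cabs (g z - lattice (t - ln 2) (j + k%:Z)) <= 1 / 4].
Proof.
pose L : R := 64 * 64.
have L0 : 0 < L by rewrite mulr_gt0.
have pi0 := @twopi_gt0 R.
pose Q : R := n%:R * (2 * pi) + 3.
have Q0 : 3 <= Q by rewrite lerDr mulr_ge0// ltW.
have Q00 : 0 < Q by lra.
exists (4 * (16 * L) * Q); first by rewrite !mulr_gt0.
move=> g g' g'' t p Hg Hg' pr gp.
have r1 z : cabs z <= 1 / 2 -> cabs z < 1 by move=> ?; lra.
have cg z : cabs z < 1 -> ccont g z by move=> zr; exact: cderiv_cont (Hg z zr).
have cg' z : cabs z < 1 -> ccont g' z by move=> zr; exact: cderiv_cont (Hg' z zr).
have [z1 [z1r gz1 Hmax]] := @max_weighted g g' t (1 / 2) p (fun z zr => cg z (r1 z zr))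
  (fun z zr => cg' z (r1 z zr)) pr gp.
pose d := 1 / 2 - cabs z1; pose N := cabs (g' z1).
have [Hs|Hl] := leP (d * N) (4 * (16 * L) * Q).
  by left => z zr gz; exact: le_trans (Hmax z zr gz) Hs.
right.
have dN0 : 0 < d * N by apply: lt_trans Hl; rewrite !mulr_gt0.
have N0 : 0 <= N by rewrite /N.
have d0 : 0 <= d by rewrite /d; lra.
have {}d0 : 0 < d.
  by rewrite lt_neqAle d0 andbT; apply: contraTneq dN0 => <-; rewrite mul0r ltxx.
have {}N0 : 0 < N.
  by rewrite lt_neqAle N0 andbT; apply: contraTneq dN0 => <-; rewrite mulr0 ltxx.
have inD z : cabs (z - z1) <= d / 2 -> d / 2 <= 1 / 2 - cabs z.
  move=> zd; have : cabs z <= cabs (z - z1) + cabs z1.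
    by rewrite -{1}(subrK z1 z) cabsD.
  rewrite /d in zd *; lra.
have inD1 z : cabs (z - z1) <= d / 2 -> cabs z < 1 by move=> /inD; lra.
have Hgd r : r <= d / 2 -> hol g g' z1 r.
  by move=> rd z zr; apply: Hg; apply: inD1; exact: le_trans rd.
have s0 : 0 < d / 8 by rewrite divr_gt0.
have lev z : cabs (z - z1) <= d / 8 -> `|complex.Re (g z) - t| <= N * d.
  move=> zr; have -> : N * d = 4 * (2 * N) * (d / 8) by field.
  apply: (@level_control _ g g' z1 (d / 8) (2 * N) t z1 z s0) => //.
  - by apply: Hgd; lra.
  - by rewrite subrr cabs0 ltW.
  - move=> w wr gw.
    have wd : cabs (w - z1) <= d / 2 by lra.
    have w2 := inD _ wd; have := Hmax w _ gw; rewrite -/d -/N => H.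
    have {}H : (1 / 2 - cabs w) * cabs (g' w) <= d * N by apply: H; lra.
    rewrite -(ler_pM2l (_ : 0 < d / 2)) ?divr_gt0//.
    have -> : d / 2 * (2 * N) = d * N by field.
    by apply: le_trans H; rewrite ler_wpM2r.
have lip w : cabs (w - z1) <= d / 16 -> cabs (g' w - g' z1) <= L * N / d * cabs (w - z1).
  move=> wr; have := @re_deriv_lip _ g g' z1 (d / 8) t (N * d) s0 (Hgd _ _) _ z1 w.
  have -> : 64 * (N * d) / (d / 8) ^+ 2 = L * N / d by rewrite /L; field; rewrite gt_eqF.
  apply.
  - lra.
  - by move=> z zr; apply: lev; rewrite zr.
  - by rewrite subrr cabs0; lra.
  - lra.
pose rho := d / (16 * L).
have L1 : 1 <= L by rewrite /L; lra.
have rho0 : 0 < rho by rewrite divr_gt0// mulr_gt0.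
have rho2 : 2 * rho <= d / 16.
  rewrite /rho invfM; have -> : 2 * (d * (16^-1 * L^-1)) = d / 16 * (2 / L) by field; rewrite gt_eqF.
  by rewrite ler_piMr ?divr_ge0 ?(ltW d0)// ler_pdivrMr// /L; lra.
have near w : cabs (w - z1) <= 2 * rho -> cabs (g' w - g' z1) <= N / 8.
  move=> wr; apply: le_trans (lip w _) _; first lra.
  have -> : N / 8 = L * N / d * (2 * rho) by rewrite /rho; field; rewrite !gt_eqF.
  by rewrite ler_wpM2l// !mulr_ge0 ?invr_ge0 ?ltW.
have rhoN : 4 * Q < rho * N.
  rewrite /rho mulrAC ltr_pdivlMr ?mulr_gt0//; apply: le_lt_trans Hl.
  by rewrite le_eqVlt; apply/orP; left; apply/eqP; ring.
have cov ze : cabs (ze - g z1) < Q -> exists2 z, cabs (z - z1) <= rho & g z = ze.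
  move=> zeQ; apply: (@disc_covered _ g g' z1 rho N ze) => //.
  - by apply: Hgd; lra.
  - by move=> w wr; apply: cg'; apply: inD1; lra.
  - by move=> w wr; apply: near; lra.
  - by rewrite ltr_pdivlMr//; lra.
(* The first lattice point above the height of [g z1]; the last one used is at most
   [n * (2 * pi)] above that height, and [Q] also accounts for the shift by [ln 2]. *)
pose j := (Num.floor (complex.Im (g z1) / (2 * pi)) + 1).
pose y := complex.Im (g z1).
have jP : y < j%:~R * (2 * pi) <= y + 2 * pi.
  have := floorD1_gt (y / (2 * pi)); rewrite -/j ltr_pdivrMr// => ->/=.
  have := floor_le (y / (2 * pi)); rewrite ler_pdivlMr// => Hf.
  by rewrite /j -/y intrD mulrDl mul1r lerD.
have ln2 : 0 < ln (2 : R) <= 1.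
  rewrite ln_gt0 ?ltr1n//= -[leRHS]expRK ler_ln ?posrE ?expR_gt0//.
  by apply: le_trans (expR_ge1Dx 1); lra.
have hit k : (k < n)%N -> exists z, cabs (z - z1) <= rho /\ g z = lattice (t - ln 2) (j + k%:Z).
  move=> kn; have [|z zr gz] := cov (lattice (t - ln 2) (j + k%:Z)); last by exists z.
  rewrite (le_lt_trans (cabs_le _))// cReD cImD cReN cImN /= gz1 -/y.
  have -> : t - ln 2 - t = - ln 2 by ring.
  rewrite normrN gtr0_norm; last by case/andP: ln2.
  rewrite intrD mulrDl addrAC.
  have kk : 0 <= (k%:R : R) * (2 * pi) <= n%:R * (2 * pi) - 2 * pi.
    have kn1 : (k%:R : R) + 1 <= n%:R by rewrite natr1 ler_nat.
    have := ler_wpM2r (ltW pi0) kn1; rewrite mulrDl mul1r => H.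
    by rewrite mulr_ge0 ?(ltW pi0)//= lerBrDr.
  rewrite ger0_norm; last by rewrite addr_ge0//; [case/andP: jP => *; lra|case/andP: kk].
  rewrite /Q; case/andP: jP => *; case/andP: kk => *; case/andP: ln2 => *.
  rewrite -[k%:Z%:~R]/(k%:R : R); lra.
have /choice[zs Hzs] : forall k, exists z, (k < n)%N -> cabs (z - z1) <= rho /\ g z = lattice (t - ln 2) (j + k%:Z).
  move=> k; have [/hit[z Hz]|kn] := boolP (k < n)%N; first by exists z.
  by exists 0.
exists N, j, zs; split => // k /Hzs[zk gzk] z zz.
have small : (8 * N)^-1 <= rho.
  rewrite -[_^-1]mul1r ler_pdivrMr ?mulr_gt0//.
  have : 1 <= rho * N by apply: le_trans (ltW rhoN); lra.
  lra.
have zz1 : cabs (z - z1) <= 2 * rho.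
  rewrite (le_trans (cabs_tri (zs k) _ _))//; lra.
split.
- by apply: inD1; lra.
- have := near z zz1; have := cabsBge (g' z1) (g' z1 - g' z).
  rewrite subKr -/N cabsC; lra.
- rewrite -gzk.
  have Hk : hol g g' (zs k) (8 * N)^-1.
    by apply: (holW (c := z1) (r := 2 * rho)); [lra|apply: Hgd; lra].
  have nk w : cabs (w - zs k) <= (8 * N)^-1 -> cabs (w - z1) <= 2 * rho.
    move=> wz; rewrite (le_trans (cabs_tri (zs k) _ _))//; lra.
  have H1 := near_affine Hk (N := N / 4) _ _ zz.
  have {}H1 : cabs (g z - g (zs k) - g' (zs k) * (z - zs k)) <= 2 * (N / 4) * cabs (z - zs k).
    apply: H1.
    + by move=> w /nk wr; apply: cg'; apply: inD1; lra.
    + move=> w /nk /near w1; have := near (zs k) _ => w2.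
      have {}w2 : cabs (g' (zs k) - g' z1) <= N / 8 by apply: w2; lra.
      rewrite (le_trans (cabs_tri (g' z1) _ _))// (cabsC (g' z1)); lra.
  have gk : cabs (g' (zs k)) <= N + N / 8.
    have w2 := near (zs k) _; have {}w2 : cabs (g' (zs k) - g' z1) <= N / 8 by apply: w2; lra.
    by rewrite -(subrK (g' z1) (g' (zs k))) (le_trans (cabsD _ _))// addrC lerD2l.
  rewrite -(subrK (g' (zs k) * (z - zs k)) (g z - g (zs k))) (le_trans (cabsD _ _))// cabsM.
  apply: (le_trans (lerD H1 (ler_wpM2r (cabs_ge0 _) gk))).
  rewrite -mulrDl; apply: (@le_trans _ _ (2 * N * (8 * N)^-1)).
    by rewrite ler_pM//; lra.
  by rewrite le_eqVlt; apply/orP; left; apply/eqP; field; rewrite gt_eqF.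
Qed.
End Dichotomy.

(** * Measurability of open sets and continuous functions in the plane *)

Section OpenMeasurable.
Context {R : realType}.

(** Every neighbourhood [nb p e] contains a member, around [p], of a fixed
    sequence of measurable sets.  This is the form of second countability that
    makes open sets measurable and that passes to products. *)
Definition countably_based d (T : measurableType d) (nb : T -> R -> set T) :=
  exists B : nat -> set T, (forall n, measurable (B n)) /\
    forall p e, 0 < e -> exists n, B n p /\ B n `<=` nb p e.

Lemma based_open d (T : measurableType d) (nb : T -> R -> set T) (U : set T) :
  countably_based nb -> (forall p, U p -> exists2 e, 0 < e & nb p e `<=` U) -> measurable U.
Proof.
move=> [B [mB HB]] HU.
rewrite (_ : U = \bigcup_(n in [set n | B n `<=` U]) B n).
  by apply: bigcup_measurable => n _; exact: mB.
apply/seteqP; split => [p Up|p [n BU /BU]//].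
have [e e0 pe] := HU p Up; have [n [Bp Bn]] := HB p e e0.
by exists n => //; exact: subset_trans Bn pe.
Qed.

Lemma based_prod d1 d2 (T1 : measurableType d1) (T2 : measurableType d2)
  (nbA : T1 -> R -> set T1) (nbB : T2 -> R -> set T2) :
  countably_based nbA -> countably_based nbB ->
  countably_based (fun (p : T1 * T2) e => nbA p.1 e `*` nbB p.2 e).
Proof.
move=> [B1 [mB1 H1]] [B2 [mB2 H2]].
exists (fun n => if (unpickle n : option (nat * nat)) is Some (i, j) then B1 i `*` B2 j else set0).
split=> [n|p e e0].
  by case: unpickle => [[i j]|]; [exact: measurableX|exact: measurable0].
have [i [Bi HBi]] := H1 p.1 e e0; have [j [Bj HBj]] := H2 p.2 e e0.
exists (pickle (i, j)); rewrite pickleK; split; first by split.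
by move=> q [/HBi ? /HBj ?].
Qed.

Definition interval_at (x : measurableTypeR R) (e : R) : set (measurableTypeR R) :=
  [set y : R | `|y - (x : R)| < e].

Lemma based_interval : countably_based interval_at.
Proof.
exists (fun n => if (unpickle n : option (rat * rat)) is Some (a, b)
  then `]ratr a, ratr b[%classic else set0); split=> [n|x e e0].
  by case: unpickle => [[a b]|]; [exact: measurable_itv|exact: measurable0].
have /rat_in_itvoo[a] : (x : R) - e < x by rewrite gtrBl.
have /rat_in_itvoo[b] : (x : R) < x + e by rewrite ltrDl.
rewrite !in_itv/= => /andP[b1 b2] /andP[a1 a2].
exists (pickle (a, b)); rewrite pickleK; split; first by rewrite /= in_itv/= a2.
move=> y /=; rewrite in_itv/= /interval_at/= => /andP[y1 y2].
rewrite ltr_norml; apply/andP; split; lra.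
Qed.

Definition plane := (measurableTypeR R * measurableTypeR R)%type.
Definition square_at (p : plane) (e : R) : set plane := interval_at p.1 e `*` interval_at p.2 e.
Lemma based_plane : countably_based square_at.
Proof. exact: based_prod based_interval based_interval. Qed.

Lemma square_at_le (p : plane) e e' : e <= e' -> square_at p e `<=` square_at p e'.
Proof.
by move=> ee q [q1 q2]; split; [exact: lt_le_trans q1 ee|exact: lt_le_trans q2 ee].
Qed.

Lemma continuous_measurable (D : set plane) (phi : plane -> R) :
  (forall p, D p -> exists2 e, 0 < e & square_at p e `<=` D) ->
  (forall p, D p -> forall e, 0 < e -> exists2 dl : R, 0 < dl &
     forall q, square_at p dl q -> `|phi q - phi p| < e) ->
  measurable_fun D (phi : plane -> measurableTypeR R).
Proof.
move=> oD cphi mD; apply: (measurability _ (RGenOInfty.measurableE R)) => //.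
move=> _ [_ [x ->] <-]; apply: (based_open based_plane) => p [Dp /=].
rewrite in_itv/= andbT => xp.
have [e e0 He] := oD p Dp.
have px0 : 0 < phi p - x by rewrite subr_gt0.
have [dl dl0 H] := cphi p Dp _ px0.
exists (Num.min e dl); first by rewrite lt_min e0.
move=> q pq; split; first by apply: He; apply: square_at_le pq; rewrite ge_min lexx.
have /H : square_at p dl q by apply: square_at_le pq; rewrite ge_min lexx orbT.
by rewrite /= in_itv/= andbT ltr_norml => /andP[]; lra.
Qed.
End OpenMeasurable.

(** * The area of a half disc *)

Section DiscArea.
Context {R : realType}.
Notation mu := (@lebesgue_measure R).
Notation mu2 := ((@lebesgue_measure R \x @lebesgue_measure R)%E).
Local Notation plane := (@plane R).

Definition disc_at (a : plane) (r : R) : set plane :=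
  [set p | ((p.1 : R) - a.1) ^+ 2 + ((p.2 : R) - a.2) ^+ 2 < r ^+ 2].

(** The area under the half circle, by the substitution [x = a + r sin t]. *)
Lemma half_disc_integral (a r : R) : 0 < r ->
  (\int[mu]_(x in `[(a - r)%R, (a + r)%R]) (2 * Num.sqrt (r ^+ 2 - (x - a) ^+ 2))%:E = (pi * r ^+ 2)%:E)%E.
Proof.
move=> r0; pose F (t : R) : R := a + r * sin t.
pose G (x : R) : R := 2 * Num.sqrt (r ^+ 2 - (x - a) ^+ 2).
have dF (t : R) : is_derive t 1 F (r * cos t).
  rewrite /F; apply: is_derive_eq; rewrite /GRing.scale/=; ring.
have F1 : F (- (pi / 2)) = a - r by rewrite /F sinN sin_pihalf mulrN1.
have F2 : F (pi / 2) = a + r by rewrite /F sin_pihalf mulr1.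
have pi2 : - (pi / 2) <= pi / 2 :> R.
  by have := @pi_gt0 R => H; lra.
have dFE t : F^`() t = r * cos t by rewrite derive1E; have [_ ->] := dF t.
have cF t : {for t, continuous F}.
  have [/derivable1_diffP/differentiable_continuous] := dF t; exact.
have cdF t : {for t, continuous (F^`())}.
  rewrite (_ : F^`() = fun t => r * cos t); last by apply/funext => u; exact: dFE.
  by apply: cvgM; [exact: cvg_cst|exact: continuous_cos].
have cG (x : R) : {for x, continuous G}.
  apply: cvgM; first exact: cvg_cst.
  apply: (@continuous_comp _ _ _ (fun x => r ^+ 2 - (x - a) ^+ 2) (@Num.sqrt R)); last exact: sqrt_continuous.
  apply: cvgB; first exact: cvg_cst.
  have cx : {for x, continuous (fun x => x - a)} by apply: cvgB; [exact: cvg_id|exact: cvg_cst].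
  by apply: cvgM.
rewrite -F1 -F2 (@integration_by_substitution_increasing R F G)//.
- have rc t : - (pi / 2) <= t <= pi / 2 -> 0 <= cos t by exact: cos_ge0_pihalf.
  transitivity ((\int[mu]_(x in `[(- (pi / 2))%R, (pi / 2)%R]) (2 * r ^+ 2 * (cos x * cos x))%:E)%E).
    apply: eq_integral => t /[!inE] /=; rewrite in_itv/= => tin; congr EFin.
    rewrite fctE /= dFE /G /F [a + _]addrC addrK.
    rewrite (_ : r ^+ 2 - _ = (r * cos t) ^+ 2); last first.
      by rewrite !exprMn [cos t ^+ 2]cos2sin2; ring.
    rewrite sqrtr_sqr ger0_norm; last by rewrite mulr_ge0 ?(ltW r0)// rc.
    rewrite /=; ring.
  pose P (t : R) : R := r ^+ 2 * (t + sin t * cos t).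
  have dP (t : R) : is_derive t 1 P (2 * r ^+ 2 * (cos t * cos t)).
    rewrite /P; apply: is_derive_eq; rewrite /GRing.scale/=.
    have := cos2Dsin2 t; rewrite !expr2; move: (cos t) (sin t) => c s cs.
    have -> : s * - s = c * c - 1 by rewrite -cs; ring.
    ring.
  have pi2' : - (pi / 2) < pi / 2 :> R by have := @pi_gt0 R => H; lra.
  have cP t : {for t, continuous P}.
    have [/derivable1_diffP/differentiable_continuous] := dP t; exact.
  rewrite (@continuous_FTC2 _ _ P)//.
  + by rewrite -EFinB /P sinN sin_pihalf cosN cos_pihalf; congr EFin; field.
  + apply: continuous_subspaceT => x; apply: cvgM; first exact: cvg_cst.
    by apply: cvgM; exact: continuous_cos.
  + split.
    * by move=> t _; have [] := dP t.
    * by apply: cvg_at_right_filter; exact: cP.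
    * by apply: cvg_at_left_filter; exact: cP.
  + by move=> t _; rewrite derive1E; have [_ ->] := dP t.
- move=> x y; rewrite !in_itv /= => xin yin xy; rewrite /F ltrD2l ltr_pM2l// ltr_sin//; by rewrite in_itv.
- by move=> t _; exact: cdF.
- by apply/cvg_ex; exists (F^`() (- (pi / 2))); apply: cvg_at_right_filter; exact: cdF.
- by apply/cvg_ex; exists (F^`() (pi / 2)); apply: cvg_at_left_filter; exact: cdF.
- split.
  + by move=> t _; have [] := dF t.
  + by apply: cvg_at_right_filter; exact: cF.
  + by apply: cvg_at_left_filter; exact: cF.
- apply: continuous_subspaceT => x; exact: cG.
Qed.
End DiscArea.

(** * A lower bound for the area of an image *)

Section Coverage.
Context {R : realType}.
Local Notation plane := (@plane R).
Local Open Scope ereal_scope.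

Lemma einf_ge (u : nat -> \bar R) (x : \bar R) (N : nat) :
  (forall n, (N <= n)%N -> x <= u n) -> x <= limn_einf u.
Proof.
move=> H; rewrite limn_einf_lim; apply: lime_ge; first exact: is_cvg_einfs.
exists N => // n /= Nn; apply: le_ereal_inf_tmp => _ [k /= nk <-].
by apply: H; exact: leq_trans Nn nk.
Qed.

Lemma einf_le (u : nat -> \bar R) (x : \bar R) :
  (forall n, u n <= x) -> limn_einf u <= x.
Proof.
move=> H; rewrite limn_einf_lim; apply: lime_le; first exact: is_cvg_einfs.
apply: nearW => n; apply: le_trans (H n); apply: ereal_inf_lbound.
by exists n => /=.
Qed.

Context d (T : measurableType d).
Variable m : {sigma_finite_measure set T -> \bar R}.
Variable D : T -> R -> set T.
Hypothesis Hm : forall a r, (0 < r)%R -> m (D a r) = (pi * r ^+ 2)%:E.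
Hypothesis mdisc : forall a (r : R), measurable (D a r).

(** This inequality plays the part of the change of variables formula.  Here [P]
    is the map, [H] its Jacobian and [D a r] the disc of centre [a] and radius
    [r]; the hypothesis says that, for [e] small, some disc of radius [r] is
    mapped into the disc of radius [e] around [w], with a Jacobian of at least
    [(e / r) ^+ 2].  Let [G n w] be the integral of [H] over the points that [P]
    maps within [ep n] of [w], divided by the area of a disc of radius [ep n].
    By Tonelli's theorem [G n] has the integral of [H] for total mass; by
    hypothesis [G n w >= 1] for [n] large, for every [w] of [D o M].  Fatou's
    lemma concludes. *)
Lemma area_coverage (P : T -> T) (H : T -> R) (M : R) (o : T) : (0 < M)%R ->
  (forall e : R, measurable [set q : T * T | D (P q.2) e q.1]) ->
  measurable_fun setT H ->
  (forall z, 0 <= H z)%R ->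
  (forall w, D o M w -> exists2 e0 : R, (0 < e0)%R &
     forall e, (0 < e < e0)%R -> exists z0 r h, [/\ (0 < r)%R, (0 <= h)%R, (e ^+ 2 <= h * r ^+ 2)%R &
       forall z, D z0 r z -> D (P z) e w /\ (h <= H z)%R]) ->
  (pi * M ^+ 2)%:E <= \int[m]_z (H z)%:E.
Proof.
move=> M0 mSe mH H0 key.
pose ep (n : nat) : R := (n.+1%:R)^-1%R.
have ep0 n : (0 < ep n)%R by rewrite invr_gt0.
pose cn n : R := (pi * ep n ^+ 2)^-1%R.
have pe0 n : (0 < pi * ep n ^+ 2)%R by rewrite mulr_gt0 ?pi_gt0 ?exprn_gt0.
have cn0 n : (0 < cn n)%R by rewrite invr_gt0.
pose S n : set (T * T) := [set q | D (P q.2) (ep n) q.1].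
have mS n : measurable (S n) by exact: mSe.
pose g n (q : T * T) : \bar R := (cn n * H q.2 * \1_(S n) q)%:E.
have mg n : measurable_fun setT (g n).
  apply/measurable_EFinP; apply: measurable_funM; last exact: measurable_indic.
  by apply: measurable_funM => //; exact: measurableT_comp.
have g0 n q : 0 <= g n q.
  by rewrite lee_fin !mulr_ge0 ?(ltW (cn0 n)).
pose G n w := \int[m]_z g n (w, z).
have mG n : measurable_fun setT (G n).
  exact: (measurable_fun_fubini_tonelli_F (m2 := m) (g n) (mg n) (g0 n)).
have G0 n w : 0 <= G n w by apply: integral_ge0 => z _; exact: g0.
have inner n z : \int[m]_w g n (w, z) = (H z)%:E.
  rewrite /g (eq_integral (fun w => (cn n * H z)%:E * (\1_(D (P z) (ep n)) w)%:E)); last first.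
    by move=> w _; rewrite -EFinM.
  rewrite ge0_integralZl_EFin//; last 2 first.
    by apply/measurable_EFinP; exact: measurable_indic.
    by rewrite mulr_ge0// ltW.
  rewrite integral_indic// setIT [X in _ * X](Hm _ (ep0 n)) -EFinM; congr EFin.
  by rewrite /cn mulrC mulrA mulfV ?mul1r// gt_eqF.
have total n : \int[m]_w G n w = \int[m]_z (H z)%:E.
  rewrite /G (fubini_tonelli (m1 := m) (m2 := m) (g n) (mg n) (g0 n)).
  by apply: eq_integral => z _; exact: inner.
have low w : D o M w -> 1 <= limn_einf (G ^~ w).
  move=> /key[e0 e00 He].
  have [N HN] : exists N, forall n, (N <= n)%N -> (ep n < e0)%R.
    exists (Num.truncn e0^-1) => n Nn; rewrite /ep invf_plt ?posrE//.
    by rewrite (lt_le_trans (truncnS_gt _))// ler_nat.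
  apply: (@einf_ge _ _ N) => n /HN en.
  have [|z0 [r [h [r0 h0 er Hz]]]] := He (ep n); first by rewrite ep0.
  apply: (@le_trans _ _ (\int[m]_(z in D z0 r) g n (w, z))); last first.
    apply: ge0_subset_integral => //.
    exact: (measurable_fun_pair2 w (mg n)).
  apply: (@le_trans _ _ (\int[m]_(z in D z0 r) (cst (cn n * h)%:E) z)).
    rewrite integral_cst// [X in _ * X](Hm _ r0) -EFinM lee_fin /cn.
    rewrite -mulrA ler_pdivlMl// mulr1 [leRHS]mulrCA ler_pM2l ?pi_gt0//.
  apply: ge0_le_integral => //.
  - by move=> z _; rewrite lee_fin mulr_ge0// ltW.
  - by apply: measurable_funTS; exact: (measurable_fun_pair2 w (mg n)).
  - move=> z Hz'; have [Sz hz] := Hz z Hz'.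
    rewrite /g lee_fin indicE mem_set// mulr1 ler_pM2l//.
have := @fatou _ _ _ m (D o M) (mdisc _ _) G (fun n => measurable_funTS (mG n)) (fun n x _ => G0 n x).
have HL : (pi * M ^+ 2)%:E <= \int[m]_(x in D o M) limn_einf (G^~ x).
  rewrite -(Hm o) // -[X in X <= _]mul1e -integral_cst//.
  apply: ge0_le_integral => //.
  rewrite /limn_einf; apply: measurableT_comp => //.
  apply: measurable_fun_limn_esup => n; apply: measurableT_comp => //.
  exact: measurable_funTS.
move=> /(le_trans HL) /le_trans; apply; apply: einf_le => n.
rewrite -(total n); apply: ge0_subset_integral => //.
Qed.
End Coverage.

(** * An analytic function of small area omits a value *)

Section Omitted.
Context {R : realType}.
Notation mu := (@lebesgue_measure R).
Notation mu2 := ((@lebesgue_measure R \x @lebesgue_measure R)%E).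
Local Notation plane := (@plane R).

Lemma measurable_near d (X : measurableType d) (u1 u2 v1 v2 : X -> R) (k : R) :
  measurable_fun setT u1 -> measurable_fun setT u2 ->
  measurable_fun setT v1 -> measurable_fun setT v2 ->
  measurable [set x | (u1 x - v1 x) ^+ 2 + (u2 x - v2 x) ^+ 2 < k].
Proof.
move=> m1 m2 m3 m4.
pose h x : R := (u1 x - v1 x) ^+ 2 + (u2 x - v2 x) ^+ 2.
have mh : measurable_fun setT h.
  by apply: measurable_funD; apply: measurable_funX; apply: measurable_funB.
rewrite (_ : [set x | _] = h @^-1` `]-oo, k[%classic).
  by rewrite -[X in measurable X]setTI; apply: mh => //; exact: measurable_itv.
by apply/seteqP; split => x; rewrite /= in_itv.
Qed.

Lemma disc_measurable (a : plane) (r : R) : measurable (disc_at a r).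
Proof.
exact: measurable_near.
Qed.

Lemma disc_area (a : plane) (r : R) : 0 < r -> mu2 (disc_at a r) = (pi * r ^+ 2)%:E.
Proof.
move=> r0; rewrite -(half_disc_integral a.1 r0) /product_measure1.
rewrite [RHS]integral_mkcond; apply: eq_integral => x _.
rewrite /= patchE.
case: ifPn => [|]; rewrite ?inE ?notin_setE /= in_itv/=.
  move=> /andP[x1 x2].
  have q0 : 0 <= r ^+ 2 - (x - a.1) ^+ 2.
    rewrite subr_ge0 -[(x - _) ^+ 2]real_normK ?num_real// ler_pXn2r ?nnegrE ?(ltW r0)//.
    rewrite ler_norml; lra.
  set s := Num.sqrt _.
  have s0 : 0 <= s by exact: sqrtr_ge0.
  have -> : xsection (disc_at a r) x = `](a.2 - s)%R, (a.2 + s)%R[%classic.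
    apply/seteqP; split => y; rewrite /xsection /= inE /disc_at /= in_itv/=.
      rewrite -ltrBrDl -(sqr_sqrtr q0) -/s -[(y - _) ^+ 2]real_normK ?num_real//.
      rewrite ltr_pXn2r ?nnegrE// ltr_norml; lra.
    move=> ys; rewrite -ltrBrDl -(sqr_sqrtr q0) -/s -[(y - _) ^+ 2]real_normK ?num_real//.
    rewrite ltr_pXn2r ?nnegrE// ltr_norml; lra.
  refine (etrans (lebesgue_measure_itv (Interval (BRight (a.2 - s)) (BLeft (a.2 + s)))) _).
  rewrite /= lte_fin; case: ltP => [_|H].
    by rewrite -EFinB; congr EFin; ring.
  have -> : s = 0 by lra.
  by rewrite mulr0.
move=> Hx; rewrite (_ : xsection _ _ = set0) ?measure0//.
apply/seteqP; split => y //; rewrite /xsection /= inE /disc_at /= => Hd.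
apply: Hx; have := sqr_ge0 (y - a.2) => H.
have {}Hd : (x - a.1) ^+ 2 < r ^+ 2 by lra.
move: Hd; rewrite -[(x - _) ^+ 2]real_normK ?num_real// ltr_pXn2r ?nnegrE ?(ltW r0)//.
rewrite ltr_norml; lra.
Qed.

(** The product measure under a name of its own, on which the sigma-finite
    structure that [area_coverage] asks for is declared. *)
Definition planar : set (measurableTypeR R * measurableTypeR R)%type -> \bar R := mu2.

HB.instance Definition _ := Measure.on planar.

Lemma planar_sigma_finite : sigma_finite setT planar.
Proof.
exists (fun n => disc_at (0, 0) n.+1%:R).
  apply/seteqP; split => // p _; pose x : R := p.1; pose y : R := p.2.
  exists (Num.truncn (x ^+ 2 + y ^+ 2)) => //.
  rewrite /disc_at /= !subr0; apply: lt_le_trans (truncnS_gt _) _.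
  by rewrite expr2 ler_peMl// ler1n.
by move=> k; split; [exact: disc_measurable|rewrite [planar _]disc_area// ltry].
Qed.

HB.instance Definition _ := Measure_isSigmaFinite.Build _ _ _ planar planar_sigma_finite.

Definition cpx (p : plane) : R[i] := (p.1 : R) +i* (p.2 : R).

Lemma cabs_square_at (p q : plane) e : square_at p (e / 2) q -> cabs (cpx q - cpx p) < e.
Proof.
move=> [q1 q2]; rewrite (le_lt_trans (cabs_le _))// cReD cImD cReN cImN (splitr e).
exact: ltrD.
Qed.

Lemma disc_atE (a w : plane) r : 0 < r -> disc_at a r w <-> cabs (cpx w - cpx a) < r.
Proof.
move=> r0; rewrite /disc_at /=.
have -> : ((w.1 : R) - a.1) ^+ 2 + ((w.2 : R) - a.2) ^+ 2 = cabs (cpx w - cpx a) ^+ 2.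
  by rewrite cabs_sq cReD cImD cReN cImN.
by rewrite ltr_pXn2r ?nnegrE// ltW.
Qed.

Definition preimage_disc (f : R[i] -> R[i]) (M : R) : set plane :=
  [set p | cabs (cpx p) < 1 /\ cabs (f (cpx p)) < M].

Lemma ccont_square_at (h : R[i] -> R[i]) (p : plane) : ccont h (cpx p) -> forall e, 0 < e ->
  exists2 dl : R, 0 < dl & forall q, square_at p dl q -> cabs (h (cpx q) - h (cpx p)) < e.
Proof.
move=> ch e e0; have e2 : 0 < e / 2 by rewrite divr_gt0.
have [dl dl0 H] := ch _ e2; exists (dl / 2); first by rewrite divr_gt0.
move=> q /cabs_square_at /H Hq; apply: le_lt_trans Hq _; lra.
Qed.

Lemma preimage_open (f : R[i] -> R[i]) M : (forall z, cabs z < 1 -> ccont f z) ->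
  forall p, preimage_disc f M p -> exists2 e, 0 < e & square_at p e `<=` preimage_disc f M.
Proof.
move=> cf p [p1 pM].
have e1 : 0 < 1 - cabs (cpx p) by rewrite subr_gt0.
have e2 : 0 < M - cabs (f (cpx p)) by rewrite subr_gt0.
have [d1 d10 H1] := ccont_square_at (cderiv_cont (cderiv_id (cpx p))) e1.
have [d2 d20 H2] := ccont_square_at (cf _ p1) e2.
exists (Num.min d1 d2); first by rewrite lt_min d10.
move=> q pq; split.
  have /H1 : square_at p d1 q by apply: square_at_le pq; rewrite ge_min lexx.
  by have := cabsBge (cpx q) (cpx p) => H; lra.
have /H2 : square_at p d2 q by apply: square_at_le pq; rewrite ge_min lexx orbT.
by have := cabsBge (f (cpx q)) (f (cpx p)) => H; lra.
Qed.

Lemma preimage_measurable (f : R[i] -> R[i]) M : (forall z, cabs z < 1 -> ccont f z) ->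
  measurable (preimage_disc f M).
Proof. by move=> cf; apply: (based_open based_plane); exact: preimage_open. Qed.

Lemma measurable_comp_cont (f : R[i] -> R[i]) M (h : R[i] -> R[i]) (N : R[i] -> R) :
  (forall z, cabs z < 1 -> ccont f z) -> (forall z, cabs z < 1 -> ccont h z) ->
  (forall z w, `|N z - N w| <= cabs (z - w)) ->
  measurable_fun (preimage_disc f M) ((fun p => N (h (cpx p))) : plane -> measurableTypeR R).
Proof.
move=> cf ch HN; apply: continuous_measurable; first exact: preimage_open.
move=> p [p1 _] e e0; have [dl dl0 H] := ccont_square_at (ch _ p1) e0.
by exists dl => // q /H; apply: le_lt_trans.
Qed.

(** If [f] took every value of the disc of radius [M], the area of its image
    would be at least that of the disc.  Apply [area_coverage] to [f] with the
    Jacobian [cabs (f' z) ^+ 2 + dl], extended by 0 outside the preimage of the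
    disc; letting [dl] tend to 0 costs nothing as the unit disc has finite
    area. *)
Lemma omitted_value (f f' : R[i] -> R[i]) (M : R) : 0 < M ->
  (forall z, cabs z < 1 -> cderiv f z (f' z)) ->
  (forall z, cabs z < 1 -> ccont f' z) ->
  (\int[planar]_(p in preimage_disc f M) (cabs (f' (cpx p)) ^+ 2)%:E < (pi * M ^+ 2)%:E)%E ->
  exists2 w, cabs w < M & forall z, cabs z < 1 -> f z <> w.
Proof.
move=> M0 df cf' HA; apply: contrapT => nw.
have cf z : cabs z < 1 -> ccont f z by move=> /df; exact: cderiv_cont.
have hit w : cabs w < M -> exists2 z, cabs z < 1 & f z = w.
  move=> wM; apply: contrapT => nz; apply: nw; exists w => // z z1 fz.
  by apply: nz; exists z.
set Om := preimage_disc f M in HA.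
have mOm : measurable Om by exact: preimage_measurable.
have mg : measurable_fun Om ((fun p => cabs (f' (cpx p)) ^+ 2) : plane -> measurableTypeR R).
  apply: measurable_funX; apply: measurable_comp_cont => // z w.
  by rewrite ler_norml cabsBge lerNl opprB cabsC cabsBge.
have mgE : measurable_fun Om (fun p => (cabs (f' (cpx p)) ^+ 2)%:E) by apply/measurable_EFinP.
set A := (\int[planar]_(p in _) _)%E in HA.
have A0 : (0 <= A)%E by apply: integral_ge0 => p _; rewrite lee_fin exprn_ge0.
have Afin : A \is a fin_num by rewrite ge0_fin_numE// (lt_trans HA)// ltry.
have key (dl : R) : 0 < dl -> ((pi * M ^+ 2)%:E <= A + (dl * pi)%:E)%E.
  move=> dl0.
  pose H0 (p : plane) : R := cabs (f' (cpx p)) ^+ 2 + dl.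
  pose H : plane -> R := H0 \_ Om.
  pose Q1 : plane -> R := (fun p => complex.Re (f (cpx p))) \_ Om.
  pose Q2 : plane -> R := (fun p => complex.Im (f (cpx p))) \_ Om.
  have mH : measurable_fun setT (H : plane -> measurableTypeR R).
    by apply/(measurable_restrictT _ mOm); apply: measurable_funD.
  have mQ1 : measurable_fun setT (Q1 : plane -> measurableTypeR R).
    apply/(measurable_restrictT _ mOm).
    apply: measurable_comp_cont => // z w; by rewrite -cReN -cReD Re_le.
  have mQ2 : measurable_fun setT (Q2 : plane -> measurableTypeR R).
    apply/(measurable_restrictT _ mOm).
    apply: measurable_comp_cont => // z w; by rewrite -cImN -cImD Im_le.
  have HC : ((pi * M ^+ 2)%:E <= \int[planar]_z (H z)%:E)%E.
    apply: (area_coverage (m := planar) disc_area disc_measurable (P := fun p => (Q1 p, Q2 p)) (o := (0, 0))) => //.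
    - move=> e; apply: measurable_near.
      + by apply: (measurableT_comp measurable_fst); exact: measurable_fst.
      + by apply: (measurableT_comp measurable_snd); exact: measurable_fst.
      + by apply: (measurableT_comp mQ1); exact: measurable_snd.
      + by apply: (measurableT_comp mQ2); exact: measurable_snd.
    - move=> z; rewrite /H patchE; case: ifP => // _.
      by rewrite /H0 addr_ge0// ?exprn_ge0// ltW.
    - move=> w /(disc_atE _ _ M0); rewrite [cpx (0, 0)](_ : _ = 0)// subr0 => wM.
      have [z0 z01 fz0] := hit _ wM.
      pose B := cabs (f' z0); have B0 : 0 <= B by rewrite /B.
      (* At a preimage [z0] of [w], [f] is Lipschitz with constant [B + eta] near [z0].
         The slack [dl] in the Jacobian absorbs [eta]; this also covers [f' z0 = 0]. *)
      pose eta := Num.min 1 (dl / (4 * B + 1)).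
      have B1 : 0 < 4 * B + 1 by rewrite ltr_wpDl// mulr_ge0.
      have eta0 : 0 < eta by rewrite lt_min ltr01 divr_gt0.
      have : eta <= eta by []. rewrite {2}/eta le_min => /andP[eta1].
      rewrite ler_pdivlMr// => etad.
      have quad : (B + eta) ^+ 2 <= B ^+ 2 - 2 * B * eta + dl.
        have : eta * eta <= eta by rewrite ler_piMl// ltW.
        rewrite !expr2; clear -etad; nra.
      have [d1 d10 H1] := df z0 z01 _ eta0.
      have [d2 d20 H2] := cf' z0 z01 _ eta0.
      have BE : 0 < B + eta by rewrite ltr_wpDl.
      have z00 : 0 < 1 - cabs z0 by rewrite subr_gt0.
      pose mm := Num.min (Num.min d1 d2) (1 - cabs z0).
      have mm0 : 0 < mm by rewrite !lt_min d10 d20.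
      have Mw : 0 < M - cabs (cpx w) by rewrite subr_gt0.
      exists (Num.min (M - cabs (cpx w)) ((B + eta) * mm)); first by rewrite lt_min Mw mulr_gt0.
      move=> e /andP[e0]; rewrite lt_min => /andP[eM emm].
      exists (complex.Re z0, complex.Im z0), (e / (B + eta)), ((B + eta) ^+ 2).
      have r0 : 0 < e / (B + eta) by rewrite divr_gt0.
      split => //; first by rewrite exprn_ge0// ltW.
        by rewrite -exprMn mulrC divfK// gt_eqF.
      move=> z /(disc_atE _ _ r0); rewrite [cpx (_, _)](_ : _ = z0); last by case: (z0).
      move=> zr; have zm : cabs (cpx z - z0) < mm.
        by apply: lt_trans zr _; rewrite ltr_pdivrMr// mulrC.
      move: zm; rewrite !lt_min => /andP[/andP[zd1 zd2] zd3].
      have fz : cabs (f (cpx z) - cpx w) < e.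
        have E : f (cpx z) - cpx w = (f (cpx z) - f z0 - f' z0 * (cpx z - z0)) + f' z0 * (cpx z - z0).
          by rewrite fz0; ring.
        rewrite E (le_lt_trans (cabsD _ _))// cabsM (le_lt_trans (lerD (H1 _ zd1) (lexx _)))//.
        by rewrite -mulrDl addrC -/B -ltr_pdivlMl// mulrC.
      have zOm : z \in Om.
        rewrite inE; split.
          by have := cabsBge (cpx z) z0 => G; lra.
        by have := cabsBge (f (cpx z)) (cpx w) => G; lra.
      have qE : cpx (Q1 z, Q2 z) = f (cpx z).
        by rewrite /Q1 /Q2 !patchE zOm /cpx /=; case: (f _).
      split; first by apply/(disc_atE _ _ e0); rewrite qE cabsC.
      rewrite /H patchE zOm /H0; apply: (le_trans quad); rewrite lerD2r.
      have gz : B - eta <= cabs (f' (cpx z)).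
        have := H2 _ zd2; have := cabsBge (f' z0) (f' (cpx z)); rewrite -/B cabsC => G1 G2; lra.
      have [Be|Be] := leP 0 (B - eta).
        apply: (@le_trans _ _ ((B - eta) ^+ 2)); last by rewrite lerXn2r ?nnegrE.
        have := sqr_ge0 eta; rewrite !expr2; clear; nra.
      apply: (@le_trans _ _ 0); last by rewrite exprn_ge0.
      rewrite expr2; clear -Be B0; nra.
  apply: (le_trans HC).
  rewrite (_ : (fun z => (H z)%:E) = (fun p => (H0 p)%:E) \_ Om); last first.
    by apply/funext => z; rewrite /H !patchE; case: ifP.
  rewrite -integral_mkcond /H0.
  under eq_integral do rewrite EFinD.
  rewrite ge0_integralD//; last 2 first.
    by move=> p _; rewrite lee_fin exprn_ge0.
    by move=> p _; rewrite lee_fin ltW.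
  apply: leeD => //; rewrite (integral_cst _ _ dl%:E)// EFinM lee_pmul2l//.
  have := @disc_area (0, 0) 1 ltr01; rewrite expr1n mulr1 => <-.
  apply: le_measure; rewrite ?inE//; first exact: disc_measurable.
  move=> p [p1 _]; apply/(disc_atE _ _ ltr01).
  by rewrite [cpx (0, 0)](_ : _ = 0)// subr0.
pose a := fine A; have AE : A = a%:E by rewrite fineK.
have pi0 := @pi_gt0 R.
rewrite AE lte_fin in HA.
have d0 : 0 < (pi * M ^+ 2 - a) / (2 * pi) by rewrite divr_gt0 ?mulr_gt0// subr_gt0.
have := key _ d0; rewrite AE -EFinD lee_fin.
have -> : (pi * M ^+ 2 - a) / (2 * pi) * pi = (pi * M ^+ 2 - a) / 2.
  move: pi pi0 => p p0; by field; rewrite gt_eqF.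
lra.
Qed.
End Omitted.

(** * Area carried by disjoint squares *)

Section SquaresArea.
Context {R : realType}.
Notation mu := (@lebesgue_measure R).
Local Notation plane := (@plane R).

(** The closed discs around 0 of radius [(1 + cabs z) / 2] exhaust the open
    unit disc. *)
Lemma analytic_deriv (f f' : R[i] -> R[i]) : (forall z, cabs z < 1 -> cderiv f z (f' z)) ->
  exists f'', forall z, cabs z < 1 -> cderiv f' z (f'' z).
Proof.
move=> df; have /choice[f'' H] : forall z, exists l, cabs z < 1 -> cderiv f' z l.
  move=> z; have [z1|z1] := ltP (cabs z) 1; last by exists 0 => zz; lra.
  have r0 : 0 < (1 + cabs z) / 2 by have := cabs_ge0 z => z0; lra.
  have Hh : hol f f' 0 ((1 + cabs z) / 2).
    by move=> w; rewrite subr0 => wr; apply: df; lra.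
  have [f'' Hf''] := hol_deriv r0 Hh.
  by exists (f'' z) => _; apply: Hf''; rewrite subr0; lra.
by exists f''.
Qed.

Lemma expR_small (x : R) : `|x| <= 1 / 4 -> 3 / 4 <= expR x <= 4 / 3.
Proof.
rewrite ler_norml => /andP[x1 x2]; apply/andP; split.
  by apply: le_trans (expR_ge1Dx x); lra.
have : 3 / 4 <= expR (- x) by apply: le_trans (expR_ge1Dx (- x)); lra.
rewrite expRN => H; have e0 := expR_gt0 x.
have : 3 / 4 * expR x <= 1.
  by rewrite -[leRHS](mulVf (lt0r_neq0 e0)) ler_pM2r.
move=> {x1 x2} H1; lra.
Qed.

(** On the segment from 0 to [h] the derivative has modulus at most [4 / 3], and
    [2 * (4 / 3) * (1 / 4) = 2 / 3]. *)
Lemma cexp_near1 (h : R[i]) : cabs h <= 1 / 4 -> cabs (cexp h - 1) <= 2 / 3.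
Proof.
move=> h1.
have seg t : 0 <= t <= 1 -> cabs (0 + t%:C * h) <= 1 / 4.
  move=> /andP[t0 t1]; rewrite add0r cabsM cabs_real ger0_norm//.
  by apply: le_trans h1; rewrite ler_piMl.
have ce t : ccont cexp (0 + t%:C * h) by exact: cderiv_cont (cderiv_cexp _).
have := @cint_path R 0 1 cexp cexp 0 h ler01 (fun t _ => ce t) (fun t _ => cderiv_cexp _).
rewrite mul0r addr0 mul1r add0r cexp0 => <-; rewrite cabsM.
have H : cabs (cint 0 1 (fun t => cexp (0 + t%:C * h))) <= 2 * (4 / 3) * (1 - 0).
  apply: cint_norm => //.
    by apply: (@pcont_comp R 0 1 cexp); [exact: pcont_affine|move=> t _; exact: ce].
  move=> t tab; rewrite cabs_cexp.
  have /expR_small/andP[] // : `|complex.Re (0 + t%:C * h)| <= 1 / 4.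
  by apply: le_trans (Re_le _) (seg t tab).
rewrite subr0 mulr1 in H.
apply: (le_trans (ler_pM (cabs_ge0 _) (cabs_ge0 _) H h1)); lra.
Qed.

Lemma interval_at_itv (x s : R) : interval_at x s = `]x - s, x + s[%classic.
Proof.
apply/seteqP; split => y; rewrite /interval_at /= in_itv/= ltr_norml => H; lra.
Qed.

Lemma interval_at_measurable (x s : R) : measurable (interval_at x s).
Proof. by rewrite interval_at_itv; exact: measurable_itv. Qed.

Lemma interval_at_length (x s : R) : 0 < s -> mu (interval_at x s) = (2 * s)%:E.
Proof.
move=> s0; rewrite interval_at_itv.
refine (etrans (lebesgue_measure_itv (Interval (BRight (x - s)) (BLeft (x + s)))) _).
rewrite /= lte_fin; case: ltP => [_|]; last by move=> H; exfalso; lra.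
by rewrite -EFinB; congr EFin; ring.
Qed.

Lemma square_measurable (c : plane) (s : R) : measurable (square_at c s).
Proof. by apply: measurableX; exact: interval_at_measurable. Qed.

Lemma square_area (c : plane) (s : R) : 0 < s -> planar (square_at c s) = ((2 * s) ^+ 2)%:E.
Proof.
move=> s0; refine (etrans (product_measure1E mu mu (interval_at_measurable c.1 s) (interval_at_measurable c.2 s)) _).
refine (etrans (f_equal2 (fun a b => (a * b)%E) (interval_at_length c.1 s0) (interval_at_length c.2 s0)) _).
by rewrite -EFinM expr2.
Qed.

Lemma area_squares (Om : set plane) (h : plane -> R) (v s : R) (n : nat) (c : nat -> plane) :
  measurable Om -> measurable_fun Om (h : plane -> measurableTypeR R) ->
  (forall p, 0 <= h p) -> 0 < s -> 0 <= v ->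
  (forall k p, (k < n)%N -> square_at (c k) s p -> Om p /\ v <= h p) ->
  (forall k l p, (k < n)%N -> (l < n)%N -> square_at (c k) s p -> square_at (c l) s p -> k = l) ->
  ((n%:R * (v * (2 * s) ^+ 2))%:E <= \int[planar]_(p in Om) (h p)%:E)%E.
Proof.
move=> mOm mh h0 s0 v0 Hin Hdis.
pose U := \big[setU/set0]_(k < n) square_at (c k) s.
have mU : measurable U by apply: bigsetU_measurable => k _; exact: square_measurable.
have UE : U = \bigcup_(k in [set k | (k < n)%N]) square_at (c k) s by rewrite /U bigcup_mkord.
have UOm : U `<=` Om.
  by rewrite UE => p [k /= kn kp]; have [] := Hin k p kn kp.
have Uv p : U p -> v <= h p.
  by rewrite UE => -[k /= kn kp]; have [] := Hin k p kn kp.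
have muU : planar U = (n%:R * (2 * s) ^+ 2)%:E.
  have mk k : (k < n)%N -> measurable (square_at (c k) s) by move=> _; exact: square_measurable.
  have tr : trivIset `I_n (fun k => square_at (c k) s).
    by move=> k l /= kn ln [p [kp lp]]; exact: (Hdis k l p).
  refine (etrans (@measure_semi_additive_ord_I _ _ _ planar (fun k => square_at (c k) s) n mk tr mU) _).
  have sa k : @planar R (square_at (c k) s) = ((2 * s) ^+ 2)%:E by exact: square_area.
  transitivity (\sum_(k < n) ((2 * s) ^+ 2)%:E)%E; first by apply: eq_bigr => k _; exact: sa.
  by rewrite sumEFin; congr EFin; rewrite sumr_const card_ord [RHS]mulr_natl.
have mhE : measurable_fun Om (fun p => (h p)%:E) by apply/measurable_EFinP.
have mhUE : measurable_fun U (fun p => (h p)%:E) by exact: measurable_funS mhE.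
have I1 : (\int[planar]_(p in U) (h p)%:E <= \int[planar]_(p in Om) (h p)%:E)%E.
  by apply: ge0_subset_integral => // p _; rewrite lee_fin.
have I2 : (\int[planar]_(p in U) (cst v%:E) p <= \int[planar]_(p in U) (h p)%:E)%E.
  by apply: ge0_le_integral.
have I3 : (\int[planar]_(p in U) (cst v%:E) p = (n%:R * (v * (2 * s) ^+ 2))%:E)%E.
  refine (etrans (integral_cst _ mU _) _).
  refine (etrans (f_equal (fun a => (v%:E * a)%E) muU) _).
  by rewrite -EFinM mulrCA.
by rewrite -I3; exact: le_trans I2 I1.
Qed.
End SquaresArea.

(** * The two alternatives for the logarithm *)

Section Growth.
Context {R : realType}.
Local Notation plane := (@plane R).
Implicit Types (f g F : R[i] -> R[i]) (w z : R[i]).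

Lemma level_point g w : (forall z, cabs z <= cabs w -> ccont g z) ->
  forall t, complex.Re (g 0) <= t <= complex.Re (g w) ->
  exists2 p, cabs p <= cabs w & complex.Re (g p) = t.
Proof.
move=> cg t /andP[t0 tw]; pose h (x : R) := complex.Re (g (0 + x%:C * (w - 0))).
have seg x : 0 <= x <= 1 -> cabs (0 + x%:C * (w - 0)) <= cabs w.
  by move=> x01; have := @segment_ball R 0 w (cabs w) x; rewrite !subr0; apply.
have ch : rcont 0 1 h.
  have [] // := @pcont_comp R 0 1 g (fun x => 0 + x%:C * (w - 0)).
    exact: pcont_affine.
  by move=> x x01; apply: cg; exact: seg.
have h0 : h 0 = complex.Re (g 0) by rewrite /h mul0r addr0.
have h1 : h 1 = complex.Re (g w) by rewrite /h mul1r subr0 add0r.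
have [|x] := IVT ler01 (rcont_within ch) (v := t).
  by rewrite h0 h1; apply/andP; split; rewrite ?ge_min ?le_max ?t0 ?tw ?orbT.
by rewrite in_itv/= => x01 hx; exists (0 + x%:C * (w - 0)) => //; exact: seg.
Qed.

(** The first alternative of [gradient_dichotomy] near 0: [Re g - t] is bounded
    by [K] on the disc of radius [1 / 16] ([level_control]), so [g'] is bounded
    on the disc of radius [1 / 32] ([re_deriv_bound]), and [g 0 = 0]. *)
Lemma small_log g g' g'' t (p : R[i]) (K : R) : 0 < K ->
  (forall z, cabs z < 1 -> cderiv g z (g' z)) ->
  (forall z, cabs z < 1 -> cderiv g' z (g'' z)) ->
  cabs p <= 1 / 16 -> complex.Re (g p) = t -> g 0 = 0 ->
  (forall z, cabs z <= 1 / 2 -> complex.Re (g z) = t -> (1 / 2 - cabs z) * cabs (g' z) <= K) ->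
  forall z, cabs z <= 1 / 32 -> cabs (g z) <= 20 * 64 * K * cabs z.
Proof.
move=> K0 dg dg' pr gp g0 HK z zr.
have s0 : 0 < 1 / 16 :> R by lra.
have hg r : r < 1 -> hol g g' 0 r by move=> r1 v; rewrite subr0 => vr; apply: dg; lra.
have lev v : cabs (v - 0) <= 1 / 16 -> `|complex.Re (g v) - t| <= K.
  move=> vr; have -> : K = 4 * (4 * K) * (1 / 16) by field.
  apply: (@level_control _ g g' 0 (1 / 16) (4 * K) t p v s0) => //.
  - by apply: hg; lra.
  - by rewrite subr0.
  - move=> u; rewrite subr0 => ur gu.
    have H : (1 / 2 - cabs u) * cabs (g' u) <= K by apply: HK => //; lra.
    have {}H : 1 / 4 * cabs (g' u) <= K.
      apply: le_trans H; rewrite ler_wpM2r//; lra.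
    lra.
have gb v : cabs (v - 0) <= 1 / 32 -> cabs (g' v) <= 16 * 16 * K.
  move=> vr; have -> : 16 * 16 * K = 16 * K / (1 / 16) by field.
  apply: (re_deriv_bound (t := t) (c := 0) s0 (g := g)) => //.
  - by apply: hg; lra.
  - by move=> u ur; apply: lev; rewrite ur.
  - lra.
have z00 : cabs (0 - 0 : R[i]) <= 1 / 32 by rewrite subrr cabs0; lra.
have := @near_affine _ g g' 0 (1 / 32) (2 * (16 * 16 * K)) z.
rewrite subr0 g0 subr0 => H; have {}H : cabs (g z - g' 0 * z) <= 2 * (2 * (16 * 16 * K)) * cabs z.
  apply: H => //.
  - by apply: hg; lra.
  - by move=> u; rewrite subr0 => ur; apply: cderiv_cont (dg' u _); lra.
  - move=> u ur; apply: (le_trans (cabsB _ _)); have := gb u ur; have := gb 0 z00; lra.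
rewrite -(subrK (g' 0 * z) (g z)); apply: (le_trans (cabsD _ _)); rewrite cabsM.
have H2 : cabs (g' 0) * cabs z <= 16 * 16 * K * cabs z by rewrite ler_wpM2r//; exact: gb.
set q := K * cabs z.
have -> : 20 * 64 * K * cabs z = 20 * 64 * q by rewrite /q; ring.
have E1 : 2 * (2 * (16 * 16 * K)) * cabs z = 4 * (16 * 16 * q) by rewrite /q; ring.
have E2 : 16 * 16 * K * cabs z = 16 * 16 * q by rewrite /q; ring.
rewrite {}E1 in H; rewrite {}E2 in H2; lra.
Qed.

Lemma lattice_far u (i j : int) : i != j -> 1 <= cabs (lattice u i - lattice u j : R[i]).
Proof.
move=> ij; apply: le_trans (Im_le _); rewrite cImD cImN /= -mulrBl normrM -rmorphB/=.
have pi2 : 2 <= pi :> R by exact: pi_ge2.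
have n1 : 1 <= `|(i - j)%:~R : R|.
  by rewrite -intr_norm (_ : 1 = 1%:~R)// ler_int -gtz0_ge1 normr_gt0 subr_eq0.
rewrite (ger0_norm (_ : 0 <= 2 * pi)); last by lra.
have : 2 * pi <= `|(i - j)%:~R : R| * (2 * pi) by rewrite ler_peMl//; lra.
by move=> H; apply: le_trans H; lra.
Qed.

(** The disc of centre [b / 2] and radius [b / 3] lies in the disc of centre 1
    and radius [lam]. *)
Lemma near_half (b lam : R) (E : R[i]) : 1 < lam -> 1 <= b <= lam ->
  cabs (E - (b / 2)%:C) <= b / 3 -> cabs (1 - E) < lam.
Proof.
move=> l1 /andP[b1 bl] HE.
have -> : 1 - E = (1 - b / 2)%:C - (E - (b / 2)%:C).
  by apply: ceqP; rewrite ?(cReD, cImD, cReN, cImN)/=; ring.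
apply: (le_lt_trans (cabsB _ _)); rewrite cabs_real.
have : `|1 - b / 2| < lam - b / 3 by rewrite ltr_norml; lra.
lra.
Qed.

(** The second alternative of [gradient_dichotomy].  Around [zs k] the function
    [cexp \o g] is close to [expR (t - ln 2) = b / 2], hence [cabs (f z) < M],
    and [cabs (f' z)] is at least of order [cabs w * b * N], that is of order
    [M * N].  The square of half side [(16 * N)^-1] around [zs k] therefore
    contributes a fixed multiple of [M ^+ 2], whatever [N].  The squares are
    disjoint because [g] sends them to neighbourhoods of points that are [2 pi]
    apart. *)
Lemma crossing_area f f' g g' w (M b t N : R) (j : int) (zs : nat -> R[i]) n :
  0 < cabs w < M -> 1 <= b -> cabs w * b <= M <= 2 * (cabs w * b) -> expR t = b ->
  (forall z, cabs z < 1 -> cderiv f z (f' z)) -> (forall z, cabs z < 1 -> ccont f' z) ->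
  (forall z, cabs z < 1 -> f z = w * (1 - cexp (g z))) ->
  (forall z, cabs z < 1 -> cabs (f' z) = cabs w * cabs (cexp (g z)) * cabs (g' z)) ->
  0 < N ->
  (forall k, (k < n)%N -> forall z, cabs (z - zs k) <= (8 * N)^-1 ->
        [/\ cabs z < 1, N / 2 <= cabs (g' z) & cabs (g z - lattice (t - ln 2) (j + k%:Z)) <= 1 / 4]) ->
  ((n%:R * (3 / (16 * 16) * M) ^+ 2)%:E <=
    \int[planar]_(p in preimage_disc f M) (cabs (f' (cpx p)) ^+ 2)%:E)%E.
Proof.
move=> /andP[w0 wM] b1 /andP[wbM Mwb] tb df cf' fE f'E N0 Hz.
have cf z : cabs z < 1 -> ccont f z by move=> /df; exact: cderiv_cont.
have M0 : 0 < M by exact: lt_trans wM.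
pose s : R := (16 * N)^-1.
have s0 : 0 < s by rewrite invr_gt0 mulr_gt0.
have sE : s = (8 * N)^-1 / 2 by rewrite /s; field; rewrite gt_eqF.
pose c k : plane := (complex.Re (zs k), complex.Im (zs k)).
have cE k : cpx (c k) = zs k by rewrite /c /cpx /=; case: (zs k).
have sq k q : (k < n)%N -> square_at (c k) s q ->
    [/\ cabs (cpx q) < 1, N / 2 <= cabs (g' (cpx q)) &
        cabs (g (cpx q) - lattice (t - ln 2) (j + k%:Z)) <= 1 / 4].
  by move=> kn; rewrite sE => /cabs_square_at; rewrite cE => /ltW; exact: Hz.
pose v : R := (cabs w * (b / 2 * (3 / 4)) * (N / 2)) ^+ 2.
have HA : ((n%:R * (v * (2 * s) ^+ 2))%:E <=
    \int[planar]_(p in preimage_disc f M) (cabs (f' (cpx p)) ^+ 2)%:E)%E.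
  refine (@area_squares R _ (fun p => cabs (f' (cpx p)) ^+ 2) v s n c _ _ _ _ _ _ _) => //.
  - exact: preimage_measurable.
  - apply: measurable_funX; apply: measurable_comp_cont => // z1 z2.
    by rewrite ler_norml cabsBge lerNl opprB cabsC cabsBge.
  - by move=> p; rewrite exprn_ge0.
  - by rewrite exprn_ge0// !mulr_ge0//; lra.
  - move=> k p kn kp; have [p1 gN gL] := sq k p kn kp.
    set h := g (cpx p) - _ in gL.
    have gE : g (cpx p) = h + lattice (t - ln 2) (j + k%:Z) by rewrite /h subrK.
    have eE : cexp (g (cpx p)) = cexp h * (b / 2)%:C.
      by rewrite gE cexpD cexp_lattice expRD expRN lnK ?posrE// tb.
    have b20 : 0 <= b / 2 by lra.
    split.
      split => //; rewrite fE// cabsM mulrC -ltr_pdivlMr//.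
      apply: (@near_half b); first by rewrite ltr_pdivlMr// mul1r.
        by rewrite b1 ler_pdivlMr// mulrC.
      have -> : cexp (g (cpx p)) - (b / 2)%:C = (cexp h - 1) * (b / 2)%:C.
        by rewrite eE mulrBl mul1r.
      rewrite cabsM cabs_real ger0_norm//.
      apply: (@le_trans _ _ (2 / 3 * (b / 2))); last by lra.
      by rewrite ler_wpM2r// cexp_near1.
    rewrite /v lerXn2r ?nnegrE//; first by rewrite !mulr_ge0//; lra.
    rewrite f'E// eE cabsM cabs_real (ger0_norm b20) cabs_cexp.
    have eh : 3 / 4 <= expR (complex.Re h).
      by have /andP[] := expR_small (le_trans (Re_le h) gL).
    apply: ler_pM => //; first by rewrite !mulr_ge0//; lra.
      by lra.
    by rewrite ler_pM2l// [leRHS]mulrC ler_wpM2l.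
  - move=> k l p kn ln kp lp; have [_ _ gk] := sq k p kn kp; have [_ _ gl] := sq l p ln lp.
    apply: contrapT => kl.
    have : 1 <= cabs (lattice (t - exp.ln 2) (j + k%:Z) - lattice (t - exp.ln 2) (j + l%:Z) : R[i]).
      by apply: lattice_far; rewrite (inj_eq (addrI j)) eqz_nat; apply/eqP.
    rewrite -(subrKA (g (cpx p))) => H; have := le_trans H (cabsD _ _); rewrite cabsC; lra.
apply: le_trans HA; rewrite lee_fin ler_wpM2l// -exprMn lerXn2r ?nnegrE//.
- by rewrite mulr_ge0//; lra.
- by rewrite !mulr_ge0//; lra.
have -> : cabs w * (b / 2 * (3 / 4)) * (N / 2) * (2 * s) = 3 / 128 * (cabs w * b).
  by rewrite /s; field; rewrite gt_eqF.
lra.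
Qed.
End Growth.

(** * The growth bound *)

Section Conclusion.
Context {R : realType}.

(** With [F = 1 - f / w] for an omitted value [w] and [lam = M / cabs w], the
    inequality [cabs (f z) >= M] reads [cabs (1 - F z) >= lam].  The level
    [b = max 1 (lam - 1)] is one that [cabs F] has to reach before [z0] if
    [cabs (f z0) >= M], and it is comparable to [lam]. *)
Theorem growth_bound : exists r0 : R, [/\ 0 < r0, r0 < 1 &
  forall (f f' : R[i] -> R[i]) (M : R),
    (forall z, cabs z < 1 -> cderiv f z (f' z)) -> f 0 = 0 -> 0 < M ->
    (\int[planar]_(p in preimage_disc f M) (cabs (f' (cpx p)) ^+ 2)%:E < (pi * M ^+ 2)%:E)%E ->
    forall z, cabs z < r0 -> cabs (f z) < M].
Proof.
(* [n] contributions [(3 * M / 256) ^+ 2] add up to at least [4 * M ^+ 2]. *)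
pose n := (Num.truncn (4 * (16 * 16 * 32) : R)).+1.
have n0 : 4 * (16 * 16 * 32) <= n%:R :> R by apply: ltW; exact: truncnS_gt.
have [K K0 dich] := @gradient_dichotomy R n.
have D0 : 0 < 4 * (20 * 64 * K) by rewrite !mulr_gt0.
(* The second bound makes [cabs (g z0) <= 1 / 4] in the first alternative. *)
pose r0 := Num.min (1 / 32) (4 * (20 * 64 * K))^-1.
have r00 : 0 < r0 by rewrite lt_min invr_gt0 D0 andbT; lra.
have : r0 <= r0 by []. rewrite {2}/r0 le_min => /andP[r0a r0b].
exists r0; split => //; first by lra.
move=> f f' M df f0 M0 area z0 z0r.
have [f'' df'] := analytic_deriv df.
have cf' z : cabs z < 1 -> ccont f' z by move=> /df'; exact: cderiv_cont.
have [w wM fw] := omitted_value M0 df cf' area.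
have w0 : w != 0.
  by apply/negP => /eqP wE; apply: (fw 0); rewrite ?cabs0 ?f0.
have cw0 : 0 < cabs w by rewrite cabs_gt0.
have cwn : cabs w != 0 by rewrite gt_eqF.
pose F z := 1 - w^-1 * f z; pose F' z := - (w^-1 * f' z); pose F'' z := - (w^-1 * f'' z).
have dF z : cabs z < 1 -> cderiv F z (F' z).
  move=> z1; have := cderivB (cderiv_cst 1 z) (cderivZ w^-1 (df z z1)).
  by rewrite sub0r.
have dF' z : cabs z < 1 -> cderiv F' z (F'' z).
  by move=> z1; apply: cderivN; apply: cderivZ; exact: df'.
have F0 z : cabs z < 1 -> F z != 0.
  move=> z1; rewrite subr_eq0; apply/eqP => E; apply: (fw z z1).
  by rewrite -[f z](mulVKf w0) -E mulr1.
have F01 : F 0 = 1 by rewrite /F f0 mulr0 subr0.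
have [g [dg g0 FE]] := log_exists dF dF' F0 F01 ltr01.
have [g'' dg'] := analytic_deriv dg.
have fE z : cabs z < 1 -> f z = w * (1 - cexp (g z)).
  by move=> z1; rewrite -FE// /F opprB addrC subrK mulVKf.
have f'E z : cabs z < 1 -> cabs (f' z) = cabs w * cabs (cexp (g z)) * cabs (F' z / F z).
  move=> z1; rewrite -FE// -!cabsM -mulrA [F z * _]mulrC divfK; last exact: F0.
  by rewrite /F' mulrN cabsN mulVKf.
rewrite ltNge; apply/negP => Mf.
have z01 : cabs z0 < 1 by lra.
pose lam := M / cabs w.
have lam1 : 1 < lam by rewrite ltr_pdivlMr// mul1r.
have lamF : lam <= cabs (1 - F z0).
  by rewrite /F opprB addrC subrK cabsM cabsV ler_pdivrMr// mulrC mulrA mulfV// mul1r.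
have Flam : lam - 1 <= cabs (F z0).
  by have := cabsB 1 (F z0); rewrite cabs1; lra.
pose b := Num.max 1 (lam - 1).
have b1 : 1 <= b by rewrite le_max lexx.
have blam : b <= lam by rewrite ge_max (ltW lam1); lra.
have lamb : lam <= 2 * b.
  have : lam - 1 <= b by rewrite le_max lexx orbT.
  lra.
pose t := ln b.
have tb : expR t = b by rewrite lnK// posrE; lra.
have t0 : 0 <= t by rewrite ln_ge0.
have cg z : cabs z < 1 -> ccont g z by move=> /dg; exact: cderiv_cont.
have [p pz gp] : exists2 p, cabs p <= cabs z0 & complex.Re (g p) = t.
  have [lam2|lam2] := leP (lam - 1) 1.
    exists 0; first by rewrite cabs0.
    by rewrite g0 /t /b max_l// ln1.
  apply: level_point; first by move=> z zz; apply: cg; lra.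
  rewrite g0 t0/= -ler_expR tb -cabs_cexp -FE//.
  by apply: le_trans Flam; rewrite ge_max lexx andbT; lra.
have p2 : cabs p <= 1 / 2 by lra.
case: (dich g (fun z => F' z / F z) g'' t p dg dg' p2 gp) => [HK|[N [j [zs [N0 Hz]]]]].
  have p16 : cabs p <= 1 / 16 by lra.
  have z32 : cabs z0 <= 1 / 32 by lra.
  have H := small_log K0 dg dg' p16 gp g0 HK z32.
  have {}H : cabs (g z0) <= 1 / 4.
    apply: (le_trans H); apply: (@le_trans _ _ (20 * 64 * K * (4 * (20 * 64 * K))^-1)).
      by rewrite ler_wpM2l ?mulr_ge0 ?(ltW K0)//; lra.
    rewrite le_eqVlt; apply/orP; left; apply/eqP; field; by rewrite gt_eqF.
  have := cexp_near1 H; rewrite -FE// cabsC; lra.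
have wb : cabs w * b <= M <= 2 * (cabs w * b).
  move: blam lamb; rewrite /lam ler_pdivlMr// ler_pdivrMr// => h1 h2.
  by rewrite [cabs w * b]mulrC h1/= mulrA.
have wwM : 0 < cabs w < M by rewrite cw0.
have HA := crossing_area wwM b1 wb tb df cf' fE f'E N0 Hz.
have := le_lt_trans HA area; rewrite lte_fin ltNge => /negP; apply.
have pi4 : pi <= 4 :> R by have := @pihalf_lt2 R; lra.
apply: (@le_trans _ _ (4 * M ^+ 2)); first by rewrite ler_wpM2r// exprn_ge0// ltW.
rewrite exprMn [leRHS]mulrA; apply: ler_wpM2r; first by rewrite exprn_ge0// ltW.
apply: (@le_trans _ _ (4 * (16 * 16 * 32) * (3 / (16 * 16)) ^+ 2)).
  rewrite expr2; lra.
by rewrite ler_wpM2r// exprn_ge0//; lra.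
Qed.
End Conclusion.

Theorem theorem1p1 (R : realType) :
  exists r0 : R, [/\ 0 < r0, r0 < 1 &
    forall (f : R[i] -> R[i]) (M : R),
      analytic_on (disk 1) f -> f 0 = 0 -> 0 < M ->
      (image_area f M < (pi * M ^+ 2)%:E)%E ->
      f @` disk r0 `<=` disk M].
Proof.
have [r0 [r00 r01 H]] := @growth_bound R.
exists r0; split => // f M fa f0 M0 area _ [z z0 <-].
have diskE (r : R) v : disk r v <-> cabs v < r by rewrite /disk /= normE ltcR.
apply/diskE; apply: (H f (complex_derive f)) => //; last exact/diskE.
  by move=> v /diskE; move/fa; exact: derivable_cderiv.
move: area; rewrite /image_area.
rewrite (_ : [set p : R * R | sublevel f M (p.1 +i* p.2)] = preimage_disc f M).
  congr (_ < _)%E; apply: eq_integral => p _.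
  by rewrite normE -rmorphXn.
apply/seteqP; split => p [/diskE p1]; rewrite ?normE ?ltcR => p2; split => //.
  by apply/diskE.
Qed.
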